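(* Let $G$ be a locally compact Abelian group and let $\omega$ be a weight on $G$. Define, for $t\in G$, $$\widehat\omega(t)=\limsup_{s\to\infty}\frac{\omega(ts)}{\omega(s)}:=\inf_{K}\ \sup_{s\in G\setminus K}\frac{\omega(ts)}{\omega(s)},$$ where the infimum is taken over all compact subsets $K$ of $G$. If there is a constant $m>0$ such that $$\liminf_{n\to\infty}\frac{\omega(t^n)\,\widehat\omega(t^{-n})}{n}\le m\quad\text{for all } t\in G,$$ then the Beurling algebra $L^1(G,\omega)$ is $2$-weakly amenable.
   Context: A weight on a locally compact group $G$ is a continuous function $\omega: G\to(0,\infty)$ with $\omega(st)\le\omega(s)\omega(t)$ for all $s,t\in G$. $L^1(G,\omega)=\{f: f\omega\in L^1(G)\}$, where $f\omega$ is the pointwise product and integrals are taken against a fixed left Haar measure; with the norm $\|f\|_\omega=\int_G|f(t)|\omega(t)\,dt$ and convolution product it is a Banach algebra, called a Beurling algebra. For a Banach algebra $A$ and a Banach $A$-bimodule $X$, a derivation $D:A\to X$ is a linear map with $D(ab)=a\cdot D(b)+D(a)\cdot b$ for all $a,b\in A$; it is inner if there is $x\in X$ with $D(a)=a\cdot x-x\cdot a$ for all $a\in A$. The dual $X^*$ is a Banach $A$-bimodule via $\langle x,a\cdot f\rangle=\langle x\cdot a,f\rangle$ and $\langle x,f\cdot a\rangle=\langle a\cdot x,f\rangle$; iterating, all iterated duals of $A$ are Banach $A$-bimodules. $A$ is $2$-weakly amenable if every continuous derivation from $A$ into its second dual $A^{**}$ is inner. *)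

(* Defs.v *)
From HB Require Import structures.
From mathcomp Require Import all_boot all_order all_algebra generic_quotient.
From mathcomp Require Import complex.
From mathcomp Require Import all_classical all_reals all_analysis.
From mathcomp Require Import measurable_realfun ring lra.

Set Implicit Arguments.
Unset Strict Implicit.
Unset Printing Implicit Defensive.

Import Order.TTheory GRing.Theory Num.Theory.
Import numFieldNormedType.Exports.

Local Open Scope classical_set_scope.
Local Open Scope ring_scope.
Local Open Scope complex_scope.
Local Open Scope quotient_scope.

Notation normc := ComplexField.Normc.normc.

Lemma normcE (R : realType) (z : R[i]) : `|z| = (normc z)%:C.
Proof. by case: z. Qed.

Lemma normc_ge0 (R : realType) (z : R[i]) : 0 <= normc z.
Proof. by case: z => a b /=; exact: sqrtr_ge0. Qed.

Lemma ge0_ReK (R : realType) (z : R[i]) : 0 <= z -> (complex.Re z)%:C = z.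
Proof. by move=> z0; rewrite RRe_real// ger0_real. Qed.

Lemma real_complexM (R : realType) (x y : R) : (x * y)%:C = x%:C * y%:C.
Proof. exact: rmorphM. Qed.

Lemma real_complexD (R : realType) (x y : R) : (x + y)%:C = x%:C + y%:C.
Proof. exact: rmorphD. Qed.

Section dual.
Variables (R : realType) (X : normedModType R[i]).

Definition dual_pred : {pred X -> R[i]^o} :=
  [pred f : X -> R[i]^o | `[< linear f /\ continuous f >]].

Lemma dual_predP (f : X -> R[i]^o) :
  reflect (linear f /\ continuous f) (f \in dual_pred).
Proof. exact: asboolP. Qed.

Lemma dual_submod : submod_closed dual_pred.
Proof.
split=> [|c f g /dual_predP[fl fc] /dual_predP[gl gc]]; apply/dual_predP.
  split=> [a x y|x]; first by rewrite /= scaler0 addr0.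
  exact: cvg_cst.
split=> [a x y|x].
  rewrite !fctE fl gl.
  by rewrite -![_ *: _]/(_ * _) !mulrDr !mulrA [c * a]mulrC; ring.
by apply: cvgD; [apply: cvgZr; exact: fc|exact: gc].
Qed.

HB.instance Definition _ :=
  GRing.isSubmodClosed.Build _ _ dual_pred dual_submod.

Record dual := Dual {
  dual_fun :> X -> R[i]^o;
  dual_funP : dual_fun \in dual_pred }.

HB.instance Definition _ := [isSub for dual_fun].
HB.instance Definition _ := [Choice of dual by <:].
HB.instance Definition _ := [SubChoice_isSubLmodule of dual by <:].

Lemma dualP (f g : dual) : f =1 g -> f = g.
Proof. by move=> fg; apply/val_inj/funext. Qed.

Lemma dual_bounded (f : dual) :
  exists M : R, forall x, normc (f x) <= M * complex.Re `|x|.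
Proof.
have /dual_predP[fl fc] := dual_funP f.
pose F : {linear X -> R[i]^o} :=
  HB.pack (dual_fun f) (GRing.isLinear.Build _ _ _ _ (dual_fun f) fl).
have /linear_boundedP : bounded_near F (nbhs 0).
  by apply: continuous_linear_bounded; exact: fc.
move=> /pinfty_ex_gt0[M M0 FM]; exists (complex.Re M) => x.
rewrite -lecR real_complexM ge0_ReK ?(ltW M0)// ge0_ReK//.
by have := FM x; rewrite normcE.
Qed.

Definition opnorm (f : dual) : R :=
  sup [set normc (f x) | x in [set x : X | `|x| <= 1]].

Lemma opnorm_has_sup (f : dual) :
  has_sup [set normc (f x) | x in [set x : X | `|x| <= 1]].
Proof.
split; first by exists (normc (f 0)), 0 => //=; rewrite normr0 ler01.
have [M fM] := dual_bounded f; exists `|M| => _ [x /= x1 <-].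
apply: le_trans (fM x) _.
have xR : 0 <= complex.Re `|x| by rewrite -ler0c ge0_ReK.
have {}x1 : complex.Re `|x| <= 1 by rewrite -lecR ge0_ReK.
apply: (@le_trans _ _ (`|M| * complex.Re `|x|)).
  by rewrite ler_wpM2r// ler_norm.
by rewrite -[leRHS]mulr1 ler_wpM2l.
Qed.

Lemma opnorm_ge0 f : 0 <= opnorm f.
Proof.
apply: le_trans (normc_ge0 (f 0)) _.
apply: sup_upper_bound; first exact: opnorm_has_sup.
by exists 0 => //=; rewrite normr0 ler01.
Qed.

Lemma opnorm_le (f : dual) M :
  (forall x, `|x| <= 1 -> normc (f x) <= M) -> opnorm f <= M.
Proof.
move=> fM; apply: ge_sup; first by case: (opnorm_has_sup f).
by move=> _ [x /= x1 <-]; exact: fM.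
Qed.

Lemma opnorm_unit (f : dual) x : `|x| <= 1 -> normc (f x) <= opnorm f.
Proof.
move=> x1; apply: sup_upper_bound; first exact: opnorm_has_sup.
by exists x.
Qed.

Lemma dualZ (f : dual) a x : f (a *: x) = a * f x.
Proof.
have /dual_predP[fl _] := dual_funP f.
by have := fl a x 0; have := fl (-1) 0 0;
   rewrite !addr0 scaler0 scaleN1r addNr => -> ->; rewrite addr0.
Qed.

Lemma opnormP (f : dual) x : normc (f x) <= opnorm f * complex.Re `|x|.
Proof.
have [->|x0] := eqVneq x 0.
  have -> : f 0 = 0 by rewrite -(scale0r (0 : X)) dualZ mul0r.
  by rewrite ComplexField.Normc.normc0 normr0 mulr0.
have n0 : `|x| != 0 by rewrite normr_eq0.
have := @opnorm_unit f (`|x|^-1 *: x).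
rewrite normrZ normfV normr_id mulVf// lexx => /(_ isT).
rewrite dualZ ComplexField.Normc.normcM -lecR real_complexM -normcE normfV normr_id.
rewrite ler_pdivrMl ?normr_gt0// => h.
by rewrite -lecR real_complexM ge0_ReK// mulrC.
Qed.

Definition dual_norm (f : dual) : R[i] := (opnorm f)%:C.

Lemma dual_normD f g : dual_norm (f + g) <= dual_norm f + dual_norm g.
Proof.
rewrite /dual_norm -real_complexD lecR; apply: opnorm_le => x x1.
apply: le_trans (le_normcD (f x) (g x)) _.
by apply: lerD; exact: opnorm_unit.
Qed.

Lemma dual_normZ c f : dual_norm (c *: f) = `|c| * dual_norm f.
Proof.
rewrite /dual_norm normcE -real_complexM; congr _%:C.
have le d (g : dual) : opnorm (d *: g) <= normc d * opnorm g.
  apply: opnorm_le => x x1; rewrite [X in normc X]/(d * g x).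
  by rewrite ComplexField.Normc.normcM ler_wpM2l ?normc_ge0// opnorm_unit.
apply/le_anti; rewrite le/=.
have [->|c0] := eqVneq c 0.
  by rewrite ComplexField.Normc.normc0 mul0r opnorm_ge0.
have nc0 : 0 < normc c.
  rewrite lt_neqAle normc_ge0 andbT eq_sym.
  by apply: contra c0 => /eqP/ComplexField.Normc.eq0_normc ->.
rewrite -ler_pdivlMl// -ComplexField.Normc.normcV.
by apply: le_trans (le _ _); rewrite scalerA mulVf// scale1r.
Qed.

Lemma dual_norm_eq0 f : dual_norm f = 0 -> f = 0.
Proof.
move=> /complexI f0; apply/dualP => x.
apply: ComplexField.Normc.eq0_normc; apply/le_anti.
by rewrite normc_ge0 andbT; have := opnormP f x; rewrite f0 mul0r.
Qed.

HB.instance Definition _ :=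
  Lmodule_isNormed.Build R[i] dual dual_normD dual_normZ dual_norm_eq0.

End dual.
Arguments dual {R} X.

(** [A] stands for the underlying normed space of a Banach algebra, and the
    actions and the product are passed as functions.  [insubd 0 f] is [f]
    itself as soon as [f] is linear and continuous, which is the case below
    whenever the action (or the product) is bounded and linear, as in any
    Banach bimodule; the default value [0] is never used then. *)
Section amenability.
Variables (R : realType) (A : normedModType R[i]).

Section bimodule.
Variable X : normedModType R[i].
Implicit Types (lact : A -> X -> X) (ract : X -> A -> X).

Definition dual_lact ract (a : A) (f : dual X) : dual X :=
  insubd 0 (fun x => f (ract x a)).

Definition dual_ract lact (f : dual X) (a : A) : dual X :=
  insubd 0 (fun x => f (lact a x)).

Definition derivation (mul : A -> A -> A) lact ract (D : A -> X) :=
  linear D /\ forall a b, D (mul a b) = lact a (D b) + ract (D a) b.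

Definition inner lact ract (D : A -> X) :=
  exists x, forall a, D a = lact a x - ract x a.

End bimodule.

Variable mul : A -> A -> A.

Definition lact1 : A -> dual A -> dual A := dual_lact mul.
Definition ract1 : dual A -> A -> dual A := dual_ract mul.
Definition lact2 : A -> dual (dual A) -> dual (dual A) := dual_lact ract1.
Definition ract2 : dual (dual A) -> A -> dual (dual A) := dual_ract lact1.

Definition two_weakly_amenable :=
  forall D : A -> dual (dual A), continuous D ->
    derivation mul lact2 ract2 D -> inner lact2 ract2 D.

End amenability.

(** [topologicalZmodType] does not include a distinguished point, which the
    library requires of the base type of [g_sigma_algebraType]; the alias
    [pointed_group G] adds [0] as this point. *)
Definition pointed_group (G : topologicalZmodType) : Type := G.
HB.instance Definition _ (G : topologicalZmodType) :=
  TopologicalZmodule.on (pointed_group G).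
HB.instance Definition _ (G : topologicalZmodType) :=
  isPointed.Build (pointed_group G) (0 : G).

Definition borel (G : topologicalZmodType) :=
  g_sigma_algebraType (@open (pointed_group G)).

Section beurling.
Variables (R : realType) (G : topologicalZmodType).

(** Nonzero translation-invariant Radon measures. *)
Definition haar_measure (mu : {measure set (borel G) -> \bar R}) :=
  [/\ (exists A : set (borel G), measurable A /\ mu A != 0%E),
      (forall (t : G) (A : set (borel G)), measurable A ->
         mu [set t + s | s in A] = mu A),
      (forall K : set G, compact K -> (mu K < +oo)%E),
      (forall A : set (borel G), measurable A ->
         mu A = ereal_inf [set mu U | U in [set U | @open G U /\ A `<=` U]]) &
      (forall U : set G, open U ->
         mu U = ereal_sup [set mu K | K in [set K | @compact G K /\ K `<=` U]])].

Record weight := Weight {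
  weight_fun :> G -> R;
  weight_continuous : continuous weight_fun;
  weight_gt0 : forall t, 0 < weight_fun t;
  weight_submul : forall s t, weight_fun (s + t) <= weight_fun s * weight_fun t }.

(** The supremum is taken in [\bar R].  It is over the empty set, hence [-oo],
    only if [K = G], which happens only for compact [G]. *)
Definition weight_hat (w : weight) (t : G) : \bar R :=
  ereal_inf [set ereal_sup [set (w (t + s) / w s)%:E | s in ~` K] |
             K in [set K : set G | compact K]].

Variable mu : {measure set (borel G) -> \bar R}.

Definition cintegrable (f : borel G -> R[i]) :=
  mu.-integrable setT (fun t => (complex.Re (f t))%:E) /\
  mu.-integrable setT (fun t => (complex.Im (f t))%:E).

Definition cintegral (f : borel G -> R[i]) : R[i] :=
  (\int[mu]_(t in setT) complex.Re (f t)) +i*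
  (\int[mu]_(t in setT) complex.Im (f t)).

Definition convolution (f g : G -> R[i]) (t : G) : R[i] :=
  cintegral (fun s => f s * g (t - s)).

Variable w : weight.

Definition L1w_pred : {pred G -> R[i]^o} :=
  [pred f : G -> R[i]^o | `[< cintegrable (fun t => f t * (w t)%:C) >]].

Lemma cintegrableD f g : cintegrable f -> cintegrable g ->
  cintegrable (fun t => f t + g t).
Proof.
move=> [rf jf] [rg jg]; split.
- apply: eq_integrable (integrableD measurableT rf rg) => //.
  by move=> t _ /=; case: (f t) (g t) => [a b] [c d].
- apply: eq_integrable (integrableD measurableT jf jg) => //.
  by move=> t _ /=; case: (f t) (g t) => [a b] [c d].
Qed.

Lemma cintegrableZ k f : cintegrable f -> cintegrable (fun t => k * f t).
Proof.
move=> [rf jf]; split.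
- apply: eq_integrable (integrableB measurableT
    (integrableZl measurableT (complex.Re k) rf)
    (integrableZl measurableT (complex.Im k) jf)) => //.
  by move=> t _ /=; case: (f t) k => [a b] [c d].
- apply: eq_integrable (integrableD measurableT
    (integrableZl measurableT (complex.Re k) jf)
    (integrableZl measurableT (complex.Im k) rf)) => //.
  by move=> t _ /=; case: (f t) k => [a b] [c d].
Qed.

Lemma cintegrable_normc f : cintegrable f ->
  mu.-integrable setT (fun t => (normc (f t))%:E).
Proof.
move=> [rf jf].
have mr := measurable_int _ rf; have mj := measurable_int _ jf.
have {}mr : measurable_fun setT (fun t => complex.Re (f t)).
  exact/measurable_EFinP.
have {}mj : measurable_fun setT (fun t => complex.Im (f t)).
  exact/measurable_EFinP.
apply: le_integrable (integrableD measurableT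
  (integrable_abse rf) (integrable_abse jf)) => //.
  apply/measurable_EFinP.
  rewrite (_ : (fun t => _) = (fun t => Num.sqrt (complex.Re (f t) ^+ 2 +
    complex.Im (f t) ^+ 2))); last by apply/funext => t; case: (f t).
  apply: (measurableT_comp (f := @Num.sqrt R)).
    by apply: continuous_measurable_fun; exact: sqrt_continuous.
  by apply: measurable_funD; exact: measurable_funX.
move=> t _ /=; case: (f t) => a b /=.
rewrite lee_fin ger0_norm ?sqrtr_ge0// ger0_norm ?addr_ge0//.
rewrite -(@ler_pXn2r _ 2)// ?nnegrE ?sqrtr_ge0 ?addr_ge0//.
rewrite sqr_sqrtr ?addr_ge0 ?sqr_ge0//.
have ab : 0 <= `|a| * `|b| by rewrite mulr_ge0.
by rewrite sqrrD !real_normK ?num_real//; lra.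
Qed.

Lemma L1w_submod : submod_closed L1w_pred.
Proof.
split=> [|c f g /asboolP fL /asboolP gL]; apply/asboolP.
  rewrite (_ : (fun t => _) = (fun=> 0)); last first.
    by apply/funext => t; exact: mul0r.
  by split; exact: integrable0.
have := cintegrableD (cintegrableZ c fL) gL.
congr cintegrable; apply/funext => t /=.
by rewrite mulrDl mulrA.
Qed.

HB.instance Definition _ :=
  GRing.isSubmodClosed.Build _ _ L1w_pred L1w_submod.

(** Functions [f] with [f w] integrable, before passing to the quotient. *)
Record L1w := MkL1w { L1w_fun :> G -> R[i]^o; L1wP : L1w_fun \in L1w_pred }.

HB.instance Definition _ := [isSub for L1w_fun].
HB.instance Definition _ := [Choice of L1w by <:].
HB.instance Definition _ := [SubChoice_isSubLmodule of L1w by <:].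

Definition null_pred : {pred L1w} :=
  [pred f : L1w | `[< {ae mu, forall t : borel G, f t = 0} >]].

Lemma null_submod : submod_closed null_pred.
Proof.
split=> [|c f g /asboolP fL /asboolP gL]; apply/asboolP.
  exact: aeW.
by apply: filterS2 fL gL => t /= f0 g0; rewrite !fctE f0 g0 scaler0 addr0.
Qed.

HB.instance Definition _ :=
  GRing.isSubmodClosed.Build _ _ null_pred null_submod.

Definition beurling := Quotient.quot null_pred.
HB.instance Definition _ := GRing.Zmodule.on beurling.
HB.instance Definition _ := EqQuotient.on beurling.

Definition beurling_scale (c : R[i]) (x : beurling) : beurling :=
  \pi_beurling (c *: repr x).
Definition beurling_norm (x : beurling) : R[i] :=
  (\int[mu]_(t in setT) (normc (repr x t) * w t))%:C.

Lemma beurling_eqP (f g : L1w) :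
  reflect {ae mu, forall t : borel G, f t = g t}
    (\pi_beurling f == \pi_beurling g).
Proof.
rewrite -Quotient.idealrBE; apply: (iffP (asboolP _)).
  by apply: filterS => t /= /eqP; rewrite subr_eq0 => /eqP.
by apply: filterS => t /= fg; rewrite !fctE fg subrr.
Qed.

Lemma repr_ae (f : L1w) :
  {ae mu, forall t : borel G, repr (\pi_beurling f) t = f t}.
Proof. by apply/beurling_eqP; rewrite reprK. Qed.

Lemma beurling_piD (f g : L1w) :
  \pi_beurling (f + g) = \pi_beurling f + \pi_beurling g.
Proof. by rewrite !piE. Qed.

Lemma beurling_piZ c (f : L1w) :
  \pi_beurling (c *: f) = beurling_scale c (\pi_beurling f).
Proof.
apply/eqP/beurling_eqP; apply: filterS (repr_ae f) => t /= ft.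
by rewrite !fctE ft.
Qed.

Lemma beurling_scaleA a b x :
  beurling_scale a (beurling_scale b x) = beurling_scale (a * b) x.
Proof. by elim/quotW: x => f; rewrite -(beurling_piZ b f) -(beurling_piZ a (b *: f))
  -(beurling_piZ _ f) scalerA. Qed.

Lemma beurling_scale1 : left_id 1 beurling_scale.
Proof. by elim/quotW=> f; rewrite -(beurling_piZ 1 f) scale1r. Qed.

Lemma beurling_scaleDr : right_distributive beurling_scale +%R.
Proof.
move=> a; elim/quotW=> f; elim/quotW=> g; rewrite -(beurling_piD f g).
by rewrite -(beurling_piZ a f) -(beurling_piZ a g) -(beurling_piZ a (f + g)) scalerDr beurling_piD.
Qed.

Lemma beurling_scaleDl x :
  {morph beurling_scale^~ x : a b / a + b}.
Proof.
by elim/quotW: x => f a b; rewrite -(beurling_piZ a f) -(beurling_piZ b f)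
  -(beurling_piZ (a + b) f) scalerDl beurling_piD.
Qed.

HB.instance Definition _ := GRing.Zmodule_isLmodule.Build R[i] beurling
  beurling_scaleA beurling_scale1 beurling_scaleDr beurling_scaleDl.

Lemma L1w_integrable (f : L1w) :
  mu.-integrable setT (fun t => (normc (f t) * w t)%:E).
Proof.
have /asboolP/cintegrable_normc := L1wP f; congr (integrable _ _ _).
apply/funext => t; congr (_%:E); rewrite ComplexField.Normc.normcM; congr (_ * _).
by rewrite /= expr0n/= addr0 sqrtr_sqr gtr0_norm// weight_gt0.
Qed.

Lemma beurling_norm_pi (f : L1w) :
  beurling_norm (\pi_beurling f) = (\int[mu]_(t in setT) (normc (f t) * w t))%:C.
Proof.
congr (_%:C); congr fine; apply: ae_eq_integral => //.
- by apply: measurable_int; exact: L1w_integrable.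
- by apply: measurable_int; exact: L1w_integrable.
- by apply: filterS (repr_ae f) => t ft _; rewrite ft.
Qed.

Lemma beurling_normD x y :
  beurling_norm (x + y) <= beurling_norm x + beurling_norm y.
Proof.
elim/quotW: x => f; elim/quotW: y => g; rewrite -(beurling_piD f g) !beurling_norm_pi.
rewrite -real_complexD lecR -RintegralD//; try exact: L1w_integrable.
apply: le_Rintegral => //; first exact: L1w_integrable.
  by apply: eq_integrable (integrableD measurableT
    (L1w_integrable f) (L1w_integrable g)).
move=> t _; rewrite -mulrDl ler_wpM2r ?(ltW (weight_gt0 w t))//.
exact: le_normcD.
Qed.

Lemma beurling_normZ c x : beurling_norm (c *: x) = `|c| * beurling_norm x.
Proof.
elim/quotW: x => f.
rewrite -[_ *: _]/(beurling_scale _ _) -(beurling_piZ c f) !beurling_norm_pi.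
rewrite normcE -real_complexM -RintegralZl//; last exact: L1w_integrable.
congr (_%:C); apply: eq_Rintegral => t _.
by rewrite mulrA -ComplexField.Normc.normcM.
Qed.

Lemma beurling_norm_eq0 x : beurling_norm x = 0 -> x = 0.
Proof.
elim/quotW: x => f; rewrite beurling_norm_pi => /complexI f0.
have iT := L1w_integrable f.
have nf t : 0 <= normc (f t) * w t.
  by rewrite mulr_ge0 ?normc_ge0// ltW// weight_gt0.
have : (\int[mu]_(t in setT) `|(normc (f t) * w t)%:E| = 0)%E.
  under eq_integral do rewrite gee0_abs ?lee_fin//.
  by rewrite -[LHS]fineK ?[fine _]f0//; exact: integrable_fin_num.
move/ae_eq_integral_abs => /(_ measurableT (measurable_int _ iT)) fae.
rewrite -[0]/(0 : beurling) (_ : 0 = \pi_beurling 0); last by rewrite !piE.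
apply/eqP/beurling_eqP; apply: filterS fae => t /(_ Logic.I) /= [] /eqP.
rewrite mulf_eq0 (gt_eqF (weight_gt0 _ _)) orbF => /eqP.
exact: ComplexField.Normc.eq0_normc.
Qed.

HB.instance Definition _ := Lmodule_isNormed.Build R[i] beurling
  beurling_normD beurling_normZ beurling_norm_eq0.

(** The class of [f], or [0] if [f w] is not integrable. *)
Definition beurling_class (f : G -> R[i]) : beurling :=
  \pi_beurling (insubd (0 : L1w) (f : G -> R[i]^o)).

(** If [f w] and [g w] are integrable then so is [convolution f g] times [w]. *)
Definition beurling_mul (x y : beurling) : beurling :=
  beurling_class (convolution (repr x) (repr y)).

End beurling.

(* Main.v *)
Require Import Defs.
From HB Require Import structures.
From mathcomp Require Import all_boot all_order all_algebra.
From mathcomp Require Import complex generic_quotient.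
From mathcomp Require Import all_classical all_reals all_analysis.
From mathcomp Require Import measurable_realfun ring lra.

Import Order.TTheory GRing.Theory Num.Theory.
Import numFieldNormedType.Exports.

Local Open Scope classical_set_scope.
Local Open Scope ring_scope.

Set Implicit Arguments.
Unset Strict Implicit.
Unset Printing Implicit Defensive.

(** Write [A] for L^1(G, w), [L t] for the translation of functions by [t],
    phi.b for the functional [x |-> phi (b x)] and phi.t for [x |-> phi (L t x)].
    As [A] is commutative, the two actions of [A] on its bidual agree, and one
    has to show that every continuous derivation [D] from [A] to its bidual is
    zero.

    The main object is the defect
      E_t(a)(psi) = D(L_t a)(psi.(-t)) - D(a)(psi)
    of [D] from being equivariant. By the Leibniz rule,
    E_t(a)(phi.b) = E_t(b)(phi.a) ([defect_swap]), and it follows that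
    E_t(a)(phi.b) is additive in [t] ([defectD]). On the other hand continuity of
    [D] bounds it by a multiple of w(t) |(phi.b).(-t)| + |phi.b|.
    Cut the functional into the part supported in a compact set [K] and the rest.
    For the first part w(t) |(phi.b).(-t)| is bounded in [t] by
    submultiplicativity of the weight, and an additive bounded function is zero
    ([defect_near]). For the rest, the growth condition provides, for each [t],
    an integer [n >= 1] and a set [K] with the bound (m + 1) n |phi| |b|
    at the point [n t] ([beurling_cutoff]); by additivity n |E_t| is at most a
    multiple of [n], so that E_t is bounded by a constant which does not depend
    on [t] ([defect_bounded]). Being additive in [t], it is zero. Thus [D] is
    equivariant under translations on the functionals phi.b, hence under
    convolution operators, which are limits of combinations of translations
    ([beurling_mul_approx], [D_module]): D(ca)(phi.b) = D(a)(phi.cb). The Leibniz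
    rule for D(ca) then leaves D(c)(phi.ba) = 0, and approximate units
    ([beurling_right_unit_approx]) give D = 0. The dual of [A] is never
    represented by functions: cutting is done on [A] and transposed. This
    argument is carried out in [translation_algebra_two_weakly_amenable].

    The rest establishes what it uses of the algebra L^1(G, w). The delicate
    point is Tonelli's theorem for (s, t) |-> f(s) g(t - s). As [G] may be neither
    second countable nor sigma-compact, addition may fail to be measurable for
    the product of the Borel sigma-algebras. Instead, the image of [mu] restricted
    to a compact set under s |-> (s, t - s) is shown to depend measurably on [t]
    (upper semicontinuity on closed rectangles, then Dynkin's lemma), and its
    integral over [t] to be the product measure: on rectangles this says that
    the integral over [t] of mu(F cap (t - C)) is mu(F) mu(C) for compact [F] and
    [C], which is proved by splitting [F] into small pieces
    ([integral_slice_compact], [tonelli_convolution]). Statements about general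
    elements of the algebra are reduced to indicators of compact sets by
    [density_ind]; for these, convolving with the indicator of a small set
    around [s] is nearly a multiple of the translation by [s]
    ([small_set_translate]). *)

(** * Topological groups and their Borel sets *)

Section group_topology.
Variable G : topologicalZmodType.
Implicit Types (t : G) (K U : set G).

Lemma addl_continuous t : continuous (fun s : G => t + s).
Proof.
move=> s; apply: (@continuous_comp _ _ _ (fun s : G => (t, s))
  (fun x : G * G => x.1 + x.2)); last exact: add_continuous.
by apply: cvg_pair; [exact: cvg_cst|exact: cvg_id].
Qed.

Lemma subr_continuous t : continuous (fun s : G => t - s).
Proof.
move=> s; apply: (@continuous_comp _ _ _ (fun s : G => (t, s))
  (fun x : G * G => x.1 - x.2)); last exact: sub_continuous.
by apply: cvg_pair; [exact: cvg_cst|exact: cvg_id].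
Qed.

Lemma addr_continuous t : continuous (fun s : G => s + t).
Proof.
move=> s; rewrite (_ : (fun s => _) = (fun s => t + s)); first exact: addl_continuous.
by apply/funext => x; rewrite addrC.
Qed.

Lemma open_preimage (T : topologicalType) (f : G -> T) (U : set T) :
  continuous f -> open U -> open (f @^-1` U).
Proof. by move/continuousP; exact. Qed.

Lemma nbhs_open U : (forall t, U t -> nbhs t U) -> open U.
Proof. by rewrite openE. Qed.

Definition setadd (A B : set G) := [set x + y | x in A & y in B].

Lemma compact_setadd (K L : set G) : compact K -> compact L -> compact (setadd K L).
Proof.
move=> cK cL.
have -> : setadd K L = (fun x : G * G => x.1 + x.2) @` (K `*` L).
  apply/seteqP; split => [_ [x Kx [y Ly <-]]|_ [[x y] [/= Kx Ly] <-]].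
    by exists (x, y).
  by exists x => //; exists y.
apply: continuous_compact; last exact: compact_setX.
by apply: continuous_subspaceT; exact: add_continuous.
Qed.

Lemma compact_opp K : compact K -> compact [set - x | x in K].
Proof.
move=> cK; apply: continuous_compact => //.
by apply: continuous_subspaceT; exact: opp_continuous.
Qed.

Lemma compact_addl t K : compact K -> compact [set t + x | x in K].
Proof.
move=> cK; apply: continuous_compact => //.
by apply: continuous_subspaceT; exact: addl_continuous.
Qed.

(** This and its symmetric version below stand in for the uniform structure:
    a compact subset of an open set stays inside it after a small translation. *)
Lemma compact_thicken K U : compact K -> open U -> K `<=` U ->
  \forall n \near (0 : G), forall x, K x -> U (x + n).
Proof.
move=> cK oU KU.
apply: (@compact_near_coveringP _ K).1 (cK) _ (nbhs (0:G))
  (fun n x => U (x + n)) _ _ => x Kx.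
have := @add_continuous G (x, 0) U; rewrite /= addr0.
by apply; exact: (open_nbhs_nbhs (conj oU (KU _ Kx))).
Qed.

Lemma compact_thicken_sym K U : compact K -> open U -> K `<=` U ->
  exists V : set G, [/\ open V, V 0 &
    forall c v, K c -> V v -> U (c + v) /\ U (c - v)].
Proof.
move=> cK oU KU; have N0 := compact_thicken cK oU KU.
have : nbhs (0 : G) ([set n | forall x, K x -> U (x + n)] `&`
    -%R @^-1` [set n | forall x, K x -> U (x + n)]).
  apply: filterI; first exact: N0.
  by apply: (@opp_continuous G 0); rewrite oppr0.
rewrite nbhsE => -[V [oV V0] VN]; exists V; split => // c v Kc /VN[/= h1 h2].
by split; [exact: h1|exact: h2].
Qed.

Lemma open_setadd (A U : set G) : open U -> open (setadd A U).
Proof.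
move=> oU; rewrite (_ : setadd A U = \bigcup_(a in A) (fun s => - a + s) @^-1` U).
  apply: bigcup_open => a _; apply: open_preimage => //; exact: addl_continuous.
apply/seteqP; split => [_ [a Aa [u Uu <-]]|x [a Aa /= Uax]].
  by exists a => //=; rewrite addrA addNr add0r.
by exists a => //; exists (- a + x) => //; rewrite addrA subrr add0r.
Qed.

End group_topology.

Section borel_structure.
Variable G : topologicalZmodType.
Hypothesis G_hausdorff : hausdorff_space G.

Lemma open_borel (U : set G) : open U -> measurable (U : set (borel G)).
Proof. by move=> oU; exact: sub_sigma_algebra. Qed.

Lemma closed_borel (U : set G) : closed U -> measurable (U : set (borel G)).
Proof. by move=> cU; rewrite -[U]setCK; apply: measurableC; apply: open_borel; exact: closed_openC. Qed.

Lemma compact_borel (U : set G) : compact U -> measurable (U : set (borel G)).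
Proof. by move=> cU; apply: closed_borel; exact: compact_closed. Qed.

Lemma continuous_borel (f : G -> G) : continuous f ->
  measurable_fun setT (f : borel G -> borel G).
Proof.
move=> cf; apply: (@measurability _ _ (borel G) (borel G) setT f (@open (pointed_group G))) => //.
move=> _ [U oU <-]; rewrite setTI; apply: open_borel.
by move/continuousP : cf; exact.
Qed.

Lemma continuous_borelR (R : realType) (f : G -> R) : continuous f ->
  measurable_fun setT (f : borel G -> R).
Proof.
move=> cf.
apply: (@measurability _ _ (borel G) R setT f _ (RGenOpens.measurableE R)) => _ [_ [a [b ->]] <-].
rewrite setTI; apply: open_borel.
by move/continuousP : cf; apply; exact: interval_open.
Qed.

End borel_structure.

(** * Haar measure *)

Section haar.
Variables (R : realType) (G : topologicalZmodType).
Hypothesis G_hausdorff : hausdorff_space G.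
Hypothesis G_locally_compact : locally_compact [set: G].
Variable mu : {measure set (borel G) -> \bar R}.
Hypothesis mu_haar : haar_measure mu.
Implicit Types (t : G) (K U : set G).

Lemma compact_nbhs0 : exists2 N : set G, nbhs 0 N & compact N.
Proof.
have [U U0 [cU _]] := @G_locally_compact 0 Logic.I.
by exists U => //; move: U0; rewrite withinET.
Qed.

Lemma borel_addl t (A : set (borel G)) : measurable A ->
  measurable ((fun s : G => t + s) @^-1` A : set (borel G)).
Proof.
move=> mA; rewrite -[X in measurable X]setTI.
by apply: (continuous_borel (@addl_continuous G t)).
Qed.

Lemma borel_subr t (A : set (borel G)) : measurable A ->
  measurable ((fun s : G => t - s) @^-1` A : set (borel G)).
Proof.
move=> mA; rewrite -[X in measurable X]setTI.
by apply: (continuous_borel (@subr_continuous G t)).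
Qed.

Lemma haar_addl t (A : set (borel G)) : measurable A ->
  mu ((fun s : G => t + s) @^-1` A : set (borel G)) = mu A.
Proof.
move=> mA; have [_ tr _ _ _] := mu_haar.
rewrite -(tr (- t) A mA); congr (mu _); apply/seteqP; split => [s /= As|_ /= [s As <-]].
  by exists (t + s) => //; rewrite addrA addNr add0r.
by rewrite addrA subrr add0r.
Qed.

Lemma haar_compact K : compact K -> (mu (K : set (borel G)) < +oo)%E.
Proof. by have [_ _ h _ _] := mu_haar; exact: h. Qed.

Lemma haar_outer (A : set (borel G)) (e : R) : measurable A -> (mu A < +oo)%E -> 0 < e ->
  exists U : set G, [/\ open U, A `<=` U & (mu (U `\` A : set (borel G)) < e%:E)%E].
Proof.
move=> mA Aoo e0; have [_ _ _ out _] := mu_haar.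
have mAf : mu A \is a fin_num by rewrite ge0_fin_numE.
have : (mu A < mu A + e%:E)%E by rewrite lteDl.
rewrite {1}out// => /ereal_inf_lt[_ [U [oU AU] <-]] Ue.
exists U; split => //; rewrite measureD//; last 2 first.
  exact: open_borel.
  by rewrite (lt_le_trans Ue)// leey.
rewrite setIidr// lteBlDl//.
Qed.

Lemma haar_inner_open U (e : R) : open U -> (mu (U : set (borel G)) < +oo)%E -> 0 < e ->
  exists K : set G, [/\ compact K, K `<=` U & (mu (U `\` K : set (borel G)) < e%:E)%E].
Proof.
move=> oU Uoo e0; have [_ _ _ _ inn] := mu_haar.
have mUf : mu (U : set (borel G)) \is a fin_num by rewrite ge0_fin_numE.
have : (mu (U : set (borel G)) - e%:E < mu (U : set (borel G)))%E.
  by rewrite lteBlDr// lteDl.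
rewrite {2}inn// => /ereal_sup_gt[_ [K [cK KU] <-]] Ke.
exists K; split => //; rewrite measureD//; last 2 first.
  exact: open_borel.
  exact: compact_borel.
have Koo := haar_compact cK.
have Kf : mu (K : set (borel G)) \is a fin_num by rewrite ge0_fin_numE.
by rewrite setIidr// lteBlDl// -lteBlDr.
Qed.

(** The definition of a Radon measure only gives inner regularity on open sets.
    To reach a Borel set [A] of finite measure, take a compact subset of an open
    set around [A] and remove from it an open set that barely exceeds the
    excess [U `\` A]. *)
Lemma haar_inner (A : set (borel G)) (e : R) : measurable A -> (mu A < +oo)%E -> 0 < e ->
  exists K : set G, [/\ compact K, K `<=` A & (mu (A `\` K : set (borel G)) < e%:E)%E].
Proof.
move=> mA Aoo e0; have e2 : 0 < e / 2 by rewrite divr_gt0.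
have [U [oU AU Ue]] := haar_outer mA Aoo e2.
have mU := open_borel oU.
have Uoo : (mu (U : set (borel G)) < +oo)%E.
  rewrite (measureDI _ mU mA) setIidr// lte_add_pinfty//.
  by rewrite (lt_trans Ue) ?ltry.
have [C [cC CU Ce]] := haar_inner_open oU Uoo e2.
have mC := compact_borel G_hausdorff cC.
have mUA : measurable (U `\` A : set (borel G)) by exact: measurableD.
have UAoo : (mu (U `\` A : set (borel G)) < +oo)%E by rewrite (lt_trans Ue) ?ltry.
have [V [oV UAV Ve]] := haar_outer mUA UAoo e2.
have mV := open_borel oV.
exists (C `\` V); split.
- apply: (subclosed_compact _ cC); last by move=> x [].
  by apply: closedI; [exact: (compact_closed G_hausdorff cC)|exact: open_closedC].
- by move=> x [Cx Vx]; apply: contrapT => Ax; apply: Vx; apply: UAV; split => //; exact: CU.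
- rewrite [e]splitr EFinD; apply: le_lt_trans (lteD Ce Ve).
  apply: le_trans (measureU2 _ _ _); last 2 first.
    exact: measurableD.
    exact: measurableD.
  rewrite le_measure ?inE//.
  + by apply: measurableD => //; apply: measurableD.
  + by apply: measurableU; apply: measurableD.
  move=> x [Ax] /not_andP [Cx|/contrapT Vx].
    by left; split => //; exact: AU.
  by right; split => //; case.
Qed.

Lemma compact_finite_cover K V : compact K -> open V -> V 0 ->
  exists2 l : seq G, {in l, forall s, K s} &
    K `<=` [set x | exists2 s, s \in l & V (x - s)].
Proof.
move=> cK0 oV V0; have cK : @cover_compact (pointed_group G) K by rewrite -(compact_cover (pointed_group G)).
have [||D DK KD] := cK G K (fun s => (fun x => x - s) @^-1` V).
- move=> s _; apply: open_preimage oV; exact: (@addr_continuous G (- s)).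
- by move=> x Kx; exists x => //=; rewrite subrr.
exists (finmap.enum_fset D) => [s /DK|]; first by rewrite inE.
by move=> x /KD [s /= Ds Vs]; exists s.
Qed.

(** If a nonempty open set were null, so would be every compact set, being
    covered by finitely many translates of it, hence [mu] by regularity. *)
Lemma haar_open_gt0 U : open U -> U !=set0 -> (0 < mu (U : set (borel G)))%E.
Proof.
move=> oU [x Ux]; rewrite lt_neqAle measure_ge0 andbT eq_sym; apply/eqP => U0.
have [[A [mA A0]] _ _ out inn] := mu_haar.
suff openW0 (W : set G) : open W -> mu (W : set (borel G)) = 0%E.
  move/eqP : A0; apply; apply/eqP; rewrite eq_le measure_ge0 andbT out//.
  by apply: ereal_inf_lbound; exists setT; [split => //; exact: openT|exact/openW0/openT].
move=> oW; rewrite inn//; apply/eqP; rewrite eq_le; apply/andP; split; last first.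
  by apply: ereal_sup_ubound; exists set0; [split => //; exact: compact0|rewrite measure0].
apply: ge_ereal_sup => _ [K [cK _] <-].
pose V := (fun s => x + s) @^-1` U.
have oV : open V by apply: open_preimage oU; exact: addl_continuous.
have mV : mu (V : set (borel G)) = 0%E by rewrite haar_addl//; exact: open_borel.
have [|l _ Kl] := compact_finite_cover cK oV; first by rewrite /V/= addr0.
have mVs s : measurable ((fun y : G => - s + y) @^-1` V : set (borel G)).
  by apply: borel_addl; exact: open_borel.
have h (l' : seq G) : mu (\big[setU/set0]_(s <- l') ((fun y : G => - s + y) @^-1` V) : set (borel G)) = 0%E.
  elim: l' => [|s l' IH]; first by rewrite big_nil measure0.
  rewrite big_cons null_set_setU//; last by rewrite haar_addl//; exact: open_borel.
  by apply: bigsetU_measurable => i _; exact: mVs.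
rewrite -(h l) le_measure ?inE//; first exact: compact_borel.
  by apply: bigsetU_measurable => i _; exact: mVs.
move=> y /Kl[s sl Vs]; rewrite -bigcup_seq; exists s => //=.
by rewrite addrC.
Qed.

(** Take compact sets [C n] exhausting an open set [U] around [E] up to measure
    0, and thicken them by a compact neighbourhood [N] of [0]. A point [x] of
    [U] missed by all [C n + N] would have a neighbourhood contained in
    [U `\` C n] for all [n], that is, a null open set. This confines integrable
    functions to sigma-compact sets in a group which is not sigma-compact. *)
Lemma finite_measure_sigma_compact (E : set (borel G)) : measurable E -> (mu E < +oo)%E ->
  exists K : nat -> set G, [/\ forall n, compact (K n),
    {homo K : m n / (m <= n)%N >-> m `<=` n} & E `<=` \bigcup_n K n].
Proof.
move=> mE Eoo; have [U [oU EU U1]] := haar_outer mE Eoo ltr01.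
have mU := open_borel oU.
have Uoo : (mu (U : set (borel G)) < +oo)%E.
  rewrite (measureDI _ mU mE) setIidr// lte_add_pinfty//.
  by rewrite (lt_trans U1) ?ltry.
have h (n : nat) : exists C : set G, [/\ compact C, C `<=` U &
    (mu (U `\` C : set (borel G)) < (n.+1%:R^-1)%:E)%E].
  by apply: haar_inner_open => //; rewrite invr_gt0.
have [C hC] := choice h.
have [N N0 cN] := compact_nbhs0.
exists (fun n => \bigcup_(k in `I_n.+1) setadd (C k) N); split.
- move=> n; rewrite (bigcup_mkord n.+1 (fun k => setadd (C k) N)).
  elim/big_ind : _ => [|A B|k _]; [exact: compact0|exact: compactU|].
  by apply: compact_setadd => //; have [] := hC k.
- move=> m n mn /=; apply: bigcup_sub => k /= km.
  by move=> x Kx; exists k => //=; exact: leq_trans mn.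
move=> x /EU Ux; apply: contrapT => xK.
pose W : set G := U `&` (fun s => x - s) @^-1` (interior N).
have oW : open W.
  apply: openI => //; apply: open_preimage; last exact: open_interior.
  exact: subr_continuous.
have : (0 < mu (W : set (borel G)))%E.
  by apply: haar_open_gt0 => //; exists x; split => //=; rewrite subrr; exact: N0.
apply/negP; rewrite -leNgt; apply/lee_addgt0Pr => e e0; rewrite add0e.
have [n /ltW ne] : exists n, n.+1%:R^-1 < e.
  have [n _ /(_ n (leqnn n))] := near_infty_natSinv_lt (PosNum e0).
  by exists n.
have [_ _ Cn] := hC n.
apply: le_trans (le_trans (ltW Cn) _); last by rewrite lee_fin.
rewrite le_measure ?inE//; first exact: open_borel.
  by apply: measurableD => //; apply: compact_borel => //; have [] := hC n.
move=> s [Us Ns]; split => // Cs; apply: xK; exists n => //.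
exists n => //=; exists s => //; exists (x - s).
  exact: interior_subset.
by rewrite addrC subrK.
Qed.

Lemma ge0_haar_integral_addl t (f : borel G -> \bar R) : measurable_fun setT f ->
  (forall s, 0 <= f s)%E ->
  (\int[mu]_(s in setT) f (t + s)%R = \int[mu]_(s in setT) f s)%E.
Proof.
move=> mf f0.
have mt : measurable_fun setT ((fun s : G => t + s) : borel G -> borel G).
  exact: (continuous_borel (@addl_continuous G t)).
transitivity (\int[pushforward mu ((fun s : G => (t + s)%R) : borel G -> borel G)]_(s in setT) f s)%E.
  by rewrite (ge0_integral_pushforward mt).
by apply: eq_measure_integral => A mA _; exact: haar_addl.
Qed.

Lemma haar_integral_addl t (f : borel G -> \bar R) : measurable_fun setT f ->
  (\int[mu]_(s in setT) f (t + s)%R = \int[mu]_(s in setT) f s)%E.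
Proof.
move=> mf; rewrite integralE [RHS]integralE.
have := ge0_haar_integral_addl t (measurable_funepos mf) (funepos_ge0 _).
have := ge0_haar_integral_addl t (measurable_funeneg mf) (funeneg_ge0 _).
move=> e1 e2; congr (_ - _)%E; [rewrite -e2|rewrite -e1];
  by apply: eq_integral => s _; rewrite ?/funepos ?/funeneg !unlock.
Qed.

End haar.

(** * Mixtures of measures *)

Section kernels.
Local Open Scope ereal_scope.
Context d d' (X : measurableType d) (Y : measurableType d') (R : realType).

(** Measurability in the parameter of a family of finite measures passes from a
    generating pi-system to the whole sigma-algebra. *)
Lemma kernel_dynkin (Gen : set (set Y)) (l : X -> {measure set Y -> \bar R}) :
  measurable = <<s Gen >> -> setI_closed Gen ->
  (forall x, l x setT < +oo) ->
  measurable_fun setT (fun x => l x setT) ->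
  (forall A, Gen A -> measurable_fun setT (fun x => l x A)) ->
  forall A, measurable A -> measurable_fun setT (fun x => l x A).
Proof.
move=> mG GI loo lT lG A; rewrite mG; move: A; apply: dynkin_induction => //.
- move=> A mA lA.
  rewrite (_ : (fun x => _) = (fun x => l x setT - l x A)); last first.
    by apply/funext => x; rewrite -setTD measureD ?setTI//; exact: loo.
  exact: emeasurable_funB.
- move=> F mF tF lF.
  rewrite (_ : (fun x => _) = (fun x => \sum_(n <oo) l x (F n))); last first.
    apply/funext => x; apply/esym/cvg_lim => //.
    by apply: measure_semi_sigma_additive => //; exact: bigcupT_measurable.
  by apply: ge0_emeasurable_sum => // n x _ _.
Qed.

Variables (m : {measure set X -> \bar R}) (l : X -> {measure set Y -> \bar R}).

Definition mixture (ml : forall U, measurable U -> measurable_fun setT (fun x => l x U))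
  (U : set Y) : \bar R := \int[m]_x l x U.

Hypothesis ml : forall U, measurable U -> measurable_fun setT (fun x => l x U).

Let mixture0 : mixture ml set0 = 0.
Proof. by rewrite /mixture (eq_integral (cst 0)) ?integral0// => y _; rewrite measure0. Qed.

Let mixture_ge0 U : 0 <= mixture ml U. Proof. exact: integral_ge0. Qed.

Let mixture_sigma_additive : semi_sigma_additive (mixture ml).
Proof.
move=> U mU tU mUU; rewrite [X in _ --> X](_ : _ =
  \int[m]_x (\sum_(n <oo) l x (U n))); last first.
  apply: eq_integral => V _.
  by apply/esym/cvg_lim => //; exact/measure_semi_sigma_additive.
apply/cvg_closeP; split.
  by apply: is_cvg_nneseries => n _ _; exact: integral_ge0.
by rewrite closeE// integral_nneseries// => n; exact: ml.
Qed.

HB.instance Definition _ := isMeasure.Build _ _ R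
  (mixture ml) mixture0 mixture_ge0 mixture_sigma_additive.

Import HBNNSimple.

Let integral_mixture_nnsfun (f : {nnsfun Y >-> R}) :
  \int[mixture ml]_z (f z)%:E = \int[m]_y (\int[l y]_z (f z)%:E).
Proof.
under [RHS]eq_integral do rewrite integralT_nnsfun sintegralE.
rewrite integralT_nnsfun sintegralE.
rewrite ge0_integral_fsum//; last 2 first.
  - by move=> r; apply: measurable_funeM; exact: ml.
  - by move=> r y _; exact: nnsfun_mulemu_ge0.
apply: eq_fsbigr => r _.
have [r0|r0] := leP 0%R r.
  by rewrite ge0_integralZl//; exact: ml.
rewrite preimage_nnfun0// measure0 mule0 integral0_eq// => y _.
by rewrite measure0 mule0.
Qed.

Lemma integral_mixture (f : Y -> \bar R) : (forall z, 0 <= f z) ->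
  measurable_fun setT f ->
  \int[mixture ml]_z f z = \int[m]_y (\int[l y]_z f z).
Proof.
move=> f0 mf.
pose f_ := nnsfun_approx measurableT mf.
have lim (mm : {measure set Y -> \bar R}) :
    \int[mm]_z f z = lim ((\int[mm]_z (f_ n z)%:E) @[n --> \oo]).
  rewrite -monotone_convergence//; last 3 first.
    by move=> n; exact/measurable_EFinP.
    by move=> n z _; rewrite lee_fin.
    by move=> z _ a b ab; rewrite lee_fin; exact/lefP/nd_nnsfun_approx.
  by apply/eq_integral => z _; apply/esym/cvg_lim => //=; exact: cvg_nnsfun_approx.
rewrite lim; under eq_fun do rewrite integral_mixture_nnsfun.
rewrite -monotone_convergence//; last 3 first.
- move=> n; apply: measurable_fun_integral_kernel => //.
  + by move=> z; rewrite lee_fin.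
  + exact/measurable_EFinP.
- by move=> n y _; apply: integral_ge0 => // z _; rewrite lee_fin.
- move=> y _ a b ab; apply: ge0_le_integral => //.
  + by move=> z _; rewrite lee_fin.
  + exact/measurable_EFinP.
  + exact/measurable_EFinP.
  + by move=> z _; rewrite lee_fin; exact/lefP/nd_nnsfun_approx.
by apply: eq_integral => y _; rewrite lim.
Qed.

End kernels.

(** * Images of Haar measure under s |-> (s, t - s) *)

(** Closed rectangles form a pi-system on which measurability can be checked by
    semicontinuity. Since [G] may fail to be second countable, the sigma-algebra
    they generate may be smaller than that of the Borel sets of [G * G], and
    [(s, t) |-> t - s] need not be measurable for it; the maps [shear t] below
    are, for each [t]. *)
Lemma closed_rectangles_generate (G : topologicalZmodType) :
  @measurable _ (borel G * borel G)%type =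
  <<s [set A `*` B | A in @closed G & B in @closed G] >>.
Proof.
set Gen := (X in <<s X >>).
pose GT := g_sigma_algebraType (Gen : set (set (pointed_group G * pointed_group G))).
have mfst : measurable_fun setT (fst : GT -> borel G).
  apply: (@measurability _ _ GT (borel G) setT fst (@open (pointed_group G))) => // _ [U oU <-].
  rewrite setTI -[X in measurable X]setCK; apply: measurableC; apply: sub_sigma_algebra.
  exists (~` U); first exact: open_closedC.
  by exists setT; [exact: closedT|rewrite setXT].
have msnd : measurable_fun setT (snd : GT -> borel G).
  apply: (@measurability _ _ GT (borel G) setT snd (@open (pointed_group G))) => // _ [U oU <-].
  rewrite setTI -[X in measurable X]setCK; apply: measurableC; apply: sub_sigma_algebra.
  exists setT; first exact: closedT.
  exists (~` U); first exact: open_closedC.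
  by rewrite setTX.
apply/seteqP; split.
  apply: smallest_sub; first exact: smallest_sigma_algebra.
  move=> _ [[A mA <-]|[A mA <-]]; first exact: (mfst measurableT A mA).
  exact: (msnd measurableT A mA).
apply: smallest_sub; first exact: sigma_algebra_measurable.
by move=> _ [A cA [B cB <-]]; apply: measurableX; exact: closed_borel.
Qed.

Lemma closed_rectangles_setI (G : topologicalZmodType) :
  setI_closed [set A `*` B | A in @closed G & B in @closed G].
Proof.
move=> _ _ [A1 cA1 [B1 cB1 <-]] [A2 cA2 [B2 cB2 <-]].
exists (A1 `&` A2); first exact: closedI.
by exists (B1 `&` B2); [exact: closedI|rewrite setXI].
Qed.

Section shear.
Variables (R : realType) (G : topologicalZmodType).
Hypothesis G_hausdorff : hausdorff_space G.
Variable mu : {measure set (borel G) -> \bar R}.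
Hypothesis mu_haar : haar_measure mu.
Implicit Types (t : G) (K U : set G).

Definition shear t (s : borel G) : borel G * borel G := (s, t - s).

Definition slice K (C : set G) t : set (borel G) := K `&` [set s | C (t - s)].

Lemma measurable_shear t : measurable_fun setT (shear t).
Proof.
apply: measurable_fun_pair; first exact: measurable_id.
exact: (continuous_borel (@subr_continuous G t)).
Qed.

Lemma measurable_shear_preimage t (P : set (borel G * borel G)) : measurable P ->
  measurable (shear t @^-1` P).
Proof. by move=> mP; rewrite -[X in measurable X]setTI; exact: measurable_shear. Qed.

Section restricted.
Variables (K : set (borel G)) (mK : measurable K).

(** The image by [shear t] of [mu] restricted to [K]. The integral of [k] against
    the mixture of these measures over [t] is the iterated integral of
    [k (s, t - s)] that occurs in convolutions. *)
Definition shear_measure (mK : measurable K) t (P : set (borel G * borel G)) : \bar R :=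
  mu (K `&` shear t @^-1` P).

Let shear0 t : shear_measure mK t set0 = 0%E.
Proof. by rewrite /shear_measure preimage_set0 setI0 measure0. Qed.

Let shear_ge0 t P : (0 <= shear_measure mK t P)%E.
Proof. exact: measure_ge0. Qed.

Let shear_sigma_additive t : semi_sigma_additive (shear_measure mK t).
Proof.
move=> F mF tF mUF; rewrite /shear_measure preimage_bigcup setI_bigcupr.
apply: measure_semi_sigma_additive.
- by move=> n; apply: measurableI => //; exact: measurable_shear_preimage.
- apply/trivIsetP => /= i j _ _ ij; apply/seteqP; split => // s [[_ Fi] [_ Fj]].
  have /trivIsetP/(_ i j Logic.I Logic.I ij) := tF.
  by move=> /seteqP[/(_ (shear t s) (conj Fi Fj))].
- apply: bigcupT_measurable => n.
  by apply: measurableI => //; exact: measurable_shear_preimage.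
Qed.

HB.instance Definition _ t := isMeasure.Build _ _ R
  (shear_measure mK t) (shear0 t) (shear_ge0 t) (@shear_sigma_additive t).

Lemma integral_shear t (k : borel G * borel G -> \bar R) :
  measurable_fun setT k -> (forall z, 0 <= k z)%E ->
  (\int[shear_measure mK t]_z k z = \int[mu]_(s in K) k (s, (t - s)%R))%E.
Proof.
move=> mk k0.
have mt := measurable_shear t.
transitivity (\int[pushforward (mrestr mu mK) (shear t)]_z k z)%E.
  by apply: eq_measure_integral => A mA _; rewrite /= /shear_measure /pushforward /mrestr setIC.
rewrite (ge0_integral_pushforward mt)//= preimage_setT.
rewrite (@ge0_negligible_integral _ _ _ (mrestr mu mK) setT (~` K))//=.
- rewrite setTD setCK; apply: eq_measure_integral => A mA AK.
  by rewrite /= /mrestr setIidl.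
- exact: measurableC.
- exact: measurableT_comp mk mt.
- by rewrite /mrestr setICl measure0.
Qed.

End restricted.

(** The measure of the slice is upper semicontinuous in [t]: an open set [U]
    around the slice at [t], of almost the same measure, still contains the
    slices at nearby points, because [K `\` U] is compact and the translates of
    [~` C] are open. *)
Lemma measurable_shear_closed K (C : set G) : compact K -> closed C ->
  measurable_fun setT (fun t : borel G => mu (slice K C t)).
Proof.
move=> cK cC.
have mE t : measurable (slice K C t).
  by apply: measurableI; [exact: (compact_borel G_hausdorff)|apply: (@borel_subr G t C); exact: closed_borel].
have Koo t : (mu (slice K C t) < +oo)%E.
  apply: le_lt_trans (haar_compact mu_haar cK).
  by rewrite le_measure ?inE// => [|s []//]; exact: (compact_borel G_hausdorff).
apply: (measurability _ (ErealGenInftyO.measurableE R)) => _ [_ [y ->] <-].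
rewrite setTI; apply: open_borel; apply: nbhs_open => t /=.
rewrite in_itv/= => ty; have e0 : 0 < y - fine (mu (slice K C t)).
  by rewrite subr_gt0 -lte_fin fineK// ge0_fin_numE.
have [U [oU KU Ue]] := haar_outer mu_haar (mE t) (Koo t) e0.
have cKU : compact (K `\` U).
  apply: (subclosed_compact _ cK); last by move=> x [].
  by apply: closedI; [exact: (compact_closed G_hausdorff cK)|exact: open_closedC].
have : \forall t' \near t, forall s, (K `\` U) s -> (~` C) (t' - s).
  apply: (@compact_near_coveringP _ (K `\` U)).1 (cKU) _ (nbhs t)
    (fun t' s => (~` C) (t' - s)) _ _ => s [Ks Us].
  have nC : (~` C) (t - s) by move=> Cts; apply: Us; exact: KU.
  have /(_ (~` C)) := @sub_continuous G (t, s); rewrite /= => /(_ _)[].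
    by apply: open_nbhs_nbhs; split => //; exact: closed_openC.
  move=> [A B] /= [tA sB] AB; exists (B, A) => //= -[a b] [/= Ba Ab].
  exact: (AB (b, a)).
apply: filterS => t' h; rewrite /= in_itv/=.
have mU := open_borel oU.
apply: (@le_lt_trans _ _ (mu (U : set (borel G)))).
  by rewrite le_measure ?inE// => s [Ks Cs]; apply: contrapT => Us; exact: (h s).
rewrite (measureDI _ mU (mE t)) setIidr//.
have -> : y%:E = ((y - fine (mu (slice K C t)))%:E +
                  mu (slice K C t))%E.
  by rewrite -[X in (_ + X)%E]fineK ?ge0_fin_numE// -EFinD subrK.
rewrite lteD2rE; first exact: Ue.
by rewrite ge0_fin_numE; [exact: Koo|exact: measure_ge0].
Qed.

Lemma measurable_shear_measure K (mK : measurable (K : set (borel G))) : compact K ->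
  forall P, measurable P -> measurable_fun setT (fun t : borel G => shear_measure mK t P).
Proof.
move=> cK.
have closedE A B t : K `&` shear t @^-1` (A `*` B) =
    slice (K `&` A) B t.
  by apply/seteqP; split => [s [Ks [As Bs]]|s [[Ks As] Bs]].
have closedM A B : closed A -> closed B ->
  measurable_fun setT (fun t : borel G => shear_measure mK t (A `*` B)).
  move=> cA cB; rewrite /shear_measure; under eq_fun do rewrite closedE.
  apply: measurable_shear_closed => //.
  apply: (subclosed_compact _ cK); last by move=> x [].
  by apply: closedI => //; exact: (compact_closed G_hausdorff cK).
apply: (kernel_dynkin (@closed_rectangles_generate G) (@closed_rectangles_setI G)).
- by move=> t; rewrite /= /shear_measure preimage_setT setIT haar_compact.
- by rewrite -setXTT; apply: closedM; exact: closedT.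
- by move=> _ [A cA [B cB <-]]; exact: closedM.
Qed.

End shear.

(** * The integral of the measures of slices *)

Section slices.
Variables (R : realType) (G : topologicalZmodType).
Hypothesis G_hausdorff : hausdorff_space G.
Hypothesis G_locally_compact : locally_compact [set: G].
Variable mu : {measure set (borel G) -> \bar R}.
Hypothesis mu_haar : haar_measure mu.
Implicit Types (t : G) (K U : set G).

Lemma measurable_mu_slice K (F E : set (borel G)) : compact K ->
  measurable F -> measurable E -> F `<=` K ->
  measurable_fun setT (fun t : borel G => mu (slice F E t)).
Proof.
move=> cK mF mE FK; have mK := compact_borel G_hausdorff cK.
have := measurable_shear_measure G_hausdorff mu_haar mK cK (measurableX mF mE).
congr measurable_fun; apply/funext => t; rewrite /shear_measure; congr (mu _).
by apply/seteqP; split => [s [Ks [Fs Es]]|s [Fs Es]] //; split => //; exact: FK.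
Qed.

Lemma measurable_slice (F E : set (borel G)) t : measurable F -> measurable E ->
  measurable (slice F E t).
Proof. by move=> mF mE; apply: measurableI => //; exact: borel_subr. Qed.

Lemma integral_translated_indic (c : \bar R) (s : G) (U : set (borel G)) :
  (0 <= c)%E -> measurable U ->
  (\int[mu]_t (c * (\1_((fun t : G => (- s + t)%R) @^-1` U) t)%:E) = c * mu U)%E.
Proof.
move=> c0 mU; rewrite ge0_integralZl//; last first.
  by apply/measurable_EFinP; apply: measurable_indic; exact: borel_addl.
by rewrite integral_indic ?setIT ?haar_addl//; exact: borel_addl.
Qed.

Lemma slice_setDI (F A E : set (borel G)) t : measurable F -> measurable A -> measurable E ->
  mu (slice F E t) = (mu (slice (F `&` A) E t) + mu (slice (F `\` A) E t))%E.
Proof.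
move=> mF mA mE.
rewrite -measureU//; last 3 first.
- by apply: measurable_slice => //; exact: measurableI.
- by apply: measurable_slice => //; exact: measurableD.
- by apply/seteqP; split => // s [[[_ As] _] [[_ nAs] _]].
congr (mu _); apply/seteqP; split => [s [Fs Es]|s [[[Fs As] Es]|[[Fs As] Es]]] //.
by have [As|As] := pselect (A s); [left|right].
Qed.

(** On a piece of [F] inside a translate [s + V], replacing [t - x] by [t - s]
    moves the point by an element of [V], hence turns [C] into [U]. The slices
    then become translates, whose integral is a product, and [F] is a finite
    disjoint union of such pieces. *)
Lemma slice_sandwich K (C U : set (borel G)) (V : set G) :
  compact K -> measurable C -> measurable U -> open V -> V 0 ->
  (forall c v, C c -> V v -> U (c + v) /\ U (c - v)) ->
  forall F : set (borel G), measurable F -> F `<=` K ->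
  (\int[mu]_t mu (slice F C t) <= mu F * mu U)%E /\
  (mu F * mu C <= \int[mu]_t mu (slice F U t))%E.
Proof.
move=> cK mC mU oV V0 CVU F mF FK.
have [l _ Kl] := compact_finite_cover cK oV V0.
have : F `<=` [set x | exists2 s, s \in l & V (x - s)] by move=> x /FK /Kl.
elim: l F mF FK {Kl} => [|s l IH] F mF FK Fl.
  have -> : F = set0 by apply/seteqP; split => // x /Fl[].
  rewrite measure0 !mul0e; split; last exact: integral_ge0.
  rewrite integral0_eq// => t _; rewrite (_ : slice _ _ _ = set0) ?measure0//.
  by apply/seteqP; split => // ? [].
pose A : set (borel G) := (fun x : G => - s + x) @^-1` V.
have mA : measurable A by apply: borel_addl; exact: open_borel.
have mFA : measurable (F `&` A) by exact: measurableI.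
have mFD : measurable (F `\` A) by exact: measurableD.
have FAK : F `&` A `<=` K by move=> x [/FK].
have FDK : F `\` A `<=` K by move=> x [/FK].
have [|IH1 IH2] := IH (F `\` A) mFD FDK.
  move=> x [/Fl [r]]; rewrite inE => /orP[/eqP ->|rl Vr _]; last by exists r.
  by rewrite /A /= addrC.
have FE : mu F = (mu (F `&` A) + mu (F `\` A))%E by rewrite (measureDI _ mF mA) addeC.
have splitI (E : set (borel G)) : measurable E -> (\int[mu]_t mu (slice F E t) =
    \int[mu]_t mu (slice (F `&` A) E t) + \int[mu]_t mu (slice (F `\` A) E t))%E.
  move=> mE; rewrite -ge0_integralD//; last 2 first.
  - exact: measurable_mu_slice cK _ _ _.
  - exact: measurable_mu_slice cK _ _ _.
  by apply: eq_integral => t _; rewrite -slice_setDI.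
have mind (E : set (borel G)) : measurable E -> measurable_fun setT (fun t : borel G =>
    mu (F `&` A) * (\1_((fun t : G => (- s + t)%R) @^-1` E) t)%:E)%E.
  move=> mE; apply: measurable_funeM; apply/measurable_EFinP.
  by apply: measurable_indic; exact: borel_addl.
rewrite !splitI// FE !ge0_muleDl//; split; apply: leeD => //.
- rewrite -(integral_translated_indic s)//; apply: ge0_le_integral => //.
  + exact: measurable_mu_slice cK _ _ _.
  + exact: mind.
  move=> t _; rewrite indicE; case: (boolP (_ \in _)) => [_|/negP st].
    rewrite mule1 le_measure ?inE//; first exact: measurable_slice.
    by move=> x [].
  rewrite mule0 (_ : slice _ _ _ = set0) ?measure0//.
  apply/seteqP; split => // x [[Fx Ax] Cx]; apply: st; rewrite inE /=.
  have [Ux _] := CVU _ _ Cx Ax; move: Ux; rewrite /= addrACA addNr addr0 addrC.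
  by [].
- rewrite -(integral_translated_indic s)//; apply: ge0_le_integral => //.
  + exact: mind.
  + exact: measurable_mu_slice cK _ _ _.
  move=> t _; rewrite indicE; case: (boolP (_ \in _)) => [|_]; last by rewrite mule0.
  rewrite inE /= => Cst; rewrite mule1 le_measure ?inE//; first exact: measurable_slice.
  move=> x [Fx Ax]; split => //=.
  have [_ Ux] := CVU _ _ Cst Ax; move: Ux; rewrite opprD opprK addrACA addNr add0r.
  by [].
Qed.

(** The upper bound follows from [slice_sandwich] with an open [U] around [C],
    by outer regularity. For the lower bound, [U] has also to be replaced by
    [C]: the slice of [U `\` C] at [t] has measure at most that of
    [- (U `\` C)], which is small when [- U] is in a small neighbourhood of the
    compact set [- C], and it is empty for [t] outside a fixed compact [H]. *)
Lemma integral_slice_compact (F C : set G) : compact F -> compact C ->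
  (\int[mu]_t mu (slice F C t) = mu (F : set (borel G)) * mu (C : set (borel G)))%E.
Proof.
move=> cF cC.
have mF := compact_borel G_hausdorff cF; have mC := compact_borel G_hausdorff cC.
have fF : mu (F : set (borel G)) \is a fin_num.
  by rewrite ge0_fin_numE ?measure_ge0//; exact: haar_compact.
have fC : mu (C : set (borel G)) \is a fin_num.
  by rewrite ge0_fin_numE ?measure_ge0//; exact: haar_compact.
have F0 : 0 <= fine (mu (F : set (borel G))) by apply: fine_ge0; exact: measure_ge0.
apply/eqP; rewrite eq_le; apply/andP; split; apply/lee_addgt0Pr => e e0.
- have e'0 : 0 < e / (fine (mu (F : set (borel G))) + 1).
    by rewrite divr_gt0// ltr_wpDl.
  have [U [oU CU Ue]] := haar_outer mu_haar mC (haar_compact mu_haar cC) e'0.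
  have mU := open_borel oU.
  have [V [oV V0 CVU]] := compact_thicken_sym cC oU CU.
  have [le1 _] := slice_sandwich cF mC mU oV V0 CVU mF (@subset_refl _ _).
  apply: le_trans le1 _; rewrite (measureDI _ mU mC) setIidr//.
  rewrite ge0_muleDr// addeC; apply: leeD => //.
  rewrite -(fineK fF); apply: le_trans (lee_wpmul2l _ (ltW Ue)) _; first by rewrite lee_fin.
  rewrite -EFinM lee_fin mulrCA ger_pMr// ler_pdivrMr ?mul1r ?ltr_wpDl//.
  by rewrite lerDl.
- have [N N0 cN] := compact_nbhs0 G_locally_compact.
  (* contains every t whose slice of F by a subset of C + N is nonempty *)
  pose H := setadd F (setadd C N).
  have cH : compact H by do 2 apply: compact_setadd => //.
  have mH := compact_borel G_hausdorff cH.
  have fH : mu (H : set (borel G)) \is a fin_num.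
    by rewrite ge0_fin_numE ?measure_ge0//; exact: haar_compact.
  have H0 : 0 <= fine (mu (H : set (borel G))) by apply: fine_ge0; exact: measure_ge0.
  have e'0 : 0 < e / (fine (mu (H : set (borel G))) + 1).
    by rewrite divr_gt0// ltr_wpDl.
  have cNC := compact_opp cC.
  have mNC := compact_borel G_hausdorff cNC.
  have [W [oO CO Oe]] := haar_outer mu_haar mNC (haar_compact mu_haar cNC) e'0.
  have mW := open_borel oO.
  pose U : set G := (-%R @^-1` W) `&` setadd C (interior N).
  have oU : open U.
    apply: openI; last by apply: open_setadd; exact: open_interior.
    by apply: open_preimage => //; exact: opp_continuous.
  have mU := open_borel oU.
  have CU : C `<=` U.
    move=> c Cc; split; first by apply: CO; exists c.
    by exists c => //; exists 0; [exact: N0|rewrite addr0].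
  have [V [oV V0 CVU]] := compact_thicken_sym cC oU CU.
  have [_ le1] := slice_sandwich cF mC mU oV V0 CVU mF (@subset_refl _ _).
  apply: le_trans le1 _.
  have le_pt t : (mu (slice F U t) <= mu (slice F C t) +
      (e / (fine (mu (H : set (borel G))) + 1))%:E * (\1_(H : set (borel G)) t)%:E)%E.
    have mUC : measurable (U `\` C : set (borel G)) by exact: measurableD.
    apply: (@le_trans _ _ (mu (slice F C t) + mu (slice F (U `\` C) t))%E).
      apply: le_trans (measureU2 _ _ _); last 2 first.
        exact: measurable_slice.
        exact: measurable_slice.
      rewrite le_measure ?inE//; first exact: measurable_slice.
        by apply: measurableU; exact: measurable_slice.
      move=> s [Fs Us]; have [Cs|Cs] := pselect (C (t - s)); first by left.
      by right; split.
    rewrite leeD2l// indicE; case: (boolP (_ \in _)) => [_|/negP Ht].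
      rewrite mule1; apply: le_trans (ltW Oe).
      have mOC : measurable (W `\` [set - x | x in C] : set (borel G)) by exact: measurableD.
      rewrite -(haar_addl mu_haar (- t) mOC) le_measure ?inE//; first exact: measurable_slice.
        exact: borel_addl.
      move=> s [_ [[Os _] nC]]; move: Os; rewrite /= opprB addrC => Os; split => //.
      move=> -[c Cc cE]; apply: nC; rewrite -[t - s]opprB [s - t]addrC -cE opprK.
      exact: Cc.
    rewrite mule0 (_ : slice _ _ _ = set0) ?measure0//.
    apply/seteqP; split => // s [Fs [[_ [c Cc [n Nn cnE]]] _]]; apply: Ht; rewrite inE.
    exists s => //; exists (c + n); last by rewrite cnE addrC subrK.
    by exists c => //; exists n => //; exact: interior_subset.
  apply: (@le_trans _ _ (\int[mu]_t (mu (slice F C t) +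
      (e / (fine (mu (H : set (borel G))) + 1))%:E * (\1_(H : set (borel G)) t)%:E))%E).
    apply: ge0_le_integral => //.
    + exact: measurable_mu_slice cF _ _ _.
    + apply: emeasurable_funD; first exact: measurable_mu_slice cF _ _ _.
      by apply: measurable_funeM; apply/measurable_EFinP; exact: measurable_indic.
    + by move=> t _; exact: le_pt.
  rewrite ge0_integralD//; last 3 first.
  + exact: measurable_mu_slice cF _ _ _.
  + by move=> t _; rewrite mule_ge0 ?lee_fin// ltW.
  + by apply: measurable_funeM; apply/measurable_EFinP; exact: measurable_indic.
  rewrite leeD2l// ge0_integralZl//; last 2 first.
  + by apply/measurable_EFinP; exact: measurable_indic.
  + by rewrite lee_fin ltW.
  rewrite integral_indic// setIT -(fineK fH) -EFinM lee_fin.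
  by rewrite mulrAC ler_pdivrMr ?ltr_wpDl// ler_pM2l// lerDl.
Qed.

End slices.

(** * Tonelli for compactly supported kernels *)

Lemma ge0_integral_mrestr d (T : measurableType d) (R : realType)
    (m : {measure set T -> \bar R}) (D : set T) (mD : measurable D) (f : T -> \bar R) :
  measurable_fun setT f -> (forall x, 0 <= f x)%E ->
  (\int[mrestr m mD]_x f x = \int[m]_(x in D) f x)%E.
Proof.
move=> mf f0.
rewrite (@ge0_negligible_integral _ _ _ (mrestr m mD) setT (~` D))//=.
- rewrite setTD setCK; apply: eq_measure_integral => A mA AK.
  by rewrite /= /mrestr setIidl.
- exact: measurableC.
- by rewrite /mrestr setICl measure0.
Qed.

Lemma cvg_indic_bigcup (R : realType) (T : Type) (K : nat -> set T) (k : T -> \bar R) x :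
  {homo K : m n / (m <= n)%N >-> m `<=` n} ->
  (~ (\bigcup_n K n) x -> k x = 0%E) ->
  ((k x * (\1_(K n) x)%:E)%E @[n --> \oo] --> k x)%classic.
Proof.
move=> ndK k0; have [[N _ KN]|/k0 ->] := pselect ((\bigcup_n K n) x).
  apply: cvg_near_cst; exists N => // n /= Nn.
  by rewrite indicE mem_set ?mule1//; exact: (ndK _ _ Nn).
by under eq_fun do rewrite mul0e; exact: cvg_cst.
Qed.

Lemma nd_indic (R : realType) (T : Type) (K : nat -> set T) (k : T -> \bar R) x :
  {homo K : m n / (m <= n)%N >-> m `<=` n} -> (0 <= k x)%E ->
  {homo (fun n => k x * (\1_(K n) x)%:E)%E : m n / (m <= n)%N >-> (m <= n)%E}.
Proof.
move=> ndK k0 m n mn; rewrite lee_wpmul2l// lee_fin !indicE ler_nat.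
by case: (boolP (x \in K m)) => // /set_mem/(ndK _ _ mn)/mem_set ->.
Qed.

Section shear_tonelli.
Variables (R : realType) (G : topologicalZmodType).
Hypothesis G_hausdorff : hausdorff_space G.
Hypothesis G_locally_compact : locally_compact [set: G].
Variable mu : {measure set (borel G) -> \bar R}.
Hypothesis mu_haar : haar_measure mu.
Implicit Types (t : G) (K U : set G).

Lemma measurable_fun_shear t (k : borel G * borel G -> \bar R) :
  measurable_fun setT k -> measurable_fun setT (fun s : borel G => k (s, (t - s)%R)).
Proof. by move=> mk; exact: (measurableT_comp mk (@measurable_shear G t)). Qed.

Lemma measurable_shear_integral (K : nat -> set G) (k : borel G * borel G -> \bar R) :
  (forall n, compact (K n)) -> {homo K : m n / (m <= n)%N >-> m `<=` n} ->
  measurable_fun setT k -> (forall z, 0 <= k z)%E ->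
  (forall s u, ~ (\bigcup_n K n) s -> k (s, u) = 0%E) ->
  measurable_fun setT (fun t : borel G => \int[mu]_s k (s, (t - s)%R))%E.
Proof.
move=> cK ndK mk k0 kK; have mK n := compact_borel G_hausdorff (cK n).
have mF n : measurable_fun setT (fun t : borel G =>
    \int[mu]_s (k (s, (t - s)%R) * (\1_(K n : set (borel G)) s)%:E))%E.
  have := @measurable_fun_integral_kernel _ _ _ _ _
    (fun t : borel G => shear_measure mu (mK n) t)
    (measurable_shear_measure G_hausdorff mu_haar (mK n) (cK n)) k k0 mk.
  congr measurable_fun; apply/funext => t; rewrite /= integral_shear// integral_mkcond.
  apply: eq_integral => s _; rewrite patchE indicE.
  by case: (boolP (_ \in _)); rewrite ?mule1 ?mule0.
apply: (emeasurable_fun_cvg _ _ mF) => t _.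
rewrite [X in _ --> X](_ : _ = \int[mu]_s lim
    ((k (s, (t - s)%R) * (\1_(K n : set (borel G)) s)%:E)%E @[n --> \oo])%classic)%E; last first.
  apply: eq_integral => s _; apply/esym/cvg_lim => //.
  exact: (@cvg_indic_bigcup R _ K (fun s => k (s, (t - s)%R)) s ndK (kK s _)).
apply: cvg_monotone_convergence => //.
- move=> n; apply: emeasurable_funM; first exact: measurable_fun_shear.
  by apply/measurable_EFinP; exact: measurable_indic.
- by move=> n s _; rewrite mule_ge0// lee_fin.
- by move=> s _; exact: (@nd_indic R _ K (fun s => k (s, (t - s)%R)) s ndK (k0 _)).
Qed.

(** Both sides are integrals of [k] against measures on the product; these agree
    on closed rectangles by [integral_slice_compact], hence everywhere. *)
Lemma tonelli_compact (K L : set G) (k : borel G * borel G -> \bar R) :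
  compact K -> compact L ->
  forall (mK : measurable (K : set (borel G))) (mL : measurable (L : set (borel G)))
    (Koo : (mu (K : set (borel G)) < +oo)%E) (Loo : (mu (L : set (borel G)) < +oo)%E),
  measurable_fun setT k -> (forall z, 0 <= k z)%E ->
  (forall s u, ~ (K s /\ L u) -> k (s, u) = 0%E) ->
  (\int[mu]_t \int[mu]_s k (s, (t - s)%R) =
   \int[mfrestr mK Koo \x mfrestr mL Loo]_z k z)%E.
Proof.
move=> cK cL mK mL Koo Loo mk k0 kKL.
pose l t := shear_measure mu mK t.
have ml := measurable_shear_measure G_hausdorff mu_haar mK cK.
have mKL : measurable (K `*` L : set (borel G * borel G)) by exact: measurableX.
transitivity (\int[mixture mu ml]_z k z)%E.
  rewrite integral_mixture//; apply: eq_integral => t _.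
  rewrite integral_shear// [RHS]integral_mkcond; apply: eq_integral => s _.
  rewrite patchE; case: ifPn => // /negP Ks; apply: kKL => -[K's _].
  by apply: Ks; rewrite inE.
transitivity (\int[mrestr (mixture mu ml) mKL]_z k z)%E.
  rewrite ge0_integral_mrestr// [RHS]integral_mkcond; apply: eq_integral => -[s u] _.
  rewrite patchE; case: ifPn => // /negP KLsu; apply: kKL => -[Ks Lu].
  by apply: KLsu; rewrite inE.
apply: eq_measure_integral => P mP _.
apply: (measure_unique _ (fun=> setT) (@closed_rectangles_generate G)
  (@closed_rectangles_setI G)) => //.
- by move=> _; exists setT; [exact: closedT|exists setT; [exact: closedT|rewrite setXTT]].
- by rewrite bigcup_const//; exists 0%N.
- move=> _ [A cA [B cB <-]].
  transitivity (mfrestr mK Koo (A : set (borel G)) * mfrestr mL Loo (B : set (borel G)))%E; last first.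
    by apply/esym/product_measure1E; exact: closed_borel.
  rewrite /= /mfrestr /mrestr /mixture -setXI -integral_slice_compact//.
  + apply: eq_integral => t _; rewrite /= /shear_measure; congr (mu _).
    by apply/seteqP; split => [s [Ks [As Bs]]|s [[As Ks] Bs]].
  + apply: (subclosed_compact _ cK); last by move=> x [].
    by apply: closedI => //; exact: (compact_closed G_hausdorff cK).
  + apply: (subclosed_compact _ cL); last by move=> x [].
    by apply: closedI => //; exact: (compact_closed G_hausdorff cL).
- move=> _; rewrite /= /mrestr setTI /mixture.
  have -> : (\int[mu]_x shear_measure mu mK x (K `*` L) = mu (K : set (borel G)) * mu (L : set (borel G)))%E.
    rewrite -integral_slice_compact//; apply: eq_integral => t _; congr (mu _).
    by apply/seteqP; split => [s [Ks [As Bs]]|s [As Bs]].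
  by rewrite lte_mul_pinfty// ge0_fin_numE.
Qed.

Lemma tonelli_convolution_compact (K L : set G) (f g : borel G -> \bar R) :
  compact K -> compact L -> measurable_fun setT f -> measurable_fun setT g ->
  (forall s, 0 <= f s)%E -> (forall s, 0 <= g s)%E ->
  (forall s, ~ K s -> f s = 0%E) -> (forall s, ~ L s -> g s = 0%E) ->
  (\int[mu]_t \int[mu]_s (f s * g (t - s)%R) = \int[mu]_s f s * \int[mu]_s g s)%E.
Proof.
move=> cK cL mf mg f0 g0 fK gL.
have mK := compact_borel G_hausdorff cK; have mL := compact_borel G_hausdorff cL.
have Koo := haar_compact mu_haar cK; have Loo := haar_compact mu_haar cL.
have mk : measurable_fun setT (fun z : borel G * borel G => f z.1 * g z.2)%E.
  by apply: emeasurable_funM; exact: measurableT_comp.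
have := @tonelli_compact K L (fun z => f z.1 * g z.2)%E cK cL mK mL Koo Loo mk.
move=> /= ->; last 2 first.
- by move=> z; exact: mule_ge0.
- move=> s u /not_andP[/fK ->|/gL ->]; [exact: mul0e|exact: mule0].
rewrite fubini_tonelli1//=; last by move=> z; exact: mule_ge0.
rewrite /fubini_F /=.
have restr (D : set G) (mD : measurable (D : set (borel G))) (Doo : (mu (D : set (borel G)) < +oo)%E)
    (h : borel G -> \bar R) :
    measurable_fun setT h -> (forall s, 0 <= h s)%E -> (forall s, ~ D s -> h s = 0%E) ->
    (\int[mfrestr mD Doo]_s h s = \int[mu]_s h s)%E.
  move=> mh h0 hD; rewrite ge0_integral_mrestr// integral_mkcond.
  apply: eq_integral => s _; rewrite patchE; case: ifPn => // /negP Ds.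
  by rewrite hD// => Ds'; apply: Ds; rewrite inE.
under eq_integral do rewrite ge0_integralZl// restr//.
by rewrite ge0_integralZr// ?restr// integral_ge0.
Qed.

End shear_tonelli.

(** * Tonelli for convolutions of integrable functions *)

Section convolution_tonelli.
Variables (R : realType) (G : topologicalZmodType).
Hypothesis G_hausdorff : hausdorff_space G.
Hypothesis G_locally_compact : locally_compact [set: G].
Variable mu : {measure set (borel G) -> \bar R}.
Hypothesis mu_haar : haar_measure mu.
Implicit Types (t : G) (K U : set G).

Lemma integrable_superlevel_finite (f : borel G -> R) (c : R) :
  (forall s, 0 <= f s) -> mu.-integrable setT (EFin \o f) -> 0 < c ->
  (mu [set s | (c <= f s)%R] < +oo)%E.
Proof.
move=> f0 fi c0.
have mf : measurable_fun setT f by apply/measurable_EFinP; exact: measurable_int fi.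
have mA : measurable [set s | c <= f s].
  by rewrite -[X in measurable X]setTI; exact: (measurable_fun_ler (measurable_cst c) mf).
have : (c%:E * mu [set s | (c <= f s)%R] <= \int[mu]_s (f s)%:E)%E.
  rewrite -[X in mu X]setIT -integral_indic// -ge0_integralZl//; last 2 first.
  - by apply/measurable_EFinP; exact: measurable_indic.
  - by rewrite lee_fin ltW.
  apply: ge0_le_integral => //.
  - by move=> s _; rewrite mule_ge0// lee_fin ltW.
  - by apply: measurable_funeM; apply/measurable_EFinP; exact: measurable_indic.
  - exact/measurable_EFinP.
  move=> s _; rewrite indicE; case: (boolP (_ \in _)) => [/set_mem/= cf|_].
    by rewrite mule1 lee_fin.
  by rewrite mule0 lee_fin.
move=> h; rewrite ltey; apply/eqP => Aoo; move: h.
rewrite Aoo gt0_muley ?lte_fin// leye_eq => /eqP foo.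
by have := integrable_fin_num measurableT fi; rewrite /= foo.
Qed.

Lemma integrable_sigma_compact_support (f : borel G -> R) :
  (forall s, 0 <= f s) -> mu.-integrable setT (EFin \o f) ->
  exists K : nat -> set G, [/\ forall n, compact (K n),
    {homo K : m n / (m <= n)%N >-> m `<=` n} & forall s, ~ (\bigcup_n K n) s -> f s = 0].
Proof.
move=> f0 fi.
have mf : measurable_fun setT f by apply/measurable_EFinP; exact: measurable_int fi.
have h (m : nat) : exists K : nat -> set G, [/\ forall n, compact (K n),
    {homo K : m n / (m <= n)%N >-> m `<=` n} &
    [set s | m.+1%:R^-1 <= f s] `<=` \bigcup_n K n].
  have m0 : 0 < m.+1%:R^-1 :> R by rewrite invr_gt0.
  apply: (finite_measure_sigma_compact G_hausdorff G_locally_compact mu_haar).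
    by rewrite -[X in measurable X]setTI; exact: (measurable_fun_ler (measurable_cst _) mf).
  exact: integrable_superlevel_finite.
have [K hK] := choice h.
exists (fun n => \bigcup_(m in `I_n.+1) K m n); split.
- move=> n; rewrite (bigcup_mkord n.+1 (fun m => K m n)).
  elim/big_ind : _ => [|A B|m _]; [exact: compact0|exact: compactU|].
  by have [cK _ _] := hK m.
- move=> n n' nn' s [m /= mn Ks]; exists m; first exact: leq_trans mn _.
  by have [_ ndK _] := hK m; exact: ndK Ks.
move=> s Ks; apply/eqP; rewrite eq_le f0 andbT leNgt; apply/negP => fs0.
have [m _ /(_ m (leqnn m)) mfs] := near_infty_natSinv_lt (PosNum fs0).
have [_ ndK /(_ s)] := hK m; case=> [|n _ Kn]; first by rewrite /= ltW.
apply: Ks; exists (maxn m n) => //; exists m; first by rewrite /= ltnS leq_maxl.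
by apply: ndK Kn; exact: leq_maxr.
Qed.

Lemma measurable_convolution (f g : borel G -> R) :
  (forall s, 0 <= f s) -> (forall s, 0 <= g s) ->
  mu.-integrable setT (EFin \o f) -> measurable_fun setT g ->
  measurable_fun setT (fun t : borel G => \int[mu]_s (f s * g (t - s)%R)%:E)%E.
Proof.
move=> f0 g0 fi mg.
have mf : measurable_fun setT f by apply/measurable_EFinP; exact: measurable_int fi.
have [K [cK ndK fK]] := integrable_sigma_compact_support f0 fi.
apply: (measurable_shear_integral G_hausdorff mu_haar cK ndK
  (k := fun z => (f z.1 * g z.2)%:E)).
- apply/measurable_EFinP; apply: measurable_funM; exact: measurableT_comp.
- by move=> z; rewrite lee_fin mulr_ge0.
- by move=> s u /fK ->; rewrite mul0r.
Qed.

(** Integrable functions vanish outside sigma-compact sets, so that monotone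
    convergence reduces the claim to compactly supported ones. *)
Lemma tonelli_convolution (f g : borel G -> R) :
  (forall s, 0 <= f s) -> (forall s, 0 <= g s) ->
  mu.-integrable setT (EFin \o f) -> mu.-integrable setT (EFin \o g) ->
  (\int[mu]_t \int[mu]_s (f s * g (t - s)%R)%:E =
   \int[mu]_s (f s)%:E * \int[mu]_s (g s)%:E)%E.
Proof.
move=> f0 g0 fi gi.
have mf : measurable_fun setT f by apply/measurable_EFinP; exact: measurable_int fi.
have mg : measurable_fun setT g by apply/measurable_EFinP; exact: measurable_int gi.
have [K [cK ndK fK]] := integrable_sigma_compact_support f0 fi.
have [L [cL ndL gL]] := integrable_sigma_compact_support g0 gi.
have mK n := compact_borel G_hausdorff (cK n); have mL n := compact_borel G_hausdorff (cL n).
pose fn n s := ((f s)%:E * (\1_(K n : set (borel G)) s)%:E)%E.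
pose gn n s := ((g s)%:E * (\1_(L n : set (borel G)) s)%:E)%E.
have mfn n : measurable_fun setT (fn n).
  apply: emeasurable_funM; first exact/measurable_EFinP.
  by apply/measurable_EFinP; exact: measurable_indic.
have mgn n : measurable_fun setT (gn n).
  apply: emeasurable_funM; first exact/measurable_EFinP.
  by apply/measurable_EFinP; exact: measurable_indic.
have fn0 n s : (0 <= fn n s)%E by rewrite mule_ge0// lee_fin.
have gn0 n s : (0 <= gn n s)%E by rewrite mule_ge0// lee_fin.
have ndfn s : {homo fn^~ s : m n / (m <= n)%N >-> (m <= n)%E}.
  by apply: (@nd_indic R _ K (fun s => (f s)%:E)) => //; rewrite lee_fin.
have ndgn s : {homo gn^~ s : m n / (m <= n)%N >-> (m <= n)%E}.
  by apply: (@nd_indic R _ L (fun s => (g s)%:E)) => //; rewrite lee_fin.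
have fn_cvg s : (fn n s @[n --> \oo] --> (f s)%:E)%classic.
  by apply: (@cvg_indic_bigcup R _ K (fun s => (f s)%:E)) => // /fK ->.
have gn_cvg s : (gn n s @[n --> \oo] --> (g s)%:E)%classic.
  by apply: (@cvg_indic_bigcup R _ L (fun s => (g s)%:E)) => // /gL ->.
have step n : (\int[mu]_t \int[mu]_s (fn n s * gn n (t - s)%R) =
    \int[mu]_s fn n s * \int[mu]_s gn n s)%E.
  apply: (tonelli_convolution_compact G_hausdorff G_locally_compact mu_haar (cK n) (cL n)) => //.
    by move=> s Ks; rewrite /fn indicE memNset// mule0.
  by move=> s Ls; rewrite /gn indicE memNset// mule0.
have mono (h : borel G -> R) (hn : nat -> borel G -> \bar R) :
    (forall n, measurable_fun setT (hn n)) -> (forall n s, 0 <= hn n s)%E ->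
    (forall s, {homo hn^~ s : m n / (m <= n)%N >-> (m <= n)%E}) ->
    (forall s, (hn n s @[n --> \oo] --> (h s)%:E)%classic) ->
    ((\int[mu]_s hn n s)%E @[n --> \oo] --> (\int[mu]_s (h s)%:E)%E)%classic.
  move=> mh h0 nd cv.
  rewrite (_ : \int[mu]_s (h s)%:E = \int[mu]_s lim (hn n s @[n --> \oo])%classic)%E; last first.
    by apply: eq_integral => s _; apply/esym/cvg_lim => //; exact: cv.
  by apply: cvg_monotone_convergence => // s _ m n mn; exact: nd.
have inner t : ((\int[mu]_s (fn n s * gn n (t - s)%R))%E @[n --> \oo] -->
    (\int[mu]_s (f s * g (t - s)%R)%:E)%E)%classic.
  apply: mono.
  - move=> n; apply: emeasurable_funM => //.
      exact: (measurableT_comp (mgn _) (continuous_borel (@subr_continuous G t))).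
  - by move=> n s; exact: mule_ge0.
  - by move=> s m n mn; apply: lee_pmul => //; [exact: ndfn|exact: ndgn].
  - by move=> s; rewrite EFinM; apply: cvgeM.
have : ((\int[mu]_t \int[mu]_s (fn n s * gn n (t - s)%R))%E @[n --> \oo] -->
    (\int[mu]_t \int[mu]_s (f s * g (t - s)%R)%:E)%E)%classic.
  rewrite (_ : \int[mu]_t \int[mu]_s (f s * g (t - s)%R)%:E =
     \int[mu]_t lim ((\int[mu]_s (fn n s * gn n (t - s)%R))%E @[n --> \oo])%classic)%E; last first.
    by apply: eq_integral => t _; apply/esym/cvg_lim => //; exact: inner.
  apply: cvg_monotone_convergence => //.
  - move=> n.
    apply: (@measurable_shear_integral _ _ G_hausdorff _ mu_haar K
      (fun z => fn n z.1 * gn n z.2)%E) => //.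
    + by apply: emeasurable_funM; exact: measurableT_comp.
    + by move=> z; exact: mule_ge0.
    + by move=> s u Ks; rewrite /= /fn fK// mul0e mul0e.
  - by move=> n t _; apply: integral_ge0 => s _; exact: mule_ge0.
  - move=> t _ m n mn; apply: ge0_le_integral => //.
    + by move=> s _; exact: mule_ge0.
    + apply: emeasurable_funM => //.
      exact: (measurableT_comp (mgn _) (continuous_borel (@subr_continuous G t))).
    + apply: emeasurable_funM => //.
      exact: (measurableT_comp (mgn _) (continuous_borel (@subr_continuous G t))).
    + by move=> s _; apply: lee_pmul => //; [exact: ndfn|exact: ndgn].
under eq_fun do rewrite step.
move=> /cvg_lim <- //; apply/cvg_lim => //; apply: cvgeM.
- have ff := integrable_fin_num measurableT fi; have gf := integrable_fin_num measurableT gi.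
  by rewrite mule_def_fin.
- exact: mono.
- exact: mono.
Qed.

End convolution_tonelli.

(** * Real norms and transposes *)

Section real_norm.
Variables (R : realType).

Lemma le0_of_eps (z C : R) : 0 <= C -> (forall e, 0 < e -> z <= C * e) -> z <= 0.
Proof.
move=> C0 h; apply/ler_addgt0Pr => e e0; rewrite add0r.
have C1 : 0 < C + 1 by rewrite ltr_wpDl.
have := h (e / (C + 1)) (divr_gt0 e0 C1) => /le_trans; apply.
by rewrite mulrCA ger_pMr// ler_pdivrMr// mul1r lerDl.
Qed.

Lemma normc_eps0 (z : R[i]) (C : R) : 0 <= C ->
  (forall e, 0 < e -> normc z <= C * e) -> z = 0.
Proof.
move=> C0 h; apply: ComplexField.Normc.eq0_normc; apply/eqP.
by rewrite eq_le normc_ge0 andbT; exact: le0_of_eps h.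
Qed.

Lemma le0_of_archi (z C : R) : (forall n : nat, n%:R * z <= C) -> z <= 0.
Proof.
move=> h; rewrite leNgt; apply/negP => z0.
have C0 : 0 <= C by have := h 0%N; rewrite mul0r.
have := archi_boundP (divr_ge0 C0 (ltW z0)); rewrite ltr_pdivrMr//.
by apply/negP; rewrite -leNgt; exact: h.
Qed.

Lemma normc_archi0 (z : R[i]) (C : R) : (forall n : nat, n%:R * normc z <= C) -> z = 0.
Proof.
move=> h; apply: ComplexField.Normc.eq0_normc; apply/eqP.
by rewrite eq_le normc_ge0 andbT; exact: le0_of_archi h.
Qed.

Lemma normc_nat (n : nat) (z : R[i]) : normc (n%:R * z) = n%:R * normc z.
Proof. by rewrite mulr_natl normcMn mulr_natl. Qed.

Lemma normc_opp (z : R[i]) : normc (- z) = normc z.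
Proof. by rewrite normcN. Qed.

Lemma normc_sub (y z : R[i]) : normc (y - z) <= normc y + normc z.
Proof. by rewrite -(normc_opp z); exact: le_normcD. Qed.

Variable X : normedModType R[i].
(** The norm of a complex normed module has its values in [R[i]], which is only
    partially ordered; estimates are carried out on its real part. *)
Definition rnorm (x : X) : R := complex.Re `|x|.

Lemma rnormE x : `|x| = (rnorm x)%:C%C.
Proof. by rewrite ge0_ReK. Qed.

Lemma rnorm_ge0 x : 0 <= rnorm x.
Proof. by rewrite -ler0c -rnormE. Qed.

Lemma rnormD x y : rnorm (x + y) <= rnorm x + rnorm y.
Proof. by rewrite -lecR real_complexD -!rnormE ler_normD. Qed.

Lemma rnormZ c x : rnorm (c *: x) = normc c * rnorm x.
Proof.
by apply: complexI; rewrite real_complexM -!rnormE normrZ; congr (_ * _).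
Qed.

Lemma rnormN x : rnorm (- x) = rnorm x.
Proof. by rewrite /rnorm normrN. Qed.

Lemma rnormB x y : rnorm (x - y) = rnorm (y - x).
Proof. by rewrite /rnorm distrC. Qed.

Lemma rnorm0 : rnorm 0 = 0.
Proof. by rewrite /rnorm normr0. Qed.

Lemma rnorm_le_split x y z : rnorm (x - z) <= rnorm (x - y) + rnorm (y - z).
Proof. by have := rnormD (x - y) (y - z); rewrite addrA subrK. Qed.

Lemma rnorm_eps_eq x y (C : R) : 0 <= C -> (forall e, 0 < e -> rnorm (x - y) <= C * e) -> x = y.
Proof.
move=> C0 h; apply/eqP; rewrite -subr_eq0 -normr_eq0 rnormE.
suff -> : rnorm (x - y) = 0 by [].
by apply/eqP; rewrite eq_le rnorm_ge0 andbT; exact: le0_of_eps h.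
Qed.

End real_norm.

Section dual_lemmas.
Variables (R : realType) (X : normedModType R[i]).
Implicit Types (f g : dual X) (x y : X).

Lemma dual_linear f : linear (f : X -> R[i]^o).
Proof. by have /dual_predP[] := dual_funP f. Qed.

Lemma dualD f x y : f (x + y) = f x + f y.
Proof. by have := dual_linear f 1 x y; rewrite !scale1r. Qed.

Lemma dualB f x y : f (x - y) = f x - f y.
Proof. by rewrite dualD -scaleN1r dualZ mulN1r. Qed.

Lemma dual_linE (a : R[i]) f g x : (a *: f + g) x = a * f x + g x.
Proof. by []. Qed.

Lemma dual_subE f g x : (f - g) x = f x - g x.
Proof. by []. Qed.

Lemma dual_le f x : normc (f x) <= opnorm f * rnorm x.
Proof. exact: opnormP. Qed.

Lemma opnorm_le_bound f (C : R) : 0 <= C -> (forall x, normc (f x) <= C * rnorm x) -> opnorm f <= C.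
Proof.
move=> C0 h; apply: opnorm_le => x; rewrite rnormE => x1.
by apply: le_trans (h x) _; rewrite ler_piMr// -lecR.
Qed.

Lemma rnorm_dual f : rnorm f = opnorm f.
Proof. by []. Qed.

Lemma bounded_linear_dual (T : X -> R[i]^o) (C : R) : linear T ->
  (forall x, normc (T x) <= C * rnorm x) -> T \in @dual_pred R X.
Proof.
move=> lT bT; apply/dual_predP; split => //.
pose F : {linear X -> R[i]^o} := HB.pack T (GRing.isLinear.Build _ _ _ _ T lT).
apply: (@bounded_linear_continuous _ _ _ F).
apply/linear_boundedP; near=> r => x.
have Cr : (Num.max C 0)%:C%C <= r by near: r; apply: nbhs_pinfty_ge; rewrite complex_real.
apply: (@le_trans _ _ ((Num.max C 0)%:C%C * `|x|)).
  rewrite (rnormE x) -real_complexM -[X in X <= _]/(`|T x|) (Defs.normcE (T x)).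
  rewrite [X in is_true X]lecR.
  by apply: le_trans (bT x) _; rewrite ler_wpM2r ?rnorm_ge0// le_max lexx.
by rewrite ler_wpM2r.
Unshelve. all: by end_near. Qed.

End dual_lemmas.

(** The transpose of [T]; it is locked because unification would otherwise
    unfold the construction of the elements of the dual. *)
Fact precomp_key : unit. Proof. exact: tt. Qed.
Definition precomp (R : realType) (X : normedModType R[i]) :=
  locked_with precomp_key (fun (T : X -> X) (f : dual X) =>
    insubd 0 (fun x => f (T x)) : dual X).

Section precomp.
Variables (R : realType) (X : normedModType R[i]).

Lemma precomp_unlock (T : X -> X) (f : dual X) :
  precomp T f = insubd 0 (fun x => f (T x)).
Proof. by rewrite /precomp unlock. Qed.

Lemma precompE (T : X -> X) (C : R) (f : dual X) x : linear T ->
  (forall x, rnorm (T x) <= C * rnorm x) -> precomp T f x = f (T x).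
Proof.
move=> lT bT; rewrite precomp_unlock insubdK//.
apply: (@bounded_linear_dual _ _ _ (opnorm f * C)).
  by move=> a y z; rewrite lT (dual_linear f).
by move=> y; apply: le_trans (dual_le _ _) _; rewrite -mulrA ler_wpM2l ?opnorm_ge0.
Qed.

End precomp.

(** * Derivations on an algebra with translations *)

(** The algebra enters only through its product and its translations. The
    hypothesis [mul_approx] makes multiplication operators limits of
    combinations of translations, at two points at once. The hypothesis
    [cutoff] is the growth condition in operator form: for each [t] some multiple
    [t *+ n] and some contraction [P], which for a Beurling algebra multiplies by
    the indicator of a compact set, such that the part kept by [P] is bounded
    after translation uniformly in the translation, and the part removed by [P]
    is of order [n]. *)
Section translation_algebra.
Variables (R : realType) (A : normedModType R[i]) (G : zmodType).
Variables (mul : A -> A -> A) (M : R).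
Hypothesis M_ge0 : 0 <= M.
Hypothesis mul_linearl : forall y, linear (mul^~ y).
Hypothesis mul_linearr : forall x, linear (mul x).
Hypothesis mul_le : forall x y, rnorm (mul x y) <= M * rnorm x * rnorm y.
Variables (L : G -> A -> A) (w : G -> R).
Hypothesis w_gt0 : forall t, 0 < w t.
Hypothesis L_linear : forall t, linear (L t).
Hypothesis L_0 : forall x, L 0 x = x.
Hypothesis L_D : forall s t x, L (s + t) x = L s (L t x).
Hypothesis L_le : forall t x, rnorm (L t x) <= w t * rnorm x.
Hypothesis L_mull : forall t x y, L t (mul x y) = mul (L t x) y.
Hypothesis L_mulr : forall t x y, L t (mul x y) = mul x (L t y).

Definition translation_comb (S : seq (R[i] * G)) (x : A) : A :=
  \sum_(p <- S) p.1 *: L p.2 x.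

Hypothesis mul_approx : forall c x y e, 0 < e -> exists S,
  rnorm (mul c x - translation_comb S x) <= e /\
  rnorm (mul c y - translation_comb S y) <= e.
Hypothesis right_unit_approx : forall x y e, 0 < e -> exists u,
  rnorm (mul x u - x) <= e /\ rnorm (mul y u - y) <= e.

Variable m : R.
Hypothesis cutoff : forall t, exists n : nat, exists P : A -> A,
  [/\ (0 < n)%N, linear P, forall x, rnorm (P x) <= rnorm x,
      exists C, forall s x, w s * rnorm (P (L (- s) x)) <= C * rnorm x &
      forall x, w (t *+ n) * rnorm (L (- (t *+ n)) x - P (L (- (t *+ n)) x)) <= m * n%:R * rnorm x].

Lemma linD (f : A -> A) : linear f -> forall x y, f (x + y) = f x + f y.
Proof. by move=> lf x y; have := lf 1 x y; rewrite !scale1r. Qed.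
Lemma lin0 (f : A -> A) : linear f -> f 0 = 0.
Proof. by move=> lf; have := lf (-1) 0 0; rewrite scaleN1r oppr0 addr0 scaleN1r addNr. Qed.
Lemma linZ (f : A -> A) : linear f -> forall a x, f (a *: x) = a *: f x.
Proof. by move=> lf a x; have := lf a x 0; rewrite !addr0 lin0// addr0. Qed.
Lemma linB (f : A -> A) : linear f -> forall x y, f (x - y) = f x - f y.
Proof. by move=> lf x y; rewrite linD// -scaleN1r linZ// scaleN1r. Qed.

Lemma comb_mull S x y : translation_comb S (mul x y) = mul (translation_comb S x) y.
Proof.
rewrite /translation_comb; elim: S => [|p S IH].
  by rewrite !big_nil (lin0 (mul_linearl y)).
rewrite !big_cons IH (linD (mul_linearl y)) (linZ (mul_linearl y)).
by rewrite L_mull.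
Qed.

Lemma comb_mulr S x y : translation_comb S (mul x y) = mul x (translation_comb S y).
Proof.
rewrite /translation_comb; elim: S => [|p S IH].
  by rewrite !big_nil (lin0 (mul_linearr x)).
by rewrite !big_cons IH (linD (mul_linearr x)) (linZ (mul_linearr x)) L_mulr.
Qed.

(** Commutation of [mul] with translations, in either argument, passes to
    limits; this yields associativity and, below, left commutativity. Together
    with approximate right units the latter gives commutativity. *)
Lemma mulA_approx c x y : mul c (mul x y) = mul (mul c x) y.
Proof.
have C0 : 0 <= 1 + M * rnorm y by rewrite addr_ge0// mulr_ge0// rnorm_ge0.
apply: (rnorm_eps_eq C0) => e e0.
have [S [S1 S2]] := mul_approx c (mul x y) x e0.
apply: le_trans (rnorm_le_split _ (translation_comb S (mul x y)) _) _.
rewrite mulrDl mul1r lerD// comb_mull -(linB (mul_linearl y)).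
apply: le_trans (mul_le _ _) _; rewrite mulrAC ler_wpM2l//.
  by rewrite mulr_ge0// rnorm_ge0.
by rewrite rnormB.
Qed.

Lemma mulCA_approx c x y : mul c (mul x y) = mul x (mul c y).
Proof.
have C0 : 0 <= 1 + M * rnorm x by rewrite addr_ge0// mulr_ge0// rnorm_ge0.
apply: (rnorm_eps_eq C0) => e e0.
have [S [S1 S2]] := mul_approx c (mul x y) y e0.
apply: le_trans (rnorm_le_split _ (translation_comb S (mul x y)) _) _.
rewrite mulrDl mul1r lerD// comb_mulr -(linB (mul_linearr x)).
apply: le_trans (mul_le _ _) _; rewrite ler_wpM2l//.
  by rewrite mulr_ge0// rnorm_ge0.
by rewrite rnormB.
Qed.

Lemma mulC_approx x y : mul x y = mul y x.
Proof.
have C0 : 0 <= M * rnorm x + M * rnorm y by rewrite addr_ge0// mulr_ge0// rnorm_ge0.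
apply: (rnorm_eps_eq C0) => e e0.
have [u [u1 u2]] := right_unit_approx x y e0.
apply: le_trans (rnorm_le_split _ (mul x (mul y u)) _) _.
rewrite mulrDl lerD//.
  rewrite -(linB (mul_linearr x)); apply: le_trans (mul_le _ _) _.
  by rewrite ler_wpM2l ?mulr_ge0 ?rnorm_ge0// rnormB.
rewrite mulCA_approx -(linB (mul_linearr y)); apply: le_trans (mul_le _ _) _.
by rewrite ler_wpM2l ?mulr_ge0 ?rnorm_ge0.
Qed.

Let blinear_mul b : forall x, rnorm (mul b x) <= M * rnorm b * rnorm x.
Proof. by move=> x; exact: mul_le. Qed.

(* As mul is commutative, phi ⊙ b is the action of b on phi from either side. *)
Local Notation "phi ⊙ b" := (precomp (mul b) phi) (at level 40, left associativity).
Local Notation "phi ⊲ t" := (precomp (L t) phi) (at level 40, left associativity).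

Lemma actE phi b x : (phi ⊙ b) x = phi (mul b x).
Proof. exact: precompE (mul_linearr b) (blinear_mul b). Qed.

Lemma shiftE phi t x : (phi ⊲ t) x = phi (L t x).
Proof. exact: precompE (L_linear t) (L_le t). Qed.

Lemma precomp_linear (T : A -> A) C : linear T -> (forall x, rnorm (T x) <= C * rnorm x) ->
  linear (precomp T : dual A -> dual A).
Proof.
move=> lT bT a phi psi; apply/dualP => x.
by rewrite dual_linE !(precompE _ _ lT bT) dual_linE.
Qed.

Lemma act_le phi b : opnorm (phi ⊙ b) <= opnorm phi * M * rnorm b.
Proof.
apply: opnorm_le_bound => [|x]; first by rewrite !mulr_ge0 ?opnorm_ge0 ?rnorm_ge0.
rewrite actE; apply: le_trans (dual_le _ _) _; rewrite -!mulrA ler_wpM2l ?opnorm_ge0//.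
by rewrite mulrA mul_le.
Qed.

Lemma ract1E a phi : ract1 mul phi a = phi ⊙ a.
Proof. by rewrite precomp_unlock. Qed.

Lemma lact1E a phi : lact1 mul a phi = phi ⊙ a.
Proof.
rewrite precomp_unlock /lact1 /dual_lact; congr (insubd 0 _).
by apply/funext => x; congr (phi _); exact: mulC_approx.
Qed.

Lemma act_linear b : linear (fun phi => phi ⊙ b).
Proof. exact: precomp_linear (mul_linearr b) (blinear_mul b). Qed.

Lemma act_bidual_in b (F : dual (dual A)) :
  ((fun phi => F (phi ⊙ b)) : dual A -> R[i]^o) \in @dual_pred R (dual A).
Proof.
apply: (@bounded_linear_dual _ _ _ (opnorm F * (M * rnorm b))).
  by move=> a phi psi; rewrite act_linear (dual_linear F).
move=> phi; apply: le_trans (dual_le _ _) _; rewrite -mulrA ler_wpM2l ?opnorm_ge0//.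
by rewrite !rnorm_dual; apply: le_trans (act_le _ _) _; rewrite -mulrA mulrC.
Qed.

Lemma lact2E b F phi : lact2 mul b F phi = F (phi ⊙ b).
Proof.
rewrite /lact2 /dual_lact (_ : (fun x => _) = (fun phi => F (phi ⊙ b))).
  by rewrite insubdK//; exact: act_bidual_in.
by apply/funext => psi; rewrite ract1E.
Qed.

Lemma ract2E b F phi : ract2 mul F b phi = F (phi ⊙ b).
Proof.
rewrite /ract2 /dual_ract (_ : (fun x => _) = (fun phi => F (phi ⊙ b))).
  by rewrite insubdK//; exact: act_bidual_in.
by apply/funext => psi; rewrite lact1E.
Qed.

Section derivation.
Variable D : A -> dual (dual A).
Hypothesis D_continuous : continuous D.
Hypothesis D_derivation : derivation mul (lact2 mul) (ract2 mul) D.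

Let D_linear : linear D. Proof. by have [] := D_derivation. Qed.

Lemma derivation_mul a b phi : D (mul a b) phi = D b (phi ⊙ a) + D a (phi ⊙ b).
Proof.
have [_ ->] := D_derivation; rewrite -lact2E -ract2E.
by have := dual_linE 1 (lact2 mul a (D b)) (ract2 mul (D a) b) phi; rewrite scale1r mul1r.
Qed.

Lemma derivation_bounded : exists2 C, 0 <= C & forall a, opnorm (D a) <= C * rnorm a.
Proof.
pose F : {linear A -> dual (dual A)} := HB.pack D (GRing.isLinear.Build _ _ _ _ D D_linear).
have /linear_boundedP : bounded_near F (nbhs 0).
  by apply: continuous_linear_bounded; exact: D_continuous.
move=> /pinfty_ex_gt0[C C0 FC]; exists (complex.Re C).
  by rewrite -ler0c ge0_ReK ltW.
move=> a; rewrite -lecR real_complexM (ge0_ReK (ltW C0)) -rnormE.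
by have := FC a; rewrite (rnormE (F a)) rnorm_dual.
Qed.

Lemma D_le : exists2 C, 0 <= C &
  forall a phi, normc (D a phi) <= C * rnorm a * opnorm phi.
Proof.
have [C C0 DC] := derivation_bounded; exists C => // a phi.
by apply: le_trans (dual_le _ _) _; rewrite rnorm_dual ler_wpM2r ?opnorm_ge0.
Qed.

Let DB a b phi : D (a - b) phi = D a phi - D b phi.
Proof.
have -> : D (a - b) = D a - D b by rewrite addrC -scaleN1r D_linear scaleN1r addrC.
exact: dual_subE.
Qed.

(** Vanishes for all [a] and [phi] when [D] commutes with the translation by [t],
    which acts on the bidual as its double transpose. *)
Definition defect t a phi : R[i] := D (L t a) (phi ⊲ (- t)) - D a phi.

Lemma shift_act_opp phi t b : (phi ⊲ t) ⊙ b = (phi ⊙ b) ⊲ t.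
Proof. by apply/dualP => x; rewrite actE !shiftE actE L_mulr. Qed.

Lemma shift_act_L phi t a : (phi ⊲ (- t)) ⊙ (L t a) = phi ⊙ a.
Proof. by apply/dualP => x; rewrite !actE shiftE L_mull -L_D addNr L_0. Qed.

Lemma shift0 phi : phi ⊲ 0 = phi.
Proof. by apply/dualP => x; rewrite shiftE L_0. Qed.

Lemma shiftD phi s t : phi ⊲ (s + t) = (phi ⊲ s) ⊲ t.
Proof. by apply/dualP => x; rewrite !shiftE L_D. Qed.

(** Expand [D] of the product [L t (mul a b)] by the Leibniz rule in two ways,
    [t] moving [a] or moving [b]. *)
Lemma defect_swap t a b phi : defect t a (phi ⊙ b) = defect t b (phi ⊙ a).
Proof.
have : D (mul (L t a) b) (phi ⊲ (- t)) = D (mul (L t b) a) (phi ⊲ (- t)).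
  by rewrite -!L_mull mulC_approx.
rewrite !derivation_mul !shift_act_L !shift_act_opp /defect => h.
by rewrite -[X in X - _](addKr (D b (phi ⊙ a))) h; ring.
Qed.

(** On functionals [phi ⊙ b] the defect is additive in [t]: by [defect_swap] one
    may exchange [a] for [b], and then the translation of [a] is absorbed by that
    of the functional. *)
Lemma defectD s t a b phi :
  defect (s + t) a (phi ⊙ b) = defect s a (phi ⊙ b) + defect t a (phi ⊙ b).
Proof.
have h : defect s (L t a) ((phi ⊙ b) ⊲ (- t)) = defect s a (phi ⊙ b).
  by rewrite -shift_act_opp defect_swap shift_act_L defect_swap.
by rewrite -h /defect L_D opprD [- s - t]addrC shiftD addrA subrK.
Qed.

Lemma defectMn t n a b phi : defect (t *+ n) a (phi ⊙ b) = n%:R * defect t a (phi ⊙ b).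
Proof.
elim: n => [|n IH]; last by rewrite mulrS defectD IH -[n.+1%:R]natr1 mulrDl mul1r addrC.
by rewrite mulr0n mul0r /defect oppr0 L_0 shift0 subrr.
Qed.

Lemma defect_le : exists2 C, 0 <= C & forall t a phi,
  normc (defect t a phi) <= C * rnorm a * (w t * opnorm (phi ⊲ (- t)) + opnorm phi).
Proof.
have [C C0 DC] := D_le; exists C => // t a phi.
apply: le_trans (normc_sub _ _) _; rewrite mulrDr lerD//.
apply: le_trans (DC _ _) _; rewrite mulrA ler_wpM2r ?opnorm_ge0//.
by rewrite -mulrA ler_wpM2l// mulrC L_le.
Qed.

Lemma defectB t a phi psi : defect t a (phi - psi) = defect t a phi - defect t a psi.
Proof.
rewrite /defect.
have -> : (phi - psi) ⊲ (- t) = (phi ⊲ (- t)) - (psi ⊲ (- t)).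
  by apply/dualP => x; rewrite shiftE !dual_subE !shiftE.
by rewrite !dualB; ring.
Qed.

Lemma weighted_opnorm_le (phi : dual A) C t : 0 <= C ->
  (forall x, w t * normc (phi x) <= C * rnorm x) -> w t * opnorm phi <= C.
Proof.
move=> C0 h; rewrite -ler_pdivlMl//; apply: opnorm_le_bound.
  by rewrite mulr_ge0// invr_ge0 ltW.
by move=> x; rewrite -mulrA ler_pdivlMl.
Qed.

(** The bound on [P (L (- s) x)], uniform in [s], bounds the defect along the
    multiples of [t], whereas additivity makes it grow linearly unless it is
    0. *)
Lemma defect_near a b phi (P : A -> A) C t : linear P ->
  (forall x, rnorm (P x) <= rnorm x) ->
  (forall s x, w s * rnorm (P (L (- s) x)) <= C * rnorm x) ->
  defect t a (precomp P phi ⊙ b) = 0.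
Proof.
move=> lP P1 PC; have P1' x : rnorm (P x) <= 1 * rnorm x by rewrite mul1r.
have [K K0 DK] := defect_le.
pose C' := Num.max C 0.
have C'0 : 0 <= C' by rewrite le_max lexx orbT.
pose B := opnorm phi * (C' * (M * rnorm b)).
have B0 : 0 <= B by rewrite !mulr_ge0 ?opnorm_ge0 ?rnorm_ge0.
apply: (@normc_archi0 _ _ (K * rnorm a * (B + opnorm (precomp P phi ⊙ b)))) => n.
rewrite -normc_nat -defectMn; apply: le_trans (DK _ _ _) _.
rewrite ler_wpM2l ?mulr_ge0 ?rnorm_ge0// lerD2r; apply: weighted_opnorm_le => // x.
rewrite shiftE actE (precompE _ _ lP P1') -L_mulr.
apply: (@le_trans _ _ (w (t *+ n) * (opnorm phi * rnorm (P (L (- (t *+ n)) (mul b x)))))).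
  by rewrite ler_wpM2l ?(ltW (w_gt0 _))// dual_le.
rewrite mulrCA /B -!mulrA ler_wpM2l ?opnorm_ge0//.
apply: le_trans (PC _ _) _; apply: (@le_trans _ _ (C' * rnorm (mul b x))).
  by rewrite ler_wpM2r ?rnorm_ge0// le_max lexx.
by rewrite ler_wpM2l// mulrA mul_le.
Qed.

(** Split [phi] with the operator [P] of [cutoff t]. The kept part has no defect,
    and the removed part has defect at most of order [n] at [t *+ n], hence, by
    additivity, at most a constant at [t]. *)
Lemma defect_bounded a b phi : exists C, forall t, normc (defect t a (phi ⊙ b)) <= C.
Proof.
have [K K0 DK] := defect_le.
pose m' := Num.max m 0.
have m'0 : 0 <= m' by rewrite le_max lexx orbT.
pose B := opnorm phi * (M * rnorm b).
have B0 : 0 <= B by rewrite !mulr_ge0 ?opnorm_ge0 ?rnorm_ge0.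
exists (K * rnorm a * (B * m' + 2 * B)) => t.
have [n [P [n0 lP P1 [C PC] Pm]]] := cutoff t.
have P1' x : rnorm (P x) <= 1 * rnorm x by rewrite mul1r.
have nR0 : 0 < n%:R :> R by rewrite ltr0n.
have nR1 : 1 <= n%:R :> R by rewrite ler1n.
rewrite -(ler_pM2l nR0) -normc_nat -defectMn.
pose chi := phi - precomp P phi.
have chiE x : chi x = phi (x - P x) by rewrite dual_subE (precompE _ _ lP P1') dualB.
have actB : (phi ⊙ b) - (precomp P phi ⊙ b) = chi ⊙ b.
  by apply/dualP => x; rewrite dual_subE !actE dual_subE.
have -> : defect (t *+ n) a (phi ⊙ b) = defect (t *+ n) a (chi ⊙ b).
  by rewrite -actB defectB (defect_near a b phi _ lP P1 PC) subr0.
apply: le_trans (DK _ _ _) _; rewrite mulrCA ler_wpM2l ?mulr_ge0 ?rnorm_ge0//.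
rewrite mulrDr; apply: lerD.
  apply: weighted_opnorm_le => [|x]; first by rewrite mulr_ge0// mulr_ge0.
  rewrite shiftE actE chiE -L_mulr.
  apply: le_trans (ler_wpM2l (ltW (w_gt0 _)) (dual_le _ _)) _.
  rewrite mulrCA (_ : n%:R * _ * _ = opnorm phi * (m' * n%:R * (M * rnorm b * rnorm x))); last first.
    by rewrite /B; ring.
  rewrite ler_wpM2l ?opnorm_ge0//; apply: le_trans (Pm _) _.
  apply: (@le_trans _ _ (m' * n%:R * rnorm (mul b x))).
    by rewrite ler_wpM2r ?rnorm_ge0// ler_wpM2r ?(ltW nR0)// le_max lexx.
  by rewrite ler_wpM2l ?mul_le// mulr_ge0// ltW.
apply: (@le_trans _ _ (2 * B)); last by rewrite ler_peMl// mulr_ge0.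
apply: opnorm_le_bound => [|x]; first by rewrite mulr_ge0.
rewrite actE chiE; apply: le_trans (dual_le _ _) _.
rewrite (_ : 2 * B * rnorm x = opnorm phi * (2 * (M * rnorm b * rnorm x))); last first.
  by rewrite /B; ring.
rewrite ler_wpM2l ?opnorm_ge0//.
apply: le_trans (rnormD _ _) _; rewrite rnormN.
apply: (@le_trans _ _ (2 * rnorm (mul b x))); last by rewrite ler_wpM2l// mul_le.
by rewrite mulr_natl mulr2n lerD2l.
Qed.

Lemma defect0 t a b phi : defect t a (phi ⊙ b) = 0.
Proof.
have [C DC] := defect_bounded a b phi; apply: (@normc_archi0 _ _ C) => n.
by rewrite -normc_nat -defectMn.
Qed.

Lemma D_translation t a b phi : D (L t a) (phi ⊙ b) = D a (phi ⊙ (L t b)).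
Proof.
have := defect0 t a b (phi ⊲ t); rewrite /defect => /eqP; rewrite subr_eq0 => /eqP.
have -> : ((phi ⊲ t) ⊙ b) ⊲ (- t) = phi ⊙ b.
  by apply/dualP => x; rewrite shiftE !actE shiftE -L_mulr -L_D subrr L_0.
by move=> ->; congr (D a _); apply/dualP => x; rewrite !actE shiftE L_mull.
Qed.

Lemma act_sub phi a b : phi ⊙ (a - b) = (phi ⊙ a) - (phi ⊙ b).
Proof.
by apply/dualP => x; rewrite dual_subE !actE (linB (mul_linearl x)) dualB.
Qed.

Lemma D_comb S a b phi :
  D (translation_comb S a) (phi ⊙ b) = D a (phi ⊙ (translation_comb S b)).
Proof.
rewrite /translation_comb; elim: S => [|p S IH].
  rewrite !big_nil; have := act_sub phi 0 0; rewrite !subrr => ->.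
  have := DB 0 0 (phi ⊙ b); rewrite !subrr => ->.
  by have := dualB (D a) 0 0; rewrite !subrr => ->.
rewrite !big_cons D_linear dual_linE IH D_translation.
have -> : phi ⊙ (p.1 *: L p.2 b + \sum_(p0 <- S) p0.1 *: L p0.2 b) =
    p.1 *: (phi ⊙ (L p.2 b)) + phi ⊙ (\sum_(p0 <- S) p0.1 *: L p0.2 b).
  apply/dualP => x; rewrite dual_linE !actE (linD (mul_linearl x)) (linZ (mul_linearl x)).
  by rewrite dualD dualZ.
by rewrite dualD dualZ.
Qed.

(** Equivariance under translations extends to multiplication operators, which
    are limits of combinations of translations. *)
Lemma D_module c a b phi : D (mul c a) (phi ⊙ b) = D a (phi ⊙ (mul c b)).
Proof.
have [K K0 DK] := D_le.
apply/eqP; rewrite -subr_eq0; apply/eqP.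
apply: (@normc_eps0 _ _ (K * opnorm (phi ⊙ b) + K * rnorm a * (opnorm phi * M))).
  by rewrite addr_ge0// !mulr_ge0 ?opnorm_ge0 ?rnorm_ge0.
move=> e e0; have [S [Sa Sb]] := mul_approx c a b e0.
rewrite (_ : _ - _ = D (mul c a - translation_comb S a) (phi ⊙ b) -
    D a (phi ⊙ (mul c b - translation_comb S b))); last first.
  by rewrite DB act_sub dualB D_comb; ring.
apply: le_trans (normc_sub _ _) _; rewrite mulrDl; apply: lerD.
  apply: le_trans (DK _ _) _; rewrite mulrAC ler_wpM2l//.
  by rewrite mulr_ge0 ?opnorm_ge0.
apply: le_trans (DK _ _) _; rewrite -(mulrA (K * rnorm a)) ler_wpM2l ?mulr_ge0 ?rnorm_ge0//.
by apply: le_trans (act_le _ _) _; rewrite ler_wpM2l// mulr_ge0 ?opnorm_ge0.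
Qed.

(** Compare [D_module] with the Leibniz rule for the product of [c] and [a]. *)
Lemma D_act_mul0 c a b phi : D c (phi ⊙ (mul b a)) = 0.
Proof.
have := derivation_mul c a (phi ⊙ b); rewrite D_module.
have -> : (phi ⊙ b) ⊙ c = phi ⊙ (mul c b).
  by apply/dualP => x; rewrite !actE mulA_approx (mulC_approx b c).
have -> : (phi ⊙ b) ⊙ a = phi ⊙ (mul b a).
  by apply/dualP => x; rewrite !actE mulA_approx.
by move=> /eqP; rewrite addrC -subr_eq subrr eq_sym => /eqP.
Qed.

Lemma D_act0 c d phi : D c (phi ⊙ d) = 0.
Proof.
have [K K0 DK] := D_le.
apply: (@normc_eps0 _ _ (K * rnorm c * (opnorm phi * M))).
  by rewrite !mulr_ge0 ?opnorm_ge0 ?rnorm_ge0.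
move=> e e0; have [u [u1 _]] := right_unit_approx d d e0.
have -> : D c (phi ⊙ d) = D c (phi ⊙ (d - mul d u)).
  by rewrite act_sub dualB D_act_mul0 subr0.
apply: le_trans (DK _ _) _; rewrite -(mulrA (K * rnorm c)) ler_wpM2l ?mulr_ge0 ?rnorm_ge0//.
apply: le_trans (act_le _ _) _; rewrite ler_wpM2l ?mulr_ge0 ?opnorm_ge0//.
by rewrite rnormB.
Qed.

Lemma derivation_eq0 c phi : D c phi = 0.
Proof.
have [K K0 DK] := D_le.
apply: (@normc_eps0 _ _ (K * opnorm phi)); first by rewrite mulr_ge0 ?opnorm_ge0.
move=> e e0; have [u [u1 _]] := right_unit_approx c c e0.
have -> : D c phi = D (c - mul c u) phi.
  by rewrite DB derivation_mul !D_act0 addr0 subr0.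
apply: le_trans (DK _ _) _; rewrite mulrAC ler_wpM2l ?mulr_ge0 ?opnorm_ge0//.
by rewrite rnormB.
Qed.

End derivation.

(** Both actions of the algebra on its bidual coincide, so that the inner
    derivation given by [0] is the only one. *)
Theorem translation_algebra_two_weakly_amenable : two_weakly_amenable mul.
Proof.
move=> D D_cont D_der; exists 0 => a; apply/dualP => phi.
transitivity (0 : R[i]); first exact: derivation_eq0.
symmetry; transitivity (lact2 mul a 0 phi - ract2 mul 0 a phi).
  exact: dual_subE.
have e1 := lact2E a 0 phi; have e2 := ract2E a 0 phi.
apply: etrans (congr2 (fun y z : R[i] => y - z) e1 e2) _.
exact: subrr.
Qed.

End translation_algebra.

(** * Complex-valued functions *)

Lemma real_complexB (R : realType) (x y : R) : (x - y)%:C%C = x%:C%C - y%:C%C.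
Proof. exact: rmorphB. Qed.

Lemma normc_realE (R : realType) (x : R) : normc x%:C%C = `|x|.
Proof. by rewrite /= expr0n/= addr0 sqrtr_sqr. Qed.

Section complex_functions.
Variables (R : realType) (d : measure_display) (T : measurableType d).
Implicit Types (f g : T -> R[i]).

Lemma normc_le_ReIm (z : R[i]) : normc z <= `|complex.Re z| + `|complex.Im z|.
Proof.
case: z => a b /=; rewrite -(@ler_pXn2r _ 2)// ?nnegrE ?sqrtr_ge0 ?addr_ge0//.
rewrite sqr_sqrtr ?addr_ge0 ?sqr_ge0//.
have ab : 0 <= `|a| * `|b| by rewrite mulr_ge0.
by rewrite sqrrD !real_normK ?num_real//; lra.
Qed.

Lemma Re_le_normc (z : R[i]) : `|complex.Re z| <= normc z.
Proof.
case: z => a b /=; rewrite -(@ler_pXn2r _ 2)// ?nnegrE ?sqrtr_ge0//.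
by rewrite sqr_sqrtr ?addr_ge0 ?sqr_ge0// real_normK ?num_real// lerDl sqr_ge0.
Qed.

Lemma Im_le_normc (z : R[i]) : `|complex.Im z| <= normc z.
Proof.
case: z => a b /=; rewrite -(@ler_pXn2r _ 2)// ?nnegrE ?sqrtr_ge0//.
by rewrite sqr_sqrtr ?addr_ge0 ?sqr_ge0// real_normK ?num_real// lerDr sqr_ge0.
Qed.

Definition cmeasurable f := measurable_fun setT (fun t => complex.Re (f t)) /\
  measurable_fun setT (fun t => complex.Im (f t)).

Lemma ReM (y z : R[i]) : complex.Re (y * z) =
  complex.Re y * complex.Re z - complex.Im y * complex.Im z.
Proof. by case: y z => [a b] [c e]. Qed.

Lemma ImM (y z : R[i]) : complex.Im (y * z) =
  complex.Re y * complex.Im z + complex.Im y * complex.Re z.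
Proof. by case: y z => [a b] [c e]. Qed.

Lemma ReD (y z : R[i]) : complex.Re (y + z) = complex.Re y + complex.Re z.
Proof. by case: y z => [a b] [c e]. Qed.

Lemma ImD (y z : R[i]) : complex.Im (y + z) = complex.Im y + complex.Im z.
Proof. by case: y z => [a b] [c e]. Qed.

Lemma cmeasurableM f g : cmeasurable f -> cmeasurable g -> cmeasurable (fun t => f t * g t).
Proof.
move=> [rf jf] [rg jg]; split.
  under eq_fun do rewrite ReM.
  by apply: measurable_funB; apply: measurable_funM.
under eq_fun do rewrite ImM.
by apply: measurable_funD; apply: measurable_funM.
Qed.

Lemma cmeasurable_real (h : T -> R) : measurable_fun setT h -> cmeasurable (fun t => (h t)%:C%C).
Proof. by move=> mh; split => //=; exact: measurable_cst. Qed.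

Lemma measurable_normc f : cmeasurable f -> measurable_fun setT (fun t => normc (f t)).
Proof.
move=> [mr mj].
rewrite (_ : (fun t => _) = (fun t => Num.sqrt (complex.Re (f t) ^+ 2 +
  complex.Im (f t) ^+ 2))); last by apply/funext => t; case: (f t).
apply: (measurableT_comp (f := @Num.sqrt R)).
  by apply: continuous_measurable_fun; exact: sqrt_continuous.
by apply: measurable_funD; [exact: (measurable_funX 2 mr)|exact: (measurable_funX 2 mj)].
Qed.

End complex_functions.

Lemma cmeasurable_comp (R : realType) d d' (T : measurableType d) (U : measurableType d')
    (f : U -> R[i]) (h : T -> U) :
  cmeasurable f -> measurable_fun setT h -> cmeasurable (f \o h).
Proof. by move=> [rf jf] mh; split; [exact: (measurableT_comp rf mh)|exact: (measurableT_comp jf mh)]. Qed.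

Section complex_integral.
Variables (R : realType) (G : topologicalZmodType).
Variable mu : {measure set (borel G) -> \bar R}.
Implicit Types (f g : borel G -> R[i]).

Lemma cintegrable_measurable f : cintegrable mu f -> cmeasurable f.
Proof. by move=> [rf jf]; split; apply/measurable_EFinP; [exact: measurable_int rf|exact: measurable_int jf]. Qed.

Lemma cintegrableP f : cintegrable mu f <->
  cmeasurable f /\ mu.-integrable setT (fun t => (normc (f t))%:E).
Proof.
split=> [fi|[[rf jf] fi]].
  by split; [exact: cintegrable_measurable|exact: cintegrable_normc].
split; apply: le_integrable fi => //.
- exact/measurable_EFinP.
- by move=> t _; rewrite /= lee_fin (ger0_norm (normc_ge0 _)) Re_le_normc.
- exact/measurable_EFinP.
- by move=> t _; rewrite /= lee_fin (ger0_norm (normc_ge0 _)) Im_le_normc.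
Qed.

Lemma cintegral_linear a f g : cintegrable mu f -> cintegrable mu g ->
  cintegral mu (fun t => a * f t + g t) = a * cintegral mu f + cintegral mu g.
Proof.
move=> [rf jf] [rg jg].
have rZ (c : R) (h : borel G -> R) : mu.-integrable setT (EFin \o h) ->
    mu.-integrable setT (EFin \o (fun t => c * h t)).
  by move=> hi; exact: (integrableZl measurableT c hi).
have rB (h k : borel G -> R) : mu.-integrable setT (EFin \o h) -> mu.-integrable setT (EFin \o k) ->
    mu.-integrable setT (EFin \o (fun t => h t - k t)).
  by move=> hi ki; exact: (integrableB measurableT hi ki).
have rD (h k : borel G -> R) : mu.-integrable setT (EFin \o h) -> mu.-integrable setT (EFin \o k) ->
    mu.-integrable setT (EFin \o (fun t => h t + k t)).
  by move=> hi ki; exact: (integrableD measurableT hi ki).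
rewrite /cintegral.
have -> : \int[mu]_(t in setT) complex.Re (a * f t + g t) =
    complex.Re a * \int[mu]_(t in setT) complex.Re (f t) -
    complex.Im a * \int[mu]_(t in setT) complex.Im (f t) + \int[mu]_(t in setT) complex.Re (g t).
  under eq_Rintegral do rewrite ReD ReM.
  rewrite RintegralD//; last by apply: rB; exact: rZ.
  by rewrite RintegralB ?RintegralZl//; exact: rZ.
have -> : \int[mu]_(t in setT) complex.Im (a * f t + g t) =
    complex.Re a * \int[mu]_(t in setT) complex.Im (f t) +
    complex.Im a * \int[mu]_(t in setT) complex.Re (f t) + \int[mu]_(t in setT) complex.Im (g t).
  under eq_Rintegral do rewrite ImD ImM.
  rewrite RintegralD//; last by apply: rD; exact: rZ.
  by rewrite RintegralD ?RintegralZl//; exact: rZ.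
by case: a.
Qed.

End complex_integral.

(** * Classes of weighted integrable functions *)

Section beurling_classes.
Variables (R : realType) (G : topologicalZmodType).
Variable mu : {measure set (borel G) -> \bar R}.
Variable w : weight R G.
Implicit Types (f g : G -> R[i]).

Local Notation A := (beurling mu w).
Local Notation cls := (beurling_class mu w).

(** Integrability of the modulus with measurability of [f] itself is handier for
    estimates than integrability of real and imaginary parts. *)
Definition wintegrable f := cmeasurable (f : borel G -> R[i]) /\
  mu.-integrable setT (fun t : borel G => (normc (f t) * w t)%:E).

Lemma weight_measurable : measurable_fun setT (w : borel G -> R).
Proof. by apply: continuous_borelR; exact: weight_continuous. Qed.

Lemma weight_inv_measurable : measurable_fun setT (fun t : borel G => (w t)^-1).
Proof.
apply: continuous_borelR => t; apply: cvgV; last exact: weight_continuous.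
by rewrite gt_eqF// weight_gt0.
Qed.

Lemma normc_weight (z : R[i]) t : normc (z * (w t)%:C%C) = normc z * w t.
Proof.
rewrite ComplexField.Normc.normcM; congr (_ * _).
by rewrite /= expr0n/= addr0 sqrtr_sqr gtr0_norm// weight_gt0.
Qed.

Lemma wintegrableP f : wintegrable f <-> ((f : G -> R[i]^o) \in L1w_pred mu w).
Proof.
have wC : cmeasurable (fun t : borel G => (w t)%:C%C : R[i]).
  by apply: cmeasurable_real; exact: weight_measurable.
split=> [[mf fi]|/asboolP/cintegrableP[mfw fi]].
  apply/asboolP/cintegrableP; split; first exact: cmeasurableM.
  by under eq_fun do rewrite normc_weight.
split; last by move: fi; under eq_fun do rewrite normc_weight.
have wV : cmeasurable (fun t : borel G => ((w t)^-1)%:C%C : R[i]).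
  by apply: cmeasurable_real; exact: weight_inv_measurable.
have := cmeasurableM mfw wV; congr cmeasurable; apply/funext => t.
by rewrite -mulrA -real_complexM mulfV ?mulr1// gt_eqF// weight_gt0.
Qed.

Lemma wintegrable_linear a f g : wintegrable f -> wintegrable g ->
  wintegrable (fun t => a * f t + g t).
Proof.
move=> /wintegrableP fP /wintegrableP gP; apply/wintegrableP.
have [_ h] := L1w_submod mu w; exact: (h a _ _ fP gP).
Qed.

Lemma wintegrable_repr (x : A) : wintegrable (repr x : L1w mu w).
Proof. by apply/wintegrableP; exact: L1wP. Qed.

Lemma cls_pi f (fP : (f : G -> R[i]^o) \in L1w_pred mu w) :
  cls f = \pi_(beurling mu w)%qT (MkL1w fP).
Proof.
rewrite /beurling_class; congr (\pi_(beurling mu w)%qT _).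
by apply/val_inj; rewrite /= insubdK.
Qed.

Lemma cls_repr (x : A) : cls (repr x : L1w mu w) = x.
Proof.
rewrite (cls_pi (L1wP (repr x))) -[RHS]reprK; congr (\pi_(beurling mu w)%qT _).
by apply/val_inj.
Qed.

Lemma cls_ind (P : A -> Prop) : (forall f, wintegrable f -> P (cls f)) -> forall x, P x.
Proof. by move=> h x; rewrite -(cls_repr x); apply: h; exact: wintegrable_repr. Qed.

Lemma cls_linear a f g : wintegrable f -> wintegrable g ->
  cls (fun t => a * f t + g t) = a *: cls f + cls g.
Proof.
move=> fi gi; have /wintegrableP := wintegrable_linear a fi gi.
move/wintegrableP : fi => fP; move/wintegrableP : gi => gP => hP.
rewrite (cls_pi fP) (cls_pi gP) (cls_pi hP).
rewrite -[_ *: _]/(beurling_scale _ _) -beurling_piZ -beurling_piD.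
by congr (\pi_(beurling mu w)%qT _); apply/val_inj.
Qed.

Lemma cls_ae f g : wintegrable f -> wintegrable g ->
  {ae mu, forall t : borel G, f t = g t} -> cls f = cls g.
Proof.
move=> /wintegrableP fP /wintegrableP gP fg.
by rewrite (cls_pi fP) (cls_pi gP); apply/eqP/beurling_eqP.
Qed.

Lemma cls_norm f : wintegrable f ->
  (rnorm (cls f))%:E = (\int[mu]_t (normc (f t) * w t)%:E)%E.
Proof.
move=> fi; have [_ fi'] := fi; move/wintegrableP : fi => fP.
rewrite (cls_pi fP) /rnorm -[`|_|]/(beurling_norm _) beurling_norm_pi /=.
by rewrite /Rintegral fineK//; exact: integrable_fin_num.
Qed.

Lemma wintegrable0 : wintegrable (fun=> 0).
Proof.
apply/wintegrableP; have [h _] := L1w_submod mu w; exact: h.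
Qed.

Lemma cls0 : cls (fun=> 0) = 0.
Proof.
have := cls_linear (-1) wintegrable0 wintegrable0.
by rewrite scaleN1r addNr; under eq_fun do rewrite mulr0 addr0.
Qed.

(** The difference of [f] and of the chosen representative of its class has norm
    0, and so has its image by [T]. Operators on classes are defined through
    representatives and computed with this lemma. *)
Lemma lift_cls (T : (G -> R[i]) -> (G -> R[i])) (C : R) :
  (forall a f g, wintegrable f -> wintegrable g ->
    cls (T (fun t => a * f t + g t)) = a *: cls (T f) + cls (T g)) ->
  (forall f, wintegrable f -> rnorm (cls (T f)) <= C * rnorm (cls f)) ->
  forall f, wintegrable f -> cls (T (repr (cls f) : L1w mu w)) = cls (T f).
Proof.
move=> Tlin Tle f fi; have ri := wintegrable_repr (cls f).
apply/eqP; rewrite -subr_eq0 -normr_eq0 rnormE.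
suff -> : rnorm (cls (T (repr (cls f) : L1w mu w)) - cls (T f)) = 0 by [].
apply/eqP; rewrite eq_le rnorm_ge0 andbT.
rewrite addrC -scaleN1r -Tlin//; apply: le_trans (Tle _ (wintegrable_linear _ fi ri)) _.
by rewrite cls_linear// scaleN1r cls_repr addNr rnorm0 mulr0.
Qed.

Lemma lift_linear (T : (G -> R[i]) -> (G -> R[i])) (C : R) :
  (forall a f g, wintegrable f -> wintegrable g ->
    cls (T (fun t => a * f t + g t)) = a *: cls (T f) + cls (T g)) ->
  (forall f, wintegrable f -> rnorm (cls (T f)) <= C * rnorm (cls f)) ->
  linear (fun x : A => cls (T (repr x : L1w mu w))).
Proof.
move=> Tlin Tle a; elim/cls_ind => f fi; elim/cls_ind => g gi.
rewrite -cls_linear// !(lift_cls Tlin Tle)//; last exact: wintegrable_linear.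
exact: Tlin.
Qed.

Lemma lift_le (T : (G -> R[i]) -> (G -> R[i])) (C : R) :
  (forall f, wintegrable f -> rnorm (cls (T f)) <= C * rnorm (cls f)) ->
  forall x : A, rnorm (cls (T (repr x : L1w mu w))) <= C * rnorm x.
Proof.
by move=> Tle x; rewrite -[X in _ <= _ * rnorm X]cls_repr; apply: Tle; exact: wintegrable_repr.
Qed.

End beurling_classes.

(** * Translations and truncations of functions *)

Section beurling_operators.
Variables (R : realType) (G : topologicalZmodType).
Variable mu : {measure set (borel G) -> \bar R}.
Hypothesis mu_haar : haar_measure mu.
Variable w : weight R G.
Implicit Types (f g : G -> R[i]).

Local Notation A := (beurling mu w).
Local Notation cls := (beurling_class mu w).
Local Notation wintegrable := (wintegrable mu w).
Local Notation wdens f := (fun t : borel G => normc (f t) * w t).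

Lemma wdens_ge0 f t : 0 <= normc (f t) * w t.
Proof. by rewrite mulr_ge0 ?normc_ge0// ltW// weight_gt0. Qed.

Lemma measurable_wdens f : cmeasurable (f : borel G -> R[i]) ->
  measurable_fun setT (wdens f).
Proof.
move=> mf; apply: measurable_funM; first exact: measurable_normc.
exact: weight_measurable.
Qed.

Lemma wintegrable_finite f : cmeasurable (f : borel G -> R[i]) ->
  (\int[mu]_t (normc (f t) * w t)%:E < +oo)%E -> wintegrable f.
Proof.
move=> mf foo; split => //; apply/integrableP; split.
  by apply/measurable_EFinP; exact: measurable_wdens.
by under eq_integral do rewrite gee0_abs ?lee_fin ?wdens_ge0//.
Qed.

Definition translate t f : G -> R[i] := fun s => f (s - t).

Lemma cmeasurable_translate t f : cmeasurable (f : borel G -> R[i]) ->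
  cmeasurable (translate t f : borel G -> R[i]).
Proof.
by move=> mf; apply: (cmeasurable_comp mf (continuous_borel (@addr_continuous G (- t)))).
Qed.

Lemma integral_translate (h : borel G -> \bar R) t : measurable_fun setT h ->
  (\int[mu]_s h (s - t)%R = \int[mu]_s h s)%E.
Proof.
move=> mh; rewrite -(haar_integral_addl mu_haar (- t) mh).
by apply: eq_integral => s _; rewrite addrC.
Qed.

(** All the operators on functions used below are controlled by such a pointwise
    domination by a translate of the density of [f]. *)
Lemma wintegrable_dominated t f g (c : R) : cmeasurable (g : borel G -> R[i]) ->
  wintegrable f -> 0 <= c ->
  (forall s, normc (g s) * w s <= c * (normc (f (s - t)) * w (s - t))) ->
  wintegrable g /\ rnorm (cls g) <= c * rnorm (cls f).
Proof.
move=> mg fi c0 gf; have [mf _] := fi.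
have mfw : measurable_fun setT (fun s : borel G => (normc (f s) * w s)%:E).
  by apply/measurable_EFinP; exact: measurable_wdens.
have mfs : measurable_fun setT (fun s : borel G => (normc (f (s - t)) * w (s - t))%:E).
  exact: (measurableT_comp mfw (continuous_borel (@addr_continuous G (- t)))).
have h : (\int[mu]_s (normc (g s) * w s)%:E <= c%:E * \int[mu]_s (normc (f s) * w s)%:E)%E.
  rewrite -(integral_translate t mfw) -ge0_integralZl//; last first.
  - by move=> s _; rewrite lee_fin wdens_ge0.
  apply: ge0_le_integral => //.
  - by move=> s _; rewrite lee_fin wdens_ge0.
  - by apply/measurable_EFinP; exact: measurable_wdens.
  - exact: measurable_funeM.
  - by move=> s _; rewrite -EFinM lee_fin.
have gi : wintegrable g.
  apply: wintegrable_finite => //; apply: le_lt_trans h _.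
  by rewrite -cls_norm// -EFinM ltry.
by split => //; rewrite -lee_fin EFinM !cls_norm.
Qed.

Lemma wintegrable_translate t f : wintegrable f ->
  wintegrable (translate t f) /\ rnorm (cls (translate t f)) <= w t * rnorm (cls f).
Proof.
move=> fi; have [mf _] := fi.
apply: (@wintegrable_dominated t) => //; first exact: cmeasurable_translate.
  by rewrite ltW// weight_gt0.
move=> s; rewrite mulrCA ler_wpM2l ?normc_ge0//.
by rewrite -{1}(subrK t s) mulrC weight_submul.
Qed.

Lemma translate_linear t a f g : translate t (fun s => a * f s + g s) =
  (fun s => a * translate t f s + translate t g s).
Proof. by []. Qed.

Definition truncate (K : set G) f : G -> R[i] := fun s => f s * (\1_(K : set (borel G)) s)%:C%C.

Lemma cmeasurable_truncate (K : set G) f : measurable (K : set (borel G)) ->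
  cmeasurable (f : borel G -> R[i]) -> cmeasurable (truncate K f : borel G -> R[i]).
Proof.
move=> mK mf; apply: cmeasurableM => //; apply: cmeasurable_real.
exact: measurable_indic.
Qed.

Lemma normc_real (x : R) : 0 <= x -> normc x%:C%C = x.
Proof. by move=> x0; rewrite /= expr0n/= addr0 sqrtr_sqr ger0_norm. Qed.

Lemma normc_truncate (K : set G) f s : normc (truncate K f s) = normc (f s) * \1_(K : set (borel G)) s.
Proof. by rewrite ComplexField.Normc.normcM normc_real. Qed.

Lemma wintegrable_truncate (K : set G) f : measurable (K : set (borel G)) -> wintegrable f ->
  wintegrable (truncate K f) /\ rnorm (cls (truncate K f)) <= 1 * rnorm (cls f).
Proof.
move=> mK fi; apply: (@wintegrable_dominated 0) => //.
  by apply: cmeasurable_truncate => //; have [] := fi.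
move=> t; rewrite subr0 mul1r normc_truncate ler_wpM2r ?(ltW (weight_gt0 _ _))//.
by rewrite ler_piMr ?normc_ge0// indicE lern1 leq_b1.
Qed.

Lemma truncate_linear (K : set G) a f g : truncate K (fun s => a * f s + g s) =
  (fun s => a * truncate K f s + truncate K g s).
Proof. by apply/funext => s; rewrite /truncate mulrDl mulrA. Qed.

End beurling_operators.

(** * Convolution of weighted integrable functions *)

Section beurling_convolution.
Variables (R : realType) (G : topologicalZmodType).
Hypothesis G_hausdorff : hausdorff_space G.
Hypothesis G_locally_compact : locally_compact [set: G].
Variable mu : {measure set (borel G) -> \bar R}.
Hypothesis mu_haar : haar_measure mu.
Variable w : weight R G.
Implicit Types (f g : G -> R[i]).

Local Notation A := (beurling mu w).
Local Notation cls := (beurling_class mu w).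
Local Notation wintegrable := (wintegrable mu w).
Local Notation conv := (convolution mu).
Local Notation wdens f := (fun t : borel G => normc (f t) * w t).

(** The convolution of the two densities with respect to [mu]; it dominates the
    density of the convolution because [w] is submultiplicative. *)
Let wconv f g (t : borel G) : \bar R :=
  (\int[mu]_s (normc (f s) * w s * (normc (g (t - s)%R) * w (t - s)%R))%:E)%E.

Lemma measurable_wconv f g : wintegrable f -> wintegrable g ->
  measurable_fun setT (wconv f g).
Proof.
move=> [mf fi] [mg gi].
apply: (measurable_convolution G_hausdorff G_locally_compact mu_haar
  (f := wdens f) (g := wdens g)) => //.
- by move=> s; exact: wdens_ge0.
- by move=> s; exact: wdens_ge0.
- exact: measurable_wdens.
Qed.

Lemma integral_wconv f g : wintegrable f -> wintegrable g ->
  (\int[mu]_t wconv f g t = (rnorm (cls f))%:E * (rnorm (cls g))%:E)%E.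
Proof.
move=> fi gi; rewrite !cls_norm//.
apply: (tonelli_convolution G_hausdorff G_locally_compact mu_haar
  (f := wdens f) (g := wdens g)); last 2 first.
- by have [] := fi.
- by have [] := gi.
- by move=> s; exact: wdens_ge0.
- by move=> s; exact: wdens_ge0.
Qed.

Lemma wconv_ge0 f g t : (0 <= wconv f g t)%E.
Proof. by apply: integral_ge0 => s _; rewrite lee_fin mulr_ge0// wdens_ge0. Qed.

Lemma wconv_ae f g : wintegrable f -> wintegrable g ->
  {ae mu, forall t : borel G, (wconv f g t < +oo)%E}.
Proof.
move=> fi gi.
have : mu.-integrable setT (wconv f g).
  apply/integrableP; split; first exact: measurable_wconv.
  under eq_integral do rewrite gee0_abs ?wconv_ge0//.
  by rewrite integral_wconv// -EFinM ltry.
move/(integrable_ae measurableT); apply: filterS => t /(_ Logic.I).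
by rewrite ge0_fin_numE ?wconv_ge0.
Qed.

Lemma cmeasurable_integrand f g t : cmeasurable (f : borel G -> R[i]) ->
  cmeasurable (g : borel G -> R[i]) ->
  cmeasurable ((fun s => f s * g (t - s)) : borel G -> R[i]).
Proof.
move=> mf mg; apply: cmeasurableM => //.
exact: (cmeasurable_comp mg (continuous_borel (@subr_continuous G t))).
Qed.

Lemma integrand_le f g t s :
  w t * normc (f s * g (t - s)) <= normc (f s) * w s * (normc (g (t - s)) * w (t - s)).
Proof.
rewrite ComplexField.Normc.normcM mulrACA mulrC ler_wpM2l ?mulr_ge0 ?normc_ge0//.
by rewrite -{1}(subrK s t) addrC weight_submul.
Qed.

Lemma integral_integrand_le f g t : wintegrable f -> wintegrable g ->
  ((w t)%:E * \int[mu]_s (normc (f s * g (t - s)%R))%:E <= wconv f g t)%E.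
Proof.
move=> [mf _] [mg _]; have mfg := cmeasurable_integrand t mf mg.
have mn : measurable_fun setT (fun s : borel G => (normc (f s * g (t - s)))%:E).
  by apply/measurable_EFinP; exact: measurable_normc.
rewrite -ge0_integralZl//; last 2 first.
- by move=> s _; rewrite lee_fin normc_ge0.
- by rewrite lee_fin ltW// weight_gt0.
apply: ge0_le_integral => //.
- by move=> s _; rewrite -EFinM lee_fin mulr_ge0 ?normc_ge0// ltW// weight_gt0.
- exact: measurable_funeM.
- apply/measurable_EFinP; apply: measurable_funM; first exact: measurable_wdens.
  exact: (measurableT_comp (measurable_wdens w mg) (continuous_borel (@subr_continuous G t))).
- by move=> s _; rewrite -EFinM lee_fin integrand_le.
Qed.

Lemma cintegrable_integrand f g t : wintegrable f -> wintegrable g ->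
  (wconv f g t < +oo)%E -> cintegrable mu (fun s => f s * g (t - s)).
Proof.
move=> fi gi too; have [mf _] := fi; have [mg _] := gi.
have mfg := cmeasurable_integrand t mf mg.
apply/cintegrableP; split => //; apply/integrableP; split.
  by apply/measurable_EFinP; exact: measurable_normc.
under eq_integral do rewrite gee0_abs ?lee_fin ?normc_ge0//.
have := le_lt_trans (integral_integrand_le t fi gi) too.
rewrite !ltey; apply: contra => /eqP ->.
by rewrite gt0_muley// lte_fin weight_gt0.
Qed.

Lemma fine_integral_le (h : borel G -> R) (k : borel G -> R) :
  measurable_fun setT h -> measurable_fun setT k -> (forall s, `|h s| <= k s) ->
  (`|\int[mu]_(s in setT) h s|%:E <= \int[mu]_s (k s)%:E)%E.
Proof.
move=> mh mk hk; rewrite /Rintegral.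
have le1 : (`|\int[mu]_s (h s)%:E| <= \int[mu]_s (k s)%:E)%E.
  apply: le_trans (le_abse_integral mu measurableT _) _; first exact/measurable_EFinP.
  apply: ge0_le_integral => //.
  - by apply/measurable_EFinP; exact: measurableT_comp.
  - exact/measurable_EFinP.
  - by move=> s _; rewrite lee_fin.
apply: le_trans le1; case: (\int[mu]_s (h s)%:E)%E => //=.
- by rewrite normr0 leey.
- by rewrite normr0 leey.
Qed.

Lemma conv_le f g t : wintegrable f -> wintegrable g ->
  ((normc (conv f g t) * w t)%:E <= 2%:E * wconv f g t)%E.
Proof.
move=> fi gi; have [mf _] := fi; have [mg _] := gi.
have mfg := cmeasurable_integrand t mf mg.
have w0 := weight_gt0 w t.
apply: (@le_trans _ _ (2%:E * ((w t)%:E * \int[mu]_s (normc (f s * g (t - s)%R))%:E))%E); last first.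
  by rewrite lee_wpmul2l ?integral_integrand_le// lee_fin.
rewrite mulrC muleCA EFinM lee_wpmul2l ?lee_fin ?(ltW w0)//.
apply: (@le_trans _ _ (`|complex.Re (conv f g t)|%:E + `|complex.Im (conv f g t)|%:E)%E).
  by rewrite -EFinD lee_fin normc_le_ReIm.
rewrite (_ : 2%:E = 1 + 1)%E; last by rewrite -EFinD.
rewrite ge0_muleDl// mul1e; apply: leeD.
- apply: fine_integral_le; [by have [] := mfg|exact: measurable_normc|].
  by move=> s; exact: Re_le_normc.
- apply: fine_integral_le; [by have [] := mfg|exact: measurable_normc|].
  by move=> s; exact: Im_le_normc.
Qed.

(** Positive and negative parts of the integrand are treated separately, as
    [measurable_shear_integral] is about nonnegative kernels. *)
Lemma cmeasurable_conv f g : wintegrable f -> wintegrable g ->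
  cmeasurable (conv f g : borel G -> R[i]).
Proof.
move=> fi gi; have [mf fi'] := fi; have [mg _] := gi.
have [K [cK ndK fK]] := integrable_sigma_compact_support G_hausdorff G_locally_compact
  mu_haar (wdens_ge0 w f) fi'.
have f0 s : ~ (\bigcup_n K n) s -> f s = 0.
  move=> /fK /eqP; rewrite mulf_eq0 (gt_eqF (weight_gt0 _ _)) orbF => /eqP.
  exact: ComplexField.Normc.eq0_normc.
have mF : cmeasurable (fun z : borel G * borel G => f z.1 * g z.2).
  by apply: cmeasurableM; [exact: (cmeasurable_comp mf measurable_fst)|exact: (cmeasurable_comp mg measurable_snd)].
have part (F : borel G * borel G -> R) : measurable_fun setT F ->
    (forall s u, ~ (\bigcup_n K n) s -> F (s, u) = 0) ->
    measurable_fun setT (fun t : borel G => \int[mu]_(s in setT) F (s, t - s)).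
  move=> mFF F0; rewrite /Rintegral.
  apply: (measurableT_comp (f := fine)) => //.
  under eq_fun do rewrite integralE.
  have Fp : measurable_fun setT (fun t : borel G => \int[mu]_s (EFin \o F)^\+ (s, (t - s)%R))%E.
    apply: (measurable_shear_integral G_hausdorff mu_haar cK ndK) => //.
    - by apply: measurable_funepos; exact/measurable_EFinP.
    - by move=> s u /F0 Fsu; rewrite unlock /= Fsu maxxx.
  have Fn : measurable_fun setT (fun t : borel G => \int[mu]_s (EFin \o F)^\- (s, (t - s)%R))%E.
    apply: (measurable_shear_integral G_hausdorff mu_haar cK ndK) => //.
    - by apply: measurable_funeneg; exact/measurable_EFinP.
    - by move=> s u /F0 Fsu; rewrite unlock /= Fsu ?oppe0 ?oppr0 maxxx.
  have := emeasurable_funB Fp Fn; congr measurable_fun; apply/funext => t /=.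
  by congr (_ - _)%E; apply: eq_integral => s _; rewrite !unlock.
have [mr mj] := mF; split.
- by apply: (part _ mr) => s u Ks /=; rewrite f0// mul0r.
- by apply: (part _ mj) => s u Ks /=; rewrite f0// mul0r.
Qed.

(** The constant [2] comes from bounding real and imaginary parts of the integral
    separately. *)
Lemma wintegrable_conv f g : wintegrable f -> wintegrable g ->
  wintegrable (conv f g) /\ rnorm (cls (conv f g)) <= 2 * rnorm (cls f) * rnorm (cls g).
Proof.
move=> fi gi; have mc := cmeasurable_conv fi gi.
have h : (\int[mu]_t (normc (conv f g t) * w t)%:E <= 2%:E * \int[mu]_t wconv f g t)%E.
  rewrite -ge0_integralZl//; last 2 first.
  - exact: measurable_wconv.
  - by move=> t _; exact: wconv_ge0.
  apply: ge0_le_integral => //.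
  - by move=> t _; rewrite lee_fin; exact: (wdens_ge0 w (conv f g)).
  - by apply/measurable_EFinP; exact: measurable_wdens.
  - by apply: measurable_funeM; exact: measurable_wconv.
  - by move=> t _; exact: conv_le.
have ci : wintegrable (conv f g).
  apply: wintegrable_finite => //; apply: le_lt_trans h _.
  by rewrite integral_wconv// -!EFinM ltry.
by split => //; rewrite -lee_fin cls_norm// -mulrA !EFinM -integral_wconv.
Qed.

Lemma conv_linearl a f1 f2 g : wintegrable f1 -> wintegrable f2 -> wintegrable g ->
  cls (conv (fun t => a * f1 t + f2 t) g) = a *: cls (conv f1 g) + cls (conv f2 g).
Proof.
move=> f1i f2i gi.
have [c1 _] := wintegrable_conv f1i gi; have [c2 _] := wintegrable_conv f2i gi.
have [c3 _] := wintegrable_conv (wintegrable_linear a f1i f2i) gi.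
rewrite -cls_linear//; apply: cls_ae => //; first exact: wintegrable_linear.
apply: filterS2 (wconv_ae f1i gi) (wconv_ae f2i gi) => t t1 t2.
rewrite /convolution -cintegral_linear; last 2 first.
- exact: cintegrable_integrand.
- exact: cintegrable_integrand.
by congr cintegral; apply/funext => s; rewrite mulrDl mulrA.
Qed.

Lemma conv_linearr a f g1 g2 : wintegrable f -> wintegrable g1 -> wintegrable g2 ->
  cls (conv f (fun t => a * g1 t + g2 t)) = a *: cls (conv f g1) + cls (conv f g2).
Proof.
move=> fi g1i g2i.
have [c1 _] := wintegrable_conv fi g1i; have [c2 _] := wintegrable_conv fi g2i.
have [c3 _] := wintegrable_conv fi (wintegrable_linear a g1i g2i).
rewrite -cls_linear//; apply: cls_ae => //; first exact: wintegrable_linear.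
apply: filterS2 (wconv_ae fi g1i) (wconv_ae fi g2i) => t t1 t2.
rewrite /convolution -cintegral_linear; last 2 first.
- exact: cintegrable_integrand.
- exact: cintegrable_integrand.
by congr cintegral; apply/funext => s; rewrite mulrDr mulrCA.
Qed.

Lemma conv_translater t f g : conv f (translate t g) = translate t (conv f g).
Proof.
apply/funext => r.
change (cintegral mu (fun s => f s * g (r - s - t)) = cintegral mu (fun s => f s * g (r - t - s))).
by congr cintegral; apply/funext => s; rewrite addrAC.
Qed.

Lemma conv_translatel t f g : wintegrable f -> wintegrable g ->
  conv (translate t f) g = translate t (conv f g).
Proof.
move=> [mf _] [mg _]; apply/funext => r; rewrite /translate /convolution /cintegral.
have [mr mj] := cmeasurable_integrand (r - t) mf mg.
have h (F : borel G -> R) : measurable_fun setT F ->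
    \int[mu]_(s in setT) F (s - t) = \int[mu]_(s in setT) F s.
  by move=> mF; rewrite /Rintegral (integral_translate mu_haar (h := EFin \o F))//; exact/measurable_EFinP.
rewrite -(h _ mr) -(h _ mj).
have E s : f (s - t) * g (r - s) = f (s - t) * g (r - t - (s - t)).
  by rewrite opprB addrA subrK.
by congr (_ +i* _)%C; apply: eq_Rintegral => s _; rewrite E.
Qed.

End beurling_convolution.

(** * Density of the indicators of compact sets *)

Section density.
Variables (R : realType) (G : topologicalZmodType).
Hypothesis G_hausdorff : hausdorff_space G.
Variable mu : {measure set (borel G) -> \bar R}.
Hypothesis mu_haar : haar_measure mu.
Variable w : weight R G.
Implicit Types (f g : G -> R[i]).

Local Notation A := (beurling mu w).
Local Notation cls := (beurling_class mu w).
Local Notation wintegrable := (wintegrable mu w).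

Definition cindic (E : set G) : G -> R[i] := fun s => (\1_(E : set (borel G)) s)%:C%C.

Lemma cmeasurable_cindic (E : set G) : measurable (E : set (borel G)) ->
  cmeasurable (cindic E : borel G -> R[i]).
Proof. by move=> mE; apply: cmeasurable_real; exact: measurable_indic. Qed.

Lemma normc_cindic (E : set G) s : normc (cindic E s) = \1_(E : set (borel G)) s.
Proof. by rewrite normc_real. Qed.

Lemma integral_bounded_on (E : set (borel G)) (v : borel G -> R) (b : R) :
  measurable E -> 0 <= b -> measurable_fun setT v -> (forall t, 0 <= v t) ->
  (forall t, E t -> v t <= b) ->
  (\int[mu]_t (\1_E t * v t)%:E <= b%:E * mu E)%E.
Proof.
move=> mE b0 mv v0 vb.
rewrite -[X in mu X]setIT -integral_indic// -ge0_integralZl//; last first.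
  by apply/measurable_EFinP; exact: measurable_indic.
apply: ge0_le_integral => //.
- by move=> t _; rewrite lee_fin mulr_ge0.
- by apply/measurable_EFinP; apply: measurable_funM => //; exact: measurable_indic.
- by apply: measurable_funeM; apply/measurable_EFinP; exact: measurable_indic.
move=> t _; rewrite -EFinM lee_fin mulrC; rewrite indicE.
by case: (boolP (_ \in _)) => [/set_mem/vb vt|_]; rewrite ?mulr1 ?mulr0.
Qed.

Lemma wintegrable_cindic (E : set G) (b : R) : measurable (E : set (borel G)) ->
  (mu (E : set (borel G)) < +oo)%E -> 0 <= b -> (forall t, E t -> w t <= b) ->
  wintegrable (cindic E) /\
  ((rnorm (cls (cindic E)))%:E <= b%:E * mu (E : set (borel G)))%E.
Proof.
move=> mE Eoo b0 wb.
have h : (\int[mu]_t (normc (cindic E t) * w t)%:E <= b%:E * mu (E : set (borel G)))%E.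
  under eq_integral do rewrite normc_cindic.
  apply: integral_bounded_on => //; first exact: weight_measurable.
  by move=> t; rewrite ltW// weight_gt0.
have Ei : wintegrable (cindic E).
  apply: wintegrable_finite; first exact: cmeasurable_cindic.
  by apply: le_lt_trans h _; rewrite lte_mul_pinfty// lee_fin.
by split => //; rewrite cls_norm.
Qed.

Lemma compact_weight_bounded (K : set G) : compact K ->
  exists2 b : R, 0 <= b & forall t, K t -> w t <= b.
Proof.
move=> cK.
have cwK : compact (w @` K).
  apply: continuous_compact => //; apply: continuous_subspaceT.
  exact: weight_continuous.
have [M [_ MK]] := compact_bounded cwK.
exists (`|M| + 1); first by rewrite addr_ge0.
move=> t Kt; apply: le_trans (ler_norm _) _; apply: (MK (`|M| + 1)) => //.
by rewrite ltr_pwDr// ler_norm.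
Qed.

Lemma wintegrable_cindic_compact (K : set G) : compact K -> wintegrable (cindic K).
Proof.
move=> cK; have [b b0 wb] := compact_weight_bounded cK.
have mK := compact_borel G_hausdorff cK.
by have [] := wintegrable_cindic mK (haar_compact mu_haar cK) b0 wb.
Qed.

Lemma cls_cindic0 : cls (cindic set0) = 0.
Proof.
rewrite -cls0; congr beurling_class; apply/funext => t.
by rewrite /cindic indicE in_set0.
Qed.

Variable P : A -> Prop.
Hypothesis P_linear : forall a x y, P x -> P y -> P (a *: x + y).
Hypothesis P_closed : forall x, (forall e, 0 < e -> exists2 y, P y & rnorm (x - y) <= e) -> P x.
Hypothesis P_cindic : forall K, compact K -> P (cls (cindic K)).

Let P0 : P 0.
Proof. by rewrite -cls_cindic0; apply: P_cindic; exact: compact0. Qed.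

Let P_scale a x : P x -> P (a *: x).
Proof. by move=> Px; rewrite -[_ *: _]addr0; exact: P_linear. Qed.

Let P_borel (E : set G) (b : R) : measurable (E : set (borel G)) ->
  (mu (E : set (borel G)) < +oo)%E -> 0 <= b -> (forall t, E t -> w t <= b) ->
  P (cls (cindic E)).
Proof.
move=> mE Eoo b0 wb; apply: P_closed => e e0.
have b1 : 0 < b + 1 by rewrite ltr_wpDl.
have e'0 : 0 < e / (b + 1) by rewrite divr_gt0.
have [K [cK KE Ke]] := haar_inner G_hausdorff mu_haar mE Eoo e'0.
have mK := compact_borel G_hausdorff cK.
exists (cls (cindic K)); first exact: P_cindic.
have mEK : measurable (E `\` K : set (borel G)) by exact: measurableD.
have EKoo : (mu (E `\` K : set (borel G)) < +oo)%E by rewrite (lt_trans Ke) ?ltry.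
have wbEK t : (E `\` K) t -> w t <= b by move=> [/wb].
have wbK t : K t -> w t <= b by move=> /KE/wb.
have [EKi EKn] := wintegrable_cindic mEK EKoo b0 wbEK.
have [Ei _] := wintegrable_cindic mE Eoo b0 wb.
have [Ki _] := wintegrable_cindic mK (haar_compact mu_haar cK) b0 wbK.
have -> : cls (cindic E) - cls (cindic K) = cls (cindic (E `\` K)).
  rewrite addrC -scaleN1r -cls_linear//; congr beurling_class; apply/funext => t.
  rewrite /cindic !indicE in_setD.
  case: (boolP (t \in K)) => [/set_mem/KE/mem_set ->|_]; first by rewrite mulN1r addNr.
  by rewrite mulr0 add0r andbT.
rewrite -lee_fin; apply: le_trans EKn _.
apply: (@le_trans _ _ (b%:E * (e / (b + 1))%:E)%E).
  by rewrite lee_wpmul2l ?lee_fin// ltW.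
by rewrite -EFinM lee_fin mulrCA ger_pMr// ler_pdivrMr// mul1r lerDl.
Qed.

Let P_sum (I : Type) (s : seq I) (F : I -> G -> R[i]) :
  (forall i, wintegrable (F i) /\ P (cls (F i))) ->
  wintegrable (fun t => \sum_(i <- s) F i t) /\ P (cls (fun t => \sum_(i <- s) F i t)).
Proof.
move=> HF; elim: s => [|i s [IH1 IH2]].
  under eq_fun do rewrite big_nil; rewrite cls0; split => //.
  exact: wintegrable0.
have [Fi PFi] := HF i.
have -> : (fun t => \sum_(j <- i :: s) F j t) = (fun t => 1 * F i t + \sum_(j <- s) F j t).
  by apply/funext => t; rewrite big_cons mul1r.
split; first exact: wintegrable_linear.
by rewrite cls_linear//; exact: P_linear.
Qed.

Import HBNNSimple.

(** As the weight is bounded below on [B], the nonzero level sets of [h] within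
    [B] have finite measure by integrability of [h w]; as it is also bounded above,
    [P_borel] applies to them. *)
Let P_simple (h : {nnsfun (borel G) >-> R}) (B : set (borel G)) (b : R) :
  mu.-integrable setT (fun t => (h t * w t)%:E) -> measurable B -> 0 < b ->
  (forall t, B t -> b^-1 <= w t /\ w t <= b) ->
  wintegrable (fun t => (h t * \1_B t)%:C%C) /\ P (cls (fun t => (h t * \1_B t)%:C%C)).
Proof.
move=> hi mB b0 wB.
have -> : (fun t : G => (h t * \1_B t)%:C%C) = (fun t : G => \sum_(y <- finmap.enum_fset (fset_set (range h)))
    y%:C%C * cindic ((h @^-1` [set y]) `&` B) t).
  apply/funext => t; rewrite {1}fimfunE fsbig_finite//= mulr_suml.
  rewrite (big_morph (fun x : R => x%:C%C) (@real_complexD R) (erefl _)).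
  by apply: eq_bigr => y _; rewrite -mulrA real_complexM /cindic indicI.
apply: P_sum => y.
have mE : measurable ((h @^-1` [set y]) `&` B : set (borel G)).
  by apply: measurableI => //; exact: measurable_sfunP.
have scaleE (F : G -> R[i]) : (fun t => y%:C%C * F t) = (fun t => y%:C%C * F t + 0).
  by apply/funext => t; rewrite addr0.
have [->|y0] := eqVneq y 0.
  rewrite (_ : (fun t => _) = (fun=> 0)); last by apply/funext => t; rewrite mul0r.
  by rewrite cls0; split => //; exact: wintegrable0.
have Eoo : (mu ((h @^-1` [set y]) `&` B : set (borel G)) < +oo)%E.
  have [ylt0|yge0] := ltP y 0.
    by rewrite preimage_nnfun0// set0I measure0 ltry.
  have y_gt0 : 0 < y by rewrite lt_neqAle eq_sym y0.
  have hw0 (t : borel G) : 0 <= h t * w t by rewrite mulr_ge0// ltW// weight_gt0.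
  apply: le_lt_trans (integrable_superlevel_finite hw0 hi (divr_gt0 y_gt0 b0)).
  rewrite le_measure ?inE//.
    rewrite -[X in measurable X]setTI; apply: (measurable_fun_ler (measurable_cst _)) => //.
    by apply/measurable_EFinP; exact: measurable_int hi.
  move=> t [/= hty /wB[bw _]]; rewrite hty.
  by rewrite ler_wpM2l// ltW.
have [Ei _] := wintegrable_cindic mE Eoo (ltW b0) (fun t Et => (wB t Et.2).2).
have PE := P_borel mE Eoo (ltW b0) (fun t Et => (wB t Et.2).2).
rewrite scaleE; split; first exact: (wintegrable_linear _ Ei (wintegrable0 _ _)).
by rewrite (cls_linear _ Ei (wintegrable0 _ _)) cls0 addr0; exact: P_scale.
Qed.

(** Simple functions cut to the sets where [1/n <= w <= n] converge to [r],
    dominated by it. *)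
Let P_nonneg (r : borel G -> R) : (forall t, 0 <= r t) ->
  wintegrable (fun t => (r t)%:C%C) -> P (cls (fun t => (r t)%:C%C)).
Proof.
move=> r0 ri; have [[mr _] riw] := ri.
have mr' : measurable_fun setT (EFin \o r) by exact/measurable_EFinP.
have rE t : normc (r t)%:C%C = r t by rewrite normc_real.
pose h n := nnsfun_approx measurableT mr' n.
have hr n t : h n t <= r t.
  by rewrite -lee_fin /h nnsfun_approxE; apply: le_approx => // s _; rewrite lee_fin.
pose B n : set (borel G) := [set t | n.+1%:R^-1 <= w t] `&` [set t | w t <= n.+1%:R].
have mB n : measurable (B n).
  apply: measurableI.
    rewrite -[X in measurable X]setTI.
    exact: (measurable_fun_ler (measurable_cst _) (weight_measurable w)).
  rewrite -[X in measurable X]setTI.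
  exact: (measurable_fun_ler (weight_measurable w) (measurable_cst _)).
have n0 n : 0 < n.+1%:R :> R by rewrite ltr0n.
have wi : mu.-integrable setT (fun t => (r t * w t)%:E).
  by move: riw; under eq_fun do rewrite rE.
have mw := weight_measurable w.
have mh n : measurable_fun setT (h n : borel G -> R) by exact: measurable_funPT.
have mhBw n : measurable_fun setT (fun t : borel G => h n t * \1_(B n) t * w t).
  by apply: measurable_funM mw; apply: measurable_funM (mh n) _; exact: measurable_indic.
have hi n : mu.-integrable setT (fun t => (h n t * w t)%:E).
  apply: le_integrable wi => //.
    by apply/measurable_EFinP; exact: measurable_funM (mh n) mw.
  move=> t _; rewrite /= lee_fin !ger0_norm ?mulr_ge0// ?(ltW (weight_gt0 _ _))//.
  by rewrite ler_wpM2r ?hr// ltW// weight_gt0.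
have hP n := P_simple (hi n) (mB n) (n0 n) (fun t Bt => Bt).
pose q n t : \bar R := (h n t * \1_(B n) t * w t)%:E.
have [] := @dominated_convergence _ (borel G) R mu setT measurableT q
  (fun t => (r t * w t)%:E) (fun t => (r t * w t)%:E).
- by move=> n; exact/measurable_EFinP.
- by apply/measurable_EFinP; exact: measurable_funM mr mw.
- apply: aeW => t _; have w0 := weight_gt0 w t.
  have [N NB] : exists N, forall n, (N <= n)%N -> B n t.
    have [N1 _ h1] := near_infty_natSinv_lt (PosNum w0).
    have [N2 N2w] : exists N2 : nat, w t <= N2%:R.
      by exists (Num.bound (w t)); apply/ltW/archi_boundP/ltW.
    exists (maxn N1 N2) => n; rewrite geq_max => /andP[N1n N2n]; split => /=.
      exact: (ltW (h1 n N1n)).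
    by apply: le_trans N2w _; rewrite ler_nat ltnW.
  have : (EFin \o (fun n => h n t) @ \oo --> (r t)%:E)%classic.
    by apply: (cvg_nnsfun_approx measurableT mr') => // s _; rewrite lee_fin.
  move=> /fine_cvgP[_ /= hc].
  apply: cvg_EFin; first by near=> n.
  rewrite (_ : fine \o _ = (fun n => h n t * \1_(B n) t * w t))//.
  apply: cvgMl; apply: cvg_trans hc; apply: near_eq_cvg; exists N => // n /= Nn.
  by rewrite indicE mem_set ?mulr1//; exact: NB.
- exact: wi.
- apply: aeW => t n _; rewrite /q /= lee_fin ger0_norm; last first.
    by rewrite !mulr_ge0// ltW// weight_gt0.
  rewrite ler_wpM2r ?(ltW (weight_gt0 _ _))//; apply: le_trans (hr n t).
  by rewrite ler_piMr// indicE lern1 leq_b1.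
move=> _ cv0 _; apply: P_closed => e e0.
have : \forall n \near \oo, (\int[mu]_(x in setT) `|q n x - (r x * w x)%:E| < e%:E)%E.
  move/fine_cvgP : cv0 => [fin /cvgrPdist_lt /(_ e e0)]; apply: filterS2 fin => n fn.
  rewrite sub0r normrN => h1; move: fn h1 => /= fn h1.
  by rewrite -[ltLHS]fineK// lte_fin; apply: le_lt_trans h1; exact: ler_norm.
move=> [n _ /(_ n (leqnn n)) ne]; have [hin Phn] := hP n.
exists (cls (fun t => (h n t * \1_(B n) t)%:C%C)) => //.
rewrite addrC -scaleN1r -cls_linear// -lee_fin cls_norm; last exact: wintegrable_linear.
apply: le_trans (ltW ne); apply: ge0_le_integral => //.
- by move=> t _; rewrite lee_fin mulr_ge0 ?normc_ge0// ltW// weight_gt0.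
- apply/measurable_EFinP; apply: measurable_wdens.
  by have [] := wintegrable_linear (-1) hin ri.
- apply: measurableT_comp => //; apply: emeasurable_funB; apply/measurable_EFinP => //.
  exact: measurable_funM mr mw.
- move=> t _; rewrite /q -EFinB -mulrBl [X in (_ <= X)%E]/= lee_fin normrM [X in _ <= _ * X]gtr0_norm ?weight_gt0//.
  rewrite ler_wpM2r ?(ltW (weight_gt0 _ _))//.
  by rewrite mulN1r addrC -real_complexB normc_realE distrC.
Unshelve. all: by end_near. Qed.

(** An induction principle: linear combinations and limits lead from indicators
    of compact sets to every element. *)
Lemma density_ind x : P x.
Proof.
elim/cls_ind: x => f fi; have [[mr mj] fi'] := fi.
have part (F : G -> R) : measurable_fun setT (F : borel G -> R) -> (forall t, `|F t| <= normc (f t)) ->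
    wintegrable (fun t => (F t)%:C%C) /\ P (cls (fun t => (F t)%:C%C)).
  move=> mF Ff.
  have dom (F' : G -> R) : measurable_fun setT (F' : borel G -> R) -> (forall t, `|F' t| <= normc (f t)) ->
      wintegrable (fun t => (F' t)%:C%C).
    move=> mF' F'f; have [|//|//||h _] := @wintegrable_dominated _ _ _ mu_haar w 0 f
      (fun t => (F' t)%:C%C) 1; last exact: h.
    - exact: cmeasurable_real.
    - move=> s; rewrite subr0 mul1r ler_wpM2r ?(ltW (weight_gt0 _ _))//.
      by rewrite normc_realE.
  have Fp : wintegrable (fun t => (Num.max (F t) 0)%:C%C).
    apply: dom; first exact: measurable_maxr.
    move=> t; apply: le_trans (Ff t); rewrite ger0_norm ?le_max ?lexx ?orbT//.
    by rewrite ge_max ler_norm normr_ge0.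
  have Fn : wintegrable (fun t => (Num.max (- F t) 0)%:C%C).
    apply: dom; first by apply: measurable_maxr => //; exact: measurableT_comp.
    move=> t; apply: le_trans (Ff t); rewrite ger0_norm ?le_max ?lexx ?orbT//.
    by rewrite ge_max normr_ge0 -normrN ler_norm.
  split; first exact: dom.
  have -> : (fun t => (F t)%:C%C) = (fun t => (-1) * (Num.max (- F t) 0)%:C%C + (Num.max (F t) 0)%:C%C).
    apply/funext => t; rewrite mulN1r addrC -real_complexB; congr (_%:C)%C.
    by rewrite !maxEle; case: (leP (F t) 0) => Ft; case: (leP (- F t) 0) => Ft'; lra.
  rewrite cls_linear//; apply: P_linear; apply: P_nonneg => // t;
    by rewrite le_max lexx orbT.
have [reI reP] := part _ mr (fun t => Re_le_normc (f t)).
have [imI imP] := part _ mj (fun t => Im_le_normc (f t)).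
have -> : f = (fun t => 'i%C * (complex.Im (f t))%:C%C + (complex.Re (f t))%:C%C).
  by apply/funext => t; rewrite [LHS]complexE addrC.
by rewrite cls_linear//; exact: P_linear.
Qed.

End density.

(** * Operators on the Beurling algebra *)

Section beurling_algebra.
Variables (R : realType) (G : topologicalZmodType).
Hypothesis G_hausdorff : hausdorff_space G.
Hypothesis G_locally_compact : locally_compact [set: G].
Variable mu : {measure set (borel G) -> \bar R}.
Hypothesis mu_haar : haar_measure mu.
Variable w : weight R G.
Implicit Types (f g : G -> R[i]).

Local Notation A := (beurling mu w).
Local Notation cls := (beurling_class mu w).
Local Notation wintegrable := (wintegrable mu w).
Local Notation conv := (convolution mu).
Local Notation mul := (@beurling_mul R G mu w).

Lemma mul_cls f g : wintegrable f -> wintegrable g -> mul (cls f) (cls g) = cls (conv f g).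
Proof.
move=> fi gi; rewrite /beurling_mul.
have fi' := wintegrable_repr (cls f).
transitivity (cls (conv (repr (cls f) : L1w mu w) g)).
  apply: (@lift_cls _ _ _ _ (conv (repr (cls f) : L1w mu w)) (2 * rnorm (cls f))) => //.
    by move=> a g1 g2 g1i g2i; exact: conv_linearr.
  move=> h hi; have [_] := wintegrable_conv G_hausdorff G_locally_compact mu_haar fi' hi.
  by rewrite cls_repr.
apply: (@lift_cls _ _ _ _ (fun f => conv f g) (2 * rnorm (cls g))) => //.
  by move=> a g1 g2 g1i g2i; exact: conv_linearl.
move=> h hi; have [_] := wintegrable_conv G_hausdorff G_locally_compact mu_haar hi gi.
by rewrite mulrAC.
Qed.

Lemma beurling_mul_linearl (y : A) : linear (mul^~ y).
Proof.
elim/cls_ind: y => g gi a; elim/cls_ind => f fi; elim/cls_ind => h hi.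
rewrite -cls_linear// !mul_cls//; last exact: wintegrable_linear.
exact: conv_linearl.
Qed.

Lemma beurling_mul_linearr (x : A) : linear (mul x).
Proof.
elim/cls_ind: x => g gi a; elim/cls_ind => f fi; elim/cls_ind => h hi.
rewrite -cls_linear// !mul_cls//; last exact: wintegrable_linear.
exact: conv_linearr.
Qed.

Lemma beurling_mul_le (x y : A) : rnorm (mul x y) <= 2 * rnorm x * rnorm y.
Proof.
elim/cls_ind: x => f fi; elim/cls_ind: y => g gi; rewrite mul_cls//.
by have [_] := wintegrable_conv G_hausdorff G_locally_compact mu_haar fi gi.
Qed.

Definition beurling_translate (t : G) (x : A) : A := cls (translate t (repr x : L1w mu w)).
Local Notation L := beurling_translate.

Let translate_lin t a f g : wintegrable f -> wintegrable g ->
  cls (translate t (fun s => a * f s + g s)) = a *: cls (translate t f) + cls (translate t g).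
Proof.
by move=> fi gi; rewrite translate_linear cls_linear//; apply: (wintegrable_translate mu_haar _ _).1.
Qed.

Let translate_le t f : wintegrable f -> rnorm (cls (translate t f)) <= w t * rnorm (cls f).
Proof. by move=> fi; have [] := wintegrable_translate mu_haar t fi. Qed.

Lemma translate_cls t f : wintegrable f -> L t (cls f) = cls (translate t f).
Proof. by apply: (lift_cls (translate_lin t) (@translate_le t)). Qed.

Lemma beurling_translate_linear t : linear (L t).
Proof. exact: (lift_linear (translate_lin t) (@translate_le t)). Qed.

Lemma beurling_translate_le t x : rnorm (L t x) <= w t * rnorm x.
Proof. exact: (lift_le (@translate_le t)). Qed.

Lemma beurling_translate0 x : L 0 x = x.
Proof.
elim/cls_ind: x => f fi; rewrite translate_cls//; congr beurling_class.
by apply/funext => s; rewrite /translate subr0.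
Qed.

Lemma beurling_translateD s t x : L (s + t) x = L s (L t x).
Proof.
elim/cls_ind: x => f fi; rewrite !translate_cls//; last first.
  by have [] := wintegrable_translate mu_haar t fi.
by congr beurling_class; apply/funext => r; rewrite /translate opprD addrA.
Qed.

Lemma beurling_translate_mull t x y : L t (mul x y) = mul (L t x) y.
Proof.
elim/cls_ind: x => f fi; elim/cls_ind: y => g gi.
have [ci _] := wintegrable_conv G_hausdorff G_locally_compact mu_haar fi gi.
have [ti _] := wintegrable_translate mu_haar t fi.
by rewrite mul_cls// !translate_cls// mul_cls// (conv_translatel mu_haar _ fi gi).
Qed.

Lemma beurling_translate_mulr t x y : L t (mul x y) = mul x (L t y).
Proof.
elim/cls_ind: x => f fi; elim/cls_ind: y => g gi.
have [ci _] := wintegrable_conv G_hausdorff G_locally_compact mu_haar fi gi.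
have [ti _] := wintegrable_translate mu_haar t gi.
by rewrite mul_cls// !translate_cls// mul_cls// conv_translater.
Qed.

Definition beurling_cut (K : set G) (x : A) : A := cls (truncate K (repr x : L1w mu w)).

Let cut_lin K a f g : measurable (K : set (borel G)) -> wintegrable f -> wintegrable g ->
  cls (truncate K (fun s => a * f s + g s)) = a *: cls (truncate K f) + cls (truncate K g).
Proof.
by move=> mK fi gi; rewrite truncate_linear cls_linear//; apply: (wintegrable_truncate mu_haar _ _).1.
Qed.

Let cut_le K f : measurable (K : set (borel G)) -> wintegrable f ->
  rnorm (cls (truncate K f)) <= 1 * rnorm (cls f).
Proof. by move=> mK fi; have [] := wintegrable_truncate mu_haar mK fi. Qed.

Lemma cut_cls K f : measurable (K : set (borel G)) -> wintegrable f ->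
  beurling_cut K (cls f) = cls (truncate K f).
Proof.
move=> mK; apply: (@lift_cls _ _ _ _ _ 1) => [a g h gi hi|g gi]; first exact: cut_lin.
exact: cut_le.
Qed.

Lemma beurling_cut_linear K : measurable (K : set (borel G)) -> linear (beurling_cut K).
Proof.
move=> mK; apply: (@lift_linear _ _ _ _ _ 1) => [a g h gi hi|g gi]; first exact: cut_lin.
exact: cut_le.
Qed.

Lemma beurling_cut_le K x : measurable (K : set (borel G)) ->
  rnorm (beurling_cut K x) <= rnorm x.
Proof.
move=> mK; have := @lift_le _ _ mu w (truncate K) 1; rewrite -[leRHS]mul1r; apply => f fi.
exact: cut_le.
Qed.

Lemma conv_cindic (E F : set G) t : measurable (E : set (borel G)) ->
  measurable (F : set (borel G)) ->
  conv (cindic R E) (cindic R F) t = (fine (mu (slice E F t)))%:C%C.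
Proof.
move=> mE mF; rewrite /convolution /cintegral.
have prod s : cindic R E s * cindic R F (t - s) = (\1_(slice E F t) s)%:C%C.
  by rewrite /cindic -real_complexM -[slice E F t]/(E `&` (fun s => t - s) @^-1` F) indicI.
have -> : \int[mu]_(s in setT) complex.Re (cindic R E s * cindic R F (t - s)) =
    fine (mu (slice E F t)).
  rewrite /Rintegral; congr fine.
  rewrite -[X in mu X]setIT -integral_indic//; last exact: measurable_slice.
  by apply: eq_integral => s _; rewrite prod.
have -> : \int[mu]_(s in setT) complex.Im (cindic R E s * cindic R F (t - s)) = 0.
  rewrite /Rintegral (eq_integral (cst 0%E)) ?integral0// => s _.
  by rewrite prod.
by [].
Qed.

(** If [q] lies under the plateau [c 1_W] and has the mass of the smaller
    plateau [c 1_K], it is close to the latter when [W \ K] is small: both are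
    then close to [c 1_W], by integrating nonnegative differences. *)
Lemma plateau_estimate (q : borel G -> R) (K W : set G) (c b d : R) :
  measurable_fun setT q -> (forall t, 0 <= q t) ->
  (forall t, q t <= c * \1_(W : set (borel G)) t) ->
  measurable (K : set (borel G)) -> measurable (W : set (borel G)) -> K `<=` W ->
  (mu (K : set (borel G)) < +oo)%E ->
  (mu (W `\` K : set (borel G)) <= d%:E)%E -> 0 <= c -> 0 <= b ->
  (forall t, W t -> w t <= b) ->
  (\int[mu]_t (q t)%:E = c%:E * mu (K : set (borel G)))%E ->
  wintegrable (fun t => (q t)%:C%C) ->
  rnorm (cls (fun t => (q t)%:C%C) - c%:C%C *: cls (cindic R K)) <= 2 * b * d * c.
Proof.
move=> mq q0 qW mK mW KW Koo Wd c0 b0 wb qE qi.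
have wbK t : K t -> w t <= b by move=> /KW/wb.
have [Ki _] := wintegrable_cindic mK Koo b0 wbK.
have mWK : measurable (W `\` K : set (borel G)) by exact: measurableD.
have fK : mu (K : set (borel G)) \is a fin_num by rewrite ge0_fin_numE.
pose p t := c * \1_(W : set (borel G)) t - q t.
have p0 t : 0 <= p t by rewrite subr_ge0.
have m1W : measurable_fun setT (fun t : borel G => c * \1_(W : set (borel G)) t).
  by apply: measurable_funM => //; exact: measurable_indic.
have mp : measurable_fun setT p by exact: measurable_funB.
have pint : (\int[mu]_t (p t)%:E = c%:E * mu (W `\` K : set (borel G)))%E.
  have qfin : (\int[mu]_t (q t)%:E)%E \is a fin_num by rewrite qE fin_numM.
  have : (\int[mu]_t (p t)%:E + \int[mu]_t (q t)%:E =
      c%:E * mu (W `\` K : set (borel G)) + \int[mu]_t (q t)%:E)%E.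
    rewrite -ge0_integralD//; last 4 first.
    - by move=> t _; rewrite lee_fin.
    - exact/measurable_EFinP.
    - by move=> t _; rewrite lee_fin.
    - exact/measurable_EFinP.
    rewrite qE -ge0_muleDr//.
    rewrite (_ : (mu (W `\` K) + mu K)%E = mu (W : set (borel G))); last first.
      by rewrite (measureDI _ mW mK) setIidr.
    rewrite -[X in (_ = _ * mu X)%E]setIT -integral_indic// -ge0_integralZl//; last first.
      by apply/measurable_EFinP; exact: measurable_indic.
    by apply: eq_integral => t _; rewrite -EFinD -EFinM subrK.
  by move=> h; rewrite -[LHS](addeK _ qfin) h addeK.
rewrite addrC -scaleNr -cls_linear// -lee_fin cls_norm; last exact: wintegrable_linear.
have mdiff : measurable_fun setT (fun t : borel G => (b * (p t + c * \1_(W `\` K : set (borel G)) t))%:E).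
  apply/measurable_EFinP; apply: measurable_funM => //; apply: measurable_funD => //.
  by apply: measurable_funM => //; exact: measurable_indic.
apply: (@le_trans _ _ (\int[mu]_t (b * (p t + c * \1_(W `\` K : set (borel G)) t))%:E)%E).
  apply: ge0_le_integral => //.
  - by move=> t _; rewrite lee_fin mulr_ge0 ?normc_ge0// ltW// weight_gt0.
  - apply/measurable_EFinP; apply: measurable_wdens.
    by have [] := wintegrable_linear (- c%:C%C) Ki qi.
  - move=> t _; rewrite lee_fin /cindic mulNr -real_complexM addrC -real_complexB normc_realE.
    have [Wt|Wt] := boolP (t \in W); last first.
      have qt0 : q t = 0.
        by apply/le_anti; rewrite q0 andbT; have := qW t; rewrite indicE (negbTE Wt) mulr0.
      have Kt : (t \in K) = false by apply/negP => /set_mem/KW/mem_set; apply/negP.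
      rewrite qt0 indicE Kt mulr0 subrr normr0 mul0r.
      by rewrite mulr_ge0// addr_ge0// mulr_ge0.
    rewrite mulrC; apply: ler_pM => //; first by rewrite ltW// weight_gt0.
      exact/wb/set_mem.
    have := q0 t; have := qW t; rewrite /p !indicE in_setD Wt /= mulr1.
    by case: (t \in K) => /= h1 h2; rewrite ?mulr1 ?mulr0 ?addr0 ?subr0;
      rewrite ler_norml; apply/andP; split; lra.
under eq_integral do rewrite EFinM.
rewrite ge0_integralZl//; last 2 first.
- apply/measurable_EFinP; apply: measurable_funD => //.
  by apply: measurable_funM => //; exact: measurable_indic.
- by move=> t _; rewrite lee_fin addr_ge0// mulr_ge0.
under eq_integral do rewrite EFinD EFinM.
rewrite ge0_integralD//; last 4 first.
- by move=> t _; rewrite lee_fin.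
- exact/measurable_EFinP.
- by move=> t _; rewrite mule_ge0// lee_fin.
- by apply: measurable_funeM; apply/measurable_EFinP; exact: measurable_indic.
rewrite pint ge0_integralZl//; last first.
  by apply/measurable_EFinP; exact: measurable_indic.
rewrite integral_indic// setIT.
apply: (@le_trans _ _ (b%:E * (c%:E * d%:E + c%:E * d%:E))%E).
  by rewrite lee_wpmul2l ?lee_fin// leeD// lee_wpmul2l ?lee_fin.
by rewrite -(EFinM c d) -EFinD -EFinM lee_fin; lra.
Qed.

End beurling_algebra.

(** * Convolution with small sets *)

Section local_approximation.
Variables (R : realType) (G : topologicalZmodType).
Hypothesis G_hausdorff : hausdorff_space G.
Hypothesis G_locally_compact : locally_compact [set: G].
Variable mu : {measure set (borel G) -> \bar R}.
Hypothesis mu_haar : haar_measure mu.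
Variable w : weight R G.

Local Notation A := (beurling mu w).
Local Notation cls := (beurling_class mu w).
Local Notation wintegrable := (wintegrable mu w).
Local Notation conv := (convolution mu).
Local Notation mul := (@beurling_mul R G mu w).
Local Notation L := (@beurling_translate R G mu w).
Local Notation vol E := (fine (mu (E : set (borel G)))).

Lemma integrable_indic_finite (E : set (borel G)) : measurable E -> (mu E < +oo)%E ->
  mu.-integrable setT (EFin \o (\1_E : borel G -> R)).
Proof.
move=> mE Eoo; apply/integrableP; split.
  by apply/measurable_EFinP; exact: measurable_indic.
under eq_integral do rewrite /= ger0_norm//.
by rewrite integral_indic// setIT.
Qed.

Lemma slice_indicE (E F : set (borel G)) t : measurable E -> measurable F ->
  (\int[mu]_s ((\1_E s * \1_F (t - s)%R)%R)%:E = mu (slice E F t))%E.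
Proof.
move=> mE mF; rewrite -[X in mu X]setIT -integral_indic//; last exact: measurable_slice.
apply: eq_integral => s _.
by rewrite -[slice E F t]/(E `&` (fun s => t - s) @^-1` F) indicI.
Qed.

Lemma integral_mu_slice (E F : set (borel G)) : measurable E -> measurable F ->
  (mu E < +oo)%E -> (mu F < +oo)%E ->
  (\int[mu]_t mu (slice E F t) = mu E * mu F)%E.
Proof.
move=> mE mF Eoo Foo.
have indic_ge0 (B : set (borel G)) s : 0 <= \1_B s :> R by [].
have := tonelli_convolution G_hausdorff G_locally_compact mu_haar
  (f := \1_E) (g := \1_F) (indic_ge0 E) (indic_ge0 F)
  (integrable_indic_finite mE Eoo) (integrable_indic_finite mF Foo).
rewrite !integral_indic// !setIT => <-.
by apply: eq_integral => t _; rewrite slice_indicE.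
Qed.

Lemma subset_vol_le (E F : set G) : measurable (E : set (borel G)) ->
  measurable (F : set (borel G)) -> E `<=` F -> (mu (F : set (borel G)) < +oo)%E ->
  vol E <= vol F.
Proof.
move=> mE mF EF Foo.
have EFm : (mu (E : set (borel G)) <= mu (F : set (borel G)))%E by rewrite le_measure ?inE.
rewrite fine_le// ge0_fin_numE//; exact: le_lt_trans EFm Foo.
Qed.

Lemma vol_ge0 (E : set G) : 0 <= vol E.
Proof. by apply: fine_ge0; exact: measure_ge0. Qed.

(** A window [W] around [K], hardly larger than [K], which contains the
    translates of [K] by a whole neighbourhood of [0]. *)
Lemma compact_window (N K : set G) (d : R) : compact N -> nbhs 0 N -> compact K -> 0 < d ->
  exists V W : set G, [/\ nbhs 0 V, measurable (W : set (borel G)), K `<=` W,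
    (mu (W `\` K : set (borel G)) <= d%:E)%E &
    [/\ V `<=` N, W `<=` setadd K N & forall x v, K x -> V v -> W (x + v)]].
Proof.
move=> cN N0 cK d0; have mK := compact_borel G_hausdorff cK.
have [U [oU KU Ud]] := haar_outer mu_haar mK (haar_compact mu_haar cK) d0.
have V0 := compact_thicken cK oU KU.
have mKN : measurable (setadd K N : set (borel G)).
  by apply: (compact_borel G_hausdorff); exact: compact_setadd.
have mU := open_borel oU.
exists ([set n | forall x, K x -> U (x + n)] `&` N), (U `&` setadd K N); split.
- exact: filterI.
- exact: measurableI.
- move=> x Kx; split; first exact: KU.
  by exists x => //; exists 0; [exact: nbhs_singleton|rewrite addr0].
- apply: le_trans (ltW Ud); rewrite le_measure ?inE//.
  + by apply: measurableD => //; exact: measurableI.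
  + exact: measurableD.
  + by move=> x [[Ux _] nK].
- split; [by move=> x []|by move=> x []|].
  by move=> x v Kx [Vv Nv]; split; [exact: Vv|exists x => //; exists v].
Qed.

Lemma plateau_scale (b e : R) : 0 <= b -> 0 < e -> 2 * b * (e / (2 * b + 1)) <= e.
Proof.
move=> b0 e0; have b1 : 0 < 2 * b + 1 by rewrite ltr_wpDl// mulr_ge0.
by rewrite mulrCA ger_pMr// ler_pdivrMr// mul1r lerDl.
Qed.

Lemma measurable_vol_slice (K : set G) (E F : set (borel G)) : compact K ->
  measurable E -> measurable F -> E `<=` K ->
  measurable_fun setT (fun t : borel G => fine (mu (slice E F t))).
Proof.
move=> cK mE mF EK; apply: (measurableT_comp (f := fine)) => //.
exact: measurable_mu_slice cK _ _ _.
Qed.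

Lemma mu_compact_subset (K : set G) (E : set (borel G)) : compact K -> measurable E ->
  E `<=` K -> (mu E < +oo)%E.
Proof.
move=> cK mE EK; apply: le_lt_trans (haar_compact mu_haar cK).
by rewrite le_measure ?inE//; exact: (compact_borel G_hausdorff).
Qed.

Lemma integral_vol_slice (K : set G) (E F : set (borel G)) : compact K ->
  measurable E -> measurable F -> E `<=` K -> (mu F < +oo)%E ->
  (\int[mu]_t (fine (mu (slice E F t)))%:E = mu E * mu F)%E.
Proof.
move=> cK mE mF EK Foo; have Eoo := mu_compact_subset cK mE EK.
rewrite -integral_mu_slice//; apply: eq_integral => t _; rewrite fineK//.
rewrite ge0_fin_numE//; apply: le_lt_trans Eoo; rewrite le_measure ?inE//.
  exact: measurable_slice.
by move=> s [].
Qed.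

Lemma wintegrable_vol_slice (E F : set G) : measurable (E : set (borel G)) ->
  measurable (F : set (borel G)) ->
  wintegrable (cindic R E) -> wintegrable (cindic R F) ->
  wintegrable (fun t => (fine (mu (slice E F t)))%:C%C) /\
  mul (cls (cindic R E)) (cls (cindic R F)) = cls (fun t => (fine (mu (slice E F t)))%:C%C).
Proof.
move=> mE mF Ei Fi.
have <- : conv (cindic R E) (cindic R F) = (fun t => (fine (mu (slice E F t)))%:C%C).
  by apply/funext => t; exact: conv_cindic.
rewrite mul_cls//; split => //.
by have [] := wintegrable_conv G_hausdorff G_locally_compact mu_haar Ei Fi.
Qed.

Lemma wintegrable_cindic_sub (K E : set G) : compact K -> measurable (E : set (borel G)) ->
  E `<=` K -> wintegrable (cindic R E).
Proof.
move=> cK mE EK; have [b b0 wb] := compact_weight_bounded w cK.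
have [] // := @wintegrable_cindic _ _ mu w E b mE (mu_compact_subset cK mE EK) b0.
by move=> t /EK/wb.
Qed.

(** With [E] close to [s], the convolution of the indicators of [E] and [K] lies
    under the plateau of height [mu E] over [s + W], where [W] is the window of
    [compact_window], and has integral [mu E * mu K]: [plateau_estimate]
    applies. *)
Lemma small_set_translate (F K : set G) (e : R) : compact F -> compact K -> 0 < e ->
  exists2 V : set G, nbhs 0 V & forall (s : G) (E : set G), F s ->
    measurable (E : set (borel G)) -> E `<=` F -> (forall x, E x -> V (x - s)) ->
    rnorm (mul (cls (cindic R E)) (cls (cindic R K)) -
      (vol E)%:C%C *: L s (cls (cindic R K))) <= e * vol E.
Proof.
move=> cF cK e0; have [N N0 cN] := compact_nbhs0 G_locally_compact.
have mK := compact_borel G_hausdorff cK; have Koo := haar_compact mu_haar cK.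
have Ki := wintegrable_cindic_compact G_hausdorff mu_haar w cK.
have cH : compact (setadd F (setadd K N)) by do 2 apply: compact_setadd => //.
have [b b0 wb] := compact_weight_bounded w cH.
have d0 : 0 < e / (2 * b + 1) by rewrite divr_gt0// ltr_wpDl// mulr_ge0.
have [V [W [V0 mW KW Wd [VN WKN KVW]]]] := compact_window cN N0 cK d0.
exists V => // s E Fs mE EF EV.
have Eoo := mu_compact_subset cF mE EF.
have Ei := wintegrable_cindic_sub cF mE EF.
have [qi ->] := wintegrable_vol_slice mE mK Ei Ki.
pose T (B : set G) : set G := (fun t => - s + t) @^-1` B.
have mT (B : set G) : measurable (B : set (borel G)) -> measurable (T B : set (borel G)).
  by move=> mB; exact: borel_addl.
have -> : L s (cls (cindic R K)) = cls (cindic R (T K)).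
  rewrite translate_cls//; congr beurling_class; apply/funext => t.
  by rewrite /translate /cindic !indicE addrC; congr ((_%:R)%:C)%C.
apply: (@le_trans _ _ (2 * b * (e / (2 * b + 1)) * vol E)); last first.
  by rewrite ler_wpM2r ?vol_ge0// plateau_scale.
apply: (@plateau_estimate _ _ _ _ _ (T K) (T W)) => //.
- exact: measurable_vol_slice cF _ _ _.
- move=> t; rewrite indicE; case: (boolP (t \in _)) => [_|/negP Wt].
    rewrite mulr1; apply: subset_vol_le => //; first exact: measurable_slice.
    by move=> x [].
  rewrite mulr0 (_ : slice _ _ _ = set0) ?measure0//.
  apply/seteqP; split => // x [Ex Kx]; apply: Wt; rewrite inE /T /=.
  rewrite (_ : - s + t = (t - x) + (x - s)); last by rewrite addrA subrK addrC.
  by apply: KVW => //; exact: EV.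
- exact: mT.
- exact: mT.
- by move=> t /KW.
- by rewrite (haar_addl mu_haar).
- rewrite (_ : T W `\` T K = T (W `\` K))//.
  by rewrite (haar_addl mu_haar)//; exact: measurableD.
- move=> t /WKN [k Kk [n Nn knE]]; apply: wb; exists s => //; exists (k + n).
    by exists k => //; exists n.
  by rewrite knE addrA subrr add0r.
- rewrite (integral_vol_slice cF)// (haar_addl mu_haar)// fineK//.
  by rewrite ge0_fin_numE.
Qed.

(** The same estimate with the roles of the factors exchanged. The symmetry of
    [E] makes the height [mu (t - E)] of the plateau equal to [mu (t + E)],
    which is [mu E] by invariance. *)
Lemma small_set_unit (N K : set G) (e : R) : compact N -> nbhs 0 N -> compact K -> 0 < e ->
  exists2 V : set G, nbhs 0 V & forall (E : set G), measurable (E : set (borel G)) ->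
    E `<=` V -> E `<=` N -> (forall x, E x -> E (- x)) ->
    rnorm (mul (cls (cindic R K)) (cls (cindic R E)) -
      (vol E)%:C%C *: cls (cindic R K)) <= e * vol E.
Proof.
move=> cN N0 cK e0.
have mK := compact_borel G_hausdorff cK; have Koo := haar_compact mu_haar cK.
have Ki := wintegrable_cindic_compact G_hausdorff mu_haar w cK.
have cH : compact (setadd K N) by exact: compact_setadd.
have [b b0 wb] := compact_weight_bounded w cH.
have d0 : 0 < e / (2 * b + 1) by rewrite divr_gt0// ltr_wpDl// mulr_ge0.
have [V [W [V0 mW KW Wd [VN WKN KVW]]]] := compact_window cN N0 cK d0.
exists V => // E mE EV EN Esym.
have Eoo := mu_compact_subset cN mE EN.
have Ei := wintegrable_cindic_sub cN mE EN.
have [qi ->] := wintegrable_vol_slice mK mE Ki Ei.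
apply: (@le_trans _ _ (2 * b * (e / (2 * b + 1)) * vol E)); last first.
  by rewrite ler_wpM2r ?vol_ge0// plateau_scale.
apply: (@plateau_estimate _ _ _ _ _ K W) => //.
- exact: measurable_vol_slice cK _ _ _.
- move=> t; rewrite indicE; case: (boolP (t \in _)) => [_|/negP Wt].
    rewrite mulr1 -[vol E](congr1 fine (haar_addl mu_haar (- t) mE)).
    have mtE : measurable ((fun s : G => - t + s) @^-1` E : set (borel G)) by exact: borel_addl.
    apply: subset_vol_le => //; first exact: measurable_slice.
      by move=> x [_ /Esym]; rewrite /= opprB addrC.
    by rewrite (haar_addl mu_haar).
  rewrite mulr0 (_ : slice _ _ _ = set0) ?measure0//.
  apply/seteqP; split => // x [Kx Ex]; apply: Wt; rewrite inE.
  by rewrite -(subrK x t) addrC; apply: KVW => //; exact: EV.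
- by move=> t /WKN; exact: wb.
- rewrite (integral_vol_slice cK)// fineK 1?muleC//.
  by rewrite ge0_fin_numE.
Qed.

End local_approximation.

(** * Convolutions as limits of translations *)

Section translation_approximation.
Variables (R : realType) (G : topologicalZmodType).
Hypothesis G_hausdorff : hausdorff_space G.
Hypothesis G_locally_compact : locally_compact [set: G].
Variable mu : {measure set (borel G) -> \bar R}.
Hypothesis mu_haar : haar_measure mu.
Variable w : weight R G.

Local Notation A := (beurling mu w).
Local Notation cls := (beurling_class mu w).
Local Notation wintegrable := (wintegrable mu w).
Local Notation mul := (@beurling_mul R G mu w).
Local Notation L := (@beurling_translate R G mu w).
Local Notation vol E := (fine (mu (E : set (borel G)))).
Local Notation mulDl := (beurling_mul_linearl G_hausdorff G_locally_compact mu_haar).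
Local Notation mulDr := (beurling_mul_linearr G_hausdorff G_locally_compact mu_haar).
Local Notation mul_le := (beurling_mul_le G_hausdorff G_locally_compact mu_haar).

Lemma ler_half_frac (C e : R) : 0 <= C -> 0 < e -> C * (e / (2 * (C + 1))) <= e / 2.
Proof.
move=> C0 e0; have C1 : 0 < C + 1 by rewrite ltr_wpDl.
rewrite (_ : C * _ = C / (C + 1) * (e / 2)); last by field; rewrite gt_eqF.
by rewrite ler_piMl ?divr_ge0 ?(ltW e0)// ler_pdivrMr// mul1r lerDl.
Qed.

Lemma divr_2frac_gt0 (C e : R) : 0 <= C -> 0 < e -> 0 < e / (2 * (C + 1)).
Proof. by move=> C0 e0; rewrite divr_gt0// mulr_gt0// ltr_wpDl. Qed.

(** The uniform bound on the [T i] carries smallness to limits, so that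
    [density_ind] applies. In the applications the indices are Borel sets, [m]
    is their measure, and [ok V] asks that they be contained in [V] up to a
    translation. *)
Lemma eventually_small (I : Type) (ok : set G -> I -> Prop) (T : I -> A -> A)
    (m : I -> R) (C : R) (V0 : set G) :
  nbhs 0 V0 -> 0 <= C -> (forall V V' i, V `<=` V' -> ok V i -> ok V' i) ->
  (forall i, linear (T i)) -> (forall i, 0 <= m i) ->
  (forall i x, ok V0 i -> rnorm (T i x) <= C * m i * rnorm x) ->
  (forall K e, compact K -> 0 < e -> exists2 V, nbhs 0 V &
    forall i, ok V i -> rnorm (T i (cls (cindic R K))) <= e * m i) ->
  forall x e, 0 < e -> exists2 V, nbhs 0 V & forall i, ok V i -> rnorm (T i x) <= e * m i.
Proof.
move=> V00 C0 ok_mono T_lin m0 T_le T_ind.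
apply: (density_ind G_hausdorff mu_haar) => [a x y Px Py e e0|x xP e e0|K cK e e0].
- have [Vx Vx0 Tx] := Px _ (divr_2frac_gt0 (normc_ge0 a) e0).
  have e2 : 0 < e / 2 by rewrite divr_gt0.
  have [Vy Vy0 Ty] := Py _ e2.
  exists (Vx `&` Vy); first exact: filterI.
  move=> i oki; rewrite T_lin; apply: le_trans (rnormD _ _) _.
  rewrite [e in e * _]splitr mulrDl rnormZ; apply: lerD.
    apply: le_trans (ler_wpM2l (normc_ge0 a) (Tx i (ok_mono _ _ _ _ oki))) _; first by move=> ? [].
    by rewrite mulrA ler_wpM2r// ler_half_frac// normc_ge0.
  by apply: Ty; apply: ok_mono oki => ? [].
- have [y Py xy] := xP _ (divr_2frac_gt0 C0 e0).
  have e2 : 0 < e / 2 by rewrite divr_gt0.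
  have [Vy Vy0 Ty] := Py _ e2.
  exists (Vy `&` V0); first exact: filterI.
  move=> i oki; have -> : T i x = T i (x - y) + T i y.
    by have := T_lin i 1 (x - y) y; rewrite !scale1r subrK.
  apply: le_trans (rnormD _ _) _; rewrite [e in e * _]splitr mulrDl; apply: lerD.
    have okV0 : ok V0 i by apply: ok_mono oki => ? [].
    apply: le_trans (T_le i (x - y) okV0) _; rewrite mulrAC ler_wpM2r//.
    by apply: le_trans (ler_half_frac C0 e0); rewrite ler_wpM2l.
  by apply: Ty; apply: ok_mono oki => ? [].
- exact: T_ind.
Qed.

Lemma rnorm_cindic_le (K E : set G) (b : R) : compact K -> measurable (E : set (borel G)) ->
  E `<=` K -> 0 <= b -> (forall t, K t -> w t <= b) -> rnorm (cls (cindic R E)) <= b * vol E.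
Proof.
move=> cK mE EK b0 wb; have Eoo := mu_compact_subset G_hausdorff mu_haar cK mE EK.
have [|_] := wintegrable_cindic mE Eoo b0 (w := w); first by move=> t /EK/wb.
by rewrite -{1}[mu E]fineK ?ge0_fin_numE// -EFinM lee_fin.
Qed.

Lemma small_set_translate_all (F : set G) x (e : R) : compact F -> 0 < e ->
  exists2 V : set G, nbhs 0 V & forall (s : G) (E : set G), F s ->
    measurable (E : set (borel G)) -> E `<=` F -> (forall x, E x -> V (x - s)) ->
    rnorm (mul (cls (cindic R E)) x - (vol E)%:C%C *: L s x) <= e * vol E.
Proof.
move=> cF e0; have [b b0 wb] := compact_weight_bounded w cF.
pose ok (V : set G) (i : G * set G) := [/\ F i.1, measurable (i.2 : set (borel G)),
  i.2 `<=` F & forall x, i.2 x -> V (x - i.1)].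
pose T (i : G * set G) (x : A) := mul (cls (cindic R i.2)) x - (vol i.2)%:C%C *: L i.1 x.
suff [V V0 VT] : exists2 V, nbhs 0 V & forall i, ok V i -> rnorm (T i x) <= e * vol i.2.
  by exists V => // s E Fs mE EF EV; apply: (VT (s, E)).
apply: (@eventually_small _ ok T (fun i => vol i.2) (3 * b) setT _ _ _ _ _ _ _ x e e0).
- exact: filterT.
- by rewrite mulr_ge0.
- by move=> V V' i VV' [? ? ? h]; split => // z /h/VV'.
- move=> i a y z; rewrite /T mulDr beurling_translate_linear// scalerDr scalerBr opprD addrACA.
  by rewrite !scalerA mulrC.
- by move=> i; exact: vol_ge0.
- move=> i z [Fs mE EF _]; have Eb := rnorm_cindic_le cF mE EF b0 wb.
  rewrite /T; apply: le_trans (rnormD _ _) _; rewrite rnormN.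
  have -> : 3 * b * vol i.2 * rnorm z = 2 * (b * vol i.2) * rnorm z + vol i.2 * (b * rnorm z) by ring.
  apply: lerD.
    by apply: le_trans (mul_le _ _) _; rewrite ler_wpM2r ?rnorm_ge0// ler_wpM2l.
  rewrite rnormZ normc_real ?vol_ge0// ler_wpM2l ?vol_ge0//.
  apply: le_trans (beurling_translate_le mu_haar _ _) _.
  by rewrite ler_wpM2r ?rnorm_ge0//; exact: wb.
- move=> K d cK d0; have [V V0 h] := small_set_translate G_hausdorff G_locally_compact mu_haar w cF cK d0.
  by exists V => // -[s E] [/= Fs mE EF EV]; exact: h.
Qed.

Lemma comb_cat S1 S2 x :
  translation_comb L (S1 ++ S2) x = translation_comb L S1 x + translation_comb L S2 x.
Proof. by rewrite /translation_comb big_cat. Qed.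

Lemma comb_scale a S x :
  translation_comb L [seq (a * p.1, p.2) | p <- S] x = a *: translation_comb L S x.
Proof.
rewrite /translation_comb big_map scaler_sumr.
by apply: eq_bigr => p _; rewrite scalerA.
Qed.

Lemma cindicU (E F : set G) : measurable (E : set (borel G)) ->
  measurable (F : set (borel G)) -> wintegrable (cindic R (E `&` F)) ->
  wintegrable (cindic R (E `\` F)) ->
  cls (cindic R E) = cls (cindic R (E `&` F)) + cls (cindic R (E `\` F)).
Proof.
move=> mE mF i1 i2; rewrite -[X in _ = X + _]scale1r -cls_linear//.
congr beurling_class; apply/funext => t; rewrite mul1r /cindic -real_complexD !indicE.
by rewrite in_setI in_setD; case: (t \in E) (t \in F) => [] []; rewrite ?addr0 ?add0r.
Qed.

(** Cover [F] by finitely many small sets, make them disjoint, and replace the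
    convolution by each of them with a multiple of a translation; the errors are
    proportional to the measures of the pieces, so that they add up. *)
Lemma mul_cindic_approx (F : set G) x y (e : R) : compact F -> 0 < e ->
  exists S, rnorm (mul (cls (cindic R F)) x - translation_comb L S x) <= e /\
            rnorm (mul (cls (cindic R F)) y - translation_comb L S y) <= e.
Proof.
move=> cF e0; have mF := compact_borel G_hausdorff cF.
pose e' := e / (vol F + 1).
have e'0 : 0 < e' by rewrite divr_gt0// ltr_wpDl// vol_ge0.
have [Vx Vx0 Tx] := small_set_translate_all x cF e'0.
have [Vy Vy0 Ty] := small_set_translate_all y cF e'0.
pose V := interior (Vx `&` Vy).
have oV : open V by exact: open_interior.
have V0 : V 0 by apply: filterI.
have VVx : V `<=` Vx by move=> z /interior_subset[].
have VVy : V `<=` Vy by move=> z /interior_subset[].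
have [l lF Fl] := compact_finite_cover cF oV V0.
suff cover (E : set G) : measurable (E : set (borel G)) -> E `<=` F ->
    E `<=` [set z | exists2 s, s \in l & V (z - s)] -> exists S,
    rnorm (mul (cls (cindic R E)) x - translation_comb L S x) <= e' * vol E /\
    rnorm (mul (cls (cindic R E)) y - translation_comb L S y) <= e' * vol E.
  have le_e : e' * vol F <= e.
    by rewrite mulrAC ler_pdivrMr ?ltr_wpDl ?vol_ge0// ler_pM2l// lerDl.
  have [S [Sx Sy]] := cover F mF (@subset_refl _ F) Fl.
  by exists S; split; [exact: le_trans Sx le_e|exact: le_trans Sy le_e].
elim: l lF {Fl} E => [|s l IH] lF E mE EF El.
  have -> : E = set0 by apply/seteqP; split => // z /El[].
  exists [::]; rewrite /translation_comb !big_nil cls_cindic0 measure0 mulr0 !subr0.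
  by rewrite !(lin0 (mulDl _)) rnorm0.
pose B : set (borel G) := (fun z : G => - s + z) @^-1` V.
have mB : measurable B by apply: borel_addl; exact: open_borel.
have mEB : measurable (E `&` B : set (borel G)) by exact: measurableI.
have mED : measurable (E `\` B : set (borel G)) by exact: measurableD.
have EBF : E `&` B `<=` F by move=> z [/EF].
have EDF : E `\` B `<=` F by move=> z [/EF].
have lF' : {in l, forall s, F s} by move=> z zl; apply: lF; rewrite inE zl orbT.
have ED : E `\` B `<=` [set z | exists2 s, s \in l & V (z - s)].
  move=> z [Ez nBz]; have [r] := El z Ez; rewrite inE => /orP[/eqP ->|rl Vr]; last by exists r.
  by move=> Vs; exfalso; apply: nBz; rewrite /B /= addrC.
have [S [Sx Sy]] := IH lF' (E `\` B) mED EDF ED.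
have Fs : F s by apply: lF; rewrite inE eqxx.
have i1 := wintegrable_cindic_sub G_hausdorff mu_haar w cF mEB EBF.
have i2 := wintegrable_cindic_sub G_hausdorff mu_haar w cF mED EDF.
have volE : vol E = vol (E `&` B) + vol (E `\` B).
  rewrite addrC (measureDI _ mE mB) fineD// ge0_fin_numE//.
    exact: mu_compact_subset EDF.
  exact: mu_compact_subset EBF.
have step z (Vz : set G) : V `<=` Vz -> (forall (s : G) (E : set G), F s ->
    measurable (E : set (borel G)) -> E `<=` F -> (forall x, E x -> Vz (x - s)) ->
    rnorm (mul (cls (cindic R E)) z - (vol E)%:C%C *: L s z) <= e' * vol E) ->
    rnorm (mul (cls (cindic R (E `\` B))) z - translation_comb L S z) <= e' * vol (E `\` B) ->
    rnorm (mul (cls (cindic R E)) z - translation_comb L (((vol (E `&` B))%:C%C, s) :: S) z) <=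
      e' * vol E.
  move=> VVz Tz Sz; rewrite (cindicU mE mB i1 i2) (linD (mulDl z)).
  rewrite /translation_comb big_cons opprD addrACA volE mulrDr.
  apply: le_trans (rnormD _ _) _; apply: lerD => //.
  apply: Tz => // r [Er Br]; apply: VVz; move: Br; rewrite /B /= addrC.
  by [].
exists (((vol (E `&` B))%:C%C, s) :: S); split; [exact: (step x Vx)|exact: (step y Vy)].
Qed.

Lemma beurling_mul_approx c x y (e : R) : 0 < e ->
  exists S, rnorm (mul c x - translation_comb L S x) <= e /\
            rnorm (mul c y - translation_comb L S y) <= e.
Proof.
elim/(density_ind G_hausdorff mu_haar): c e => [a c c' Pc Pc' e e0|c cP e e0|K cK e e0].
- have [S [Sx Sy]] := Pc _ (divr_2frac_gt0 (normc_ge0 a) e0).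
  have e2 : 0 < e / 2 by rewrite divr_gt0.
  have [S' [S'x S'y]] := Pc' _ e2.
  exists ([seq (a * p.1, p.2) | p <- S] ++ S').
  have step z : rnorm (mul c z - translation_comb L S z) <= e / (2 * (normc a + 1)) ->
      rnorm (mul c' z - translation_comb L S' z) <= e / 2 ->
      rnorm (mul (a *: c + c') z - translation_comb L ([seq (a * p.1, p.2) | p <- S] ++ S') z) <= e.
    move=> Sz S'z; rewrite mulDl comb_cat comb_scale opprD addrACA -scalerBr.
    apply: le_trans (rnormD _ _) _; rewrite [e]splitr rnormZ; apply: lerD => //.
    apply: le_trans (ler_half_frac (normc_ge0 a) e0).
    by rewrite ler_wpM2l ?normc_ge0.
  by split; exact: step.
- have C0 : 0 <= 2 * (rnorm x + rnorm y) by rewrite mulr_ge0// addr_ge0// rnorm_ge0.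
  have [c' Pc' cc'] := cP _ (divr_2frac_gt0 C0 e0).
  have e2 : 0 < e / 2 by rewrite divr_gt0.
  have [S [Sx Sy]] := Pc' _ e2.
  exists S.
  have step z : rnorm z <= rnorm x + rnorm y ->
      rnorm (mul c' z - translation_comb L S z) <= e / 2 ->
      rnorm (mul c z - translation_comb L S z) <= e.
    move=> zxy Sz; apply: le_trans (rnorm_le_split _ (mul c' z) _) _.
    rewrite [e]splitr lerD// -(linB (mulDl z)); apply: le_trans (mul_le _ _) _.
    apply: le_trans (ler_half_frac C0 e0); rewrite mulrAC.
    by apply: ler_pM; rewrite ?mulr_ge0 ?rnorm_ge0// ler_wpM2l.
  by split; apply: step => //; rewrite ?lerDl ?lerDr rnorm_ge0.
- exact: mul_cindic_approx.
Qed.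

Lemma small_set_unit_all (N : set G) x (e : R) : compact N -> nbhs 0 N -> 0 < e ->
  exists2 V : set G, nbhs 0 V & forall (E : set G), measurable (E : set (borel G)) ->
    E `<=` V -> E `<=` N -> (forall x, E x -> E (- x)) ->
    rnorm (mul x (cls (cindic R E)) - (vol E)%:C%C *: x) <= e * vol E.
Proof.
move=> cN N0 e0; have [b b0 wb] := compact_weight_bounded w cN.
pose ok (V : set G) (E : set G) := [/\ measurable (E : set (borel G)), E `<=` V, E `<=` N &
  forall x, E x -> E (- x)].
pose T (E : set G) (x : A) := mul x (cls (cindic R E)) - (vol E)%:C%C *: x.
suff [V V0 VT] : exists2 V, nbhs 0 V & forall E, ok V E -> rnorm (T E x) <= e * vol E.
  by exists V => // E mE EV EN Es; apply: VT.
apply: (@eventually_small _ ok T (fun E => vol E) (2 * b + 1) setT _ _ _ _ _ _ _ x e e0).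
- exact: filterT.
- by rewrite addr_ge0// mulr_ge0.
- by move=> V V' E VV' [? h ? ?]; split => // z /h/VV'.
- move=> E a y z; rewrite /T mulDl scalerDr scalerBr opprD addrACA.
  by rewrite !scalerA mulrC.
- by move=> E; exact: vol_ge0.
- move=> E z [mE _ EN _]; have Eb := rnorm_cindic_le cN mE EN b0 wb.
  rewrite /T; apply: le_trans (rnormD _ _) _; rewrite rnormN.
  have -> : (2 * b + 1) * vol E * rnorm z = 2 * rnorm z * (b * vol E) + vol E * rnorm z by ring.
  apply: lerD; last by rewrite rnormZ normc_real ?vol_ge0.
  by apply: le_trans (mul_le _ _) _; rewrite ler_wpM2l ?mulr_ge0 ?rnorm_ge0.
- move=> K d cK d0; have [V V0 h] := small_set_unit G_hausdorff G_locally_compact mu_haar w cN N0 cK d0.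
  by exists V => // E [mE EV EN Es]; exact: h.
Qed.

(** Normalized indicators of small symmetric open sets are approximate units. *)
Lemma beurling_right_unit_approx x y (e : R) : 0 < e ->
  exists u, rnorm (mul x u - x) <= e /\ rnorm (mul y u - y) <= e.
Proof.
move=> e0; have [N N0 cN] := compact_nbhs0 G_locally_compact.
have [Vx Vx0 Tx] := small_set_unit_all x cN N0 e0.
have [Vy Vy0 Ty] := small_set_unit_all y cN N0 e0.
pose V := interior (Vx `&` (Vy `&` N)).
have V0 : V 0 by do 2 apply: filterI => //.
pose E := V `&` -%R @^-1` V.
have oE : open E.
  by apply: openI; [exact: open_interior|apply: open_preimage (open_interior _); exact: opp_continuous].
have E0 : E 0 by split => //=; rewrite oppr0.
have EV : E `<=` Vx `&` (Vy `&` N) by move=> z [/interior_subset].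
have EVx : E `<=` Vx by move=> z /EV[].
have EVy : E `<=` Vy by move=> z /EV[_ []].
have EN : E `<=` N by move=> z /EV[_ []].
have Es z : E z -> E (- z) by move=> [Vz Vz']; split => //=; rewrite opprK.
have mE := open_borel oE.
have Eoo := mu_compact_subset G_hausdorff mu_haar cN mE EN.
have vE : 0 < vol E.
  rewrite fine_gt0// Eoo andbT; apply: (haar_open_gt0 G_hausdorff mu_haar oE).
  by exists 0.
exists ((vol E)^-1%:C%C *: cls (cindic R E)).
have step z : rnorm (mul z (cls (cindic R E)) - (vol E)%:C%C *: z) <= e * vol E ->
    rnorm (mul z ((vol E)^-1%:C%C *: cls (cindic R E)) - z) <= e.
  move=> h; rewrite (linZ (mulDr z)).
  have {2}-> : z = (vol E)^-1%:C%C *: ((vol E)%:C%C *: z).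
    by rewrite scalerA -real_complexM mulVf ?scale1r// gt_eqF.
  rewrite -scalerBr rnormZ normc_real ?invr_ge0 ?vol_ge0//.
  by rewrite ler_pdivrMl// mulrC.
by split; apply: step; [exact: Tx|exact: Ty].
Qed.

End translation_approximation.

(** * Cutoffs given by the growth condition *)

Section cutoff.
Variables (R : realType) (G : topologicalZmodType).
Hypothesis G_hausdorff : hausdorff_space G.
Variable mu : {measure set (borel G) -> \bar R}.
Hypothesis mu_haar : haar_measure mu.
Variable w : weight R G.

Local Notation A := (beurling mu w).
Local Notation cls := (beurling_class mu w).
Local Notation L := (@beurling_translate R G mu w).
Local Notation cut := (@beurling_cut R G mu w).

Lemma limn_einf_lt_exists (u : (\bar R)^nat) (a : \bar R) : (limn_einf u < a)%E ->
  exists2 n, (0 < n)%N & (u n < a)%E.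
Proof.
move=> ua; apply: contrapT => h; move: ua; apply/negP; rewrite -leNgt limn_einf_lim.
have -> : limn (einfs u) = ereal_sup (range (einfs u)) by apply/cvg_lim; last exact: cvg_einfs_sup.
apply: (@le_trans _ _ (einfs u 1)); last by apply: ereal_sup_ubound; exists 1%N.
apply: le_ereal_inf_tmp => _ [n /= n0 <-]; rewrite leNgt; apply/negP => un.
by apply: h; exists n.
Qed.

Lemma weight_hat_lt t (b : R) : (weight_hat w t < b%:E)%E ->
  exists2 K : set G, compact K & forall s, ~ K s -> w (t + s) <= b * w s.
Proof.
move=> /ereal_inf_lt[_ [K /= cK <-] Kb]; exists K => // s Ks.
rewrite -ler_pdivrMr ?weight_gt0// -lee_fin.
by apply: le_trans (ltW Kb); apply: ereal_sup_ubound; exists s.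
Qed.

(** The index [0] has to be avoided: the sequence is 0 there, as [0^-1 = 0]. *)
Lemma growth_weight_hat (m : R) t :
  (limn_einf (fun n : nat => (w (t *+ n)%R)%:E * weight_hat w (- (t *+ n))%R * (n%:R^-1)%:E)
     <= m%:E)%E ->
  exists2 n, (0 < n)%N & (weight_hat w (- (t *+ n))%R < ((w (t *+ n)%R)^-1 * ((m + 1) * n%:R))%R%:E)%E.
Proof.
move=> h; have mm : (m%:E < (m + 1)%:E)%E by rewrite lte_fin ltrDl.
have [n n0] := limn_einf_lt_exists (le_lt_trans h mm).
rewrite lte_pdivrMr ?ltr0n// -lte_pdivlMl ?weight_gt0// => hn.
by exists n.
Qed.

(** For [u] in [K], the bound [w s <= w (u + s) * w (- u)] compares [w u * w s]
    with the weight at the translated point [u + s]. *)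
Lemma cut_near (K : set G) : compact K ->
  exists C, forall s (x : A), w s * rnorm (cut K (L (- s) x)) <= C * rnorm x.
Proof.
move=> cK; have mK := compact_borel G_hausdorff cK.
have [b b0 wb] := compact_weight_bounded w cK.
have [b' b'0 wb'] := compact_weight_bounded w (compact_opp cK).
exists (b * b') => s; elim/cls_ind => f fi.
have [ti _] := wintegrable_translate mu_haar (- s) fi.
rewrite translate_cls// cut_cls// mulrC -ler_pdivlMr ?weight_gt0// mulrAC.
apply: (@wintegrable_dominated _ _ _ mu_haar w (- s) _ _ _ _ fi _ _).2 => [||u].
- by apply: cmeasurable_truncate => //; have [] := ti.
- by rewrite divr_ge0 ?mulr_ge0// ltW// weight_gt0.
rewrite normc_truncate indicE; case: (boolP (u \in K)) => [/set_mem Ku|_]; last first.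
  by rewrite mulr0 mul0r mulr_ge0 ?wdens_ge0// divr_ge0 ?mulr_ge0// ltW// weight_gt0.
rewrite mulr1 /translate mulrCA ler_wpM2l ?normc_ge0//.
rewrite mulrAC ler_pdivlMr ?weight_gt0//.
rewrite -mulrA; apply: ler_pM; rewrite ?(ltW (weight_gt0 _ _))//; first exact: wb.
rewrite opprK -{1}(addKr u s).
apply: le_trans (weight_submul _ _ _) _.
rewrite ler_wpM2r ?(ltW (weight_gt0 _ _))//; apply: wb'.
by exists u.
Qed.

Lemma cut_far (K : set G) t (b : R) (x : A) : compact K -> 0 <= b ->
  (forall u, ~ K u -> w u <= b * w (u + t)) ->
  rnorm (L (- t) x - cut K (L (- t) x)) <= b * rnorm x.
Proof.
move=> cK b0 wK; have mK := compact_borel G_hausdorff cK.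
elim/cls_ind: x => f fi.
have [ti _] := wintegrable_translate mu_haar (- t) fi.
have [tci _] := wintegrable_truncate mu_haar mK ti.
rewrite translate_cls// cut_cls// addrC -scaleN1r -cls_linear//.
apply: (@wintegrable_dominated _ _ _ mu_haar w (- t) _ _ _ _ fi b0 _).2 => [|u].
  by have [] := wintegrable_linear (- 1) tci ti.
rewrite /truncate /translate indicE; case: (boolP (u \in K)) => [/set_mem Ku|/negP Ku].
  by rewrite mulr1 mulN1r addNr ComplexField.Normc.normc0 mul0r mulr_ge0 ?wdens_ge0.
rewrite mulr0 mulr0 add0r mulrCA ler_wpM2l ?normc_ge0//.
by rewrite opprK; apply: wK => Ku'; apply: Ku; rewrite inE.
Qed.

(** The compact set given by [weight_hat_lt] controls [w (u - t *+ n) / w u]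
    outside it; translating it by [- (t *+ n)] makes it a condition on the
    translated function. *)
Lemma beurling_cutoff (m : R) t : 0 < m ->
  (limn_einf (fun n : nat => (w (t *+ n)%R)%:E * weight_hat w (- (t *+ n))%R * (n%:R^-1)%:E)
     <= m%:E)%E ->
  exists n : nat, exists P : A -> A,
  [/\ (0 < n)%N, linear P, forall x, rnorm (P x) <= rnorm x,
      exists C, forall s x, w s * rnorm (P (L (- s) x)) <= C * rnorm x &
      forall x, w (t *+ n) * rnorm (L (- (t *+ n)) x - P (L (- (t *+ n)) x)) <=
        (m + 1) * n%:R * rnorm x].
Proof.
move=> m0 /growth_weight_hat[n n0 /weight_hat_lt[K0 cK0 K0w]].
have cK := @compact_addl _ (- (t *+ n)) _ cK0.
have mK := compact_borel G_hausdorff cK.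
exists n, (cut [set - (t *+ n) + x | x in K0]); split => //.
- exact: beurling_cut_linear.
- by move=> x; exact: beurling_cut_le.
- exact: cut_near.
move=> x; rewrite mulrC -ler_pdivlMr ?weight_gt0// mulrAC [_ / w _]mulrC.
apply: cut_far => //.
  by rewrite mulr_ge0 ?invr_ge0 ?(ltW (weight_gt0 _ _))// mulr_ge0// addr_ge0// ltW.
move=> u Ku; rewrite -{1}(addKr (t *+ n) u) [u + _]addrC; apply: K0w => Ku'; apply: Ku.
by exists (t *+ n + u); rewrite ?addKr.
Qed.

End cutoff.

(** * Beurling algebras are 2-weakly amenable *)

Theorem theorem4p1 (R : realType) (G : topologicalZmodType)
  (G_hausdorff : hausdorff_space G)
  (G_locally_compact : locally_compact [set: G])
  (mu : {measure set (borel G) -> \bar R}) (mu_haar : haar_measure mu)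
  (w : weight R G) (m : R) (m_gt0 : 0 < m)
  (w_growth : forall t : G,
    (limn_einf (fun n : nat =>
       (w (t *+ n)%R)%:E * weight_hat w (- (t *+ n))%R * (n%:R^-1)%:E)
     <= m%:E)%E) :
  two_weakly_amenable (@beurling_mul R G mu w).
Proof.
apply: (@translation_algebra_two_weakly_amenable R (beurling mu w) G
  (@beurling_mul R G mu w) 2 _ _ _ _ (@beurling_translate R G mu w) w _ _ _ _ _ _ _ _ _ (m + 1)).
- by [].
- exact: beurling_mul_linearl.
- exact: beurling_mul_linearr.
- exact: beurling_mul_le.
- exact: weight_gt0.
- exact: beurling_translate_linear.
- exact: beurling_translate0.
- exact: beurling_translateD.
- exact: beurling_translate_le.
- exact: beurling_translate_mull.
- exact: beurling_translate_mulr.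
- exact: beurling_mul_approx.
- exact: beurling_right_unit_approx.
- by move=> t; exact: beurling_cutoff.
Qed.
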